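(* Let $W(x)=\sum_{n\ge1}\frac{W_n}{n}x^n$ and $W^\circ(x)=\sum_{n\ge1}\frac{W_n^\circ}{n}x^n$ in $\mathfrak P\otimes\mathbb Q[[x]]$, and let $\beta(x)=x-\sum_{n\ge1}\mathfrak a_n^\circ x^{n+1}$. Then $W^\circ(x)=W(\beta(x))$. Here $\beta$ is the compositional inverse of $\alpha(x)=x+\sum_{n\ge1}\mathfrak a_n x^{n+1}$.
   Context: $\mathfrak P$ is the commutative ring freely generated as an abelian group by combinatorial equivalence classes of convex polytopes, with multiplication the Cartesian product; the point is the unit $1$. For a polytope $Q$, let $\mathcal F(Q)$ be the set of nonempty faces of $Q$ (including $Q$), regarded as elements of $\mathfrak P$, and define its motivic interior $Q^\circ=\sum_{f\in\mathcal F(Q)}(-1)^{\operatorname{codim} f}f$. For a connected simple graph $\Gamma$ on $[n]$, the graph-associahedron is $P_\Gamma=\{x\in\mathbb R^n:\sum_i x_i=3^n,\ \sum_{i\in S}x_i\ge3^{|S|}\text{ for all proper nonempty }S\subset[n]\text{ with }\Gamma|_S\text{ connected}\}$. The associahedron $\mathfrak a_n$ is $P_\Gamma$ for $\Gamma$ the path with $n$ vertices, and $\mathfrak a_n^\circ$ its motivic interior (so $\mathfrak a_1=\mathfrak a_1^\circ=1$). The cyclohedron $W_n$ is $P_\Gamma$ for $\Gamma$ the $n$-cycle graph (for $n=1,2$, the connected graph with $n$ vertices, so $W_1$ is a point and $W_2$ a segment), and $W_n^\circ$ its motivic interior. *)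

(* Defs.v *)
From HB Require Import structures.
From mathcomp Require Import all_boot all_order all_algebra.
From mathcomp Require Import finmap.
From mathcomp Require Import mathcomp_extra boolp classical_sets functions.
From mathcomp Require Import fsbigop reals topology normedtype.
(* The notations of monalg clash with those of mathcomp-analysis:
   [malg K A] is the monoid algebra of [K] over [A], [mkmalgU k a] is the
   monomial [a k]. *)
From mathcomp.multinomials Require Import -(notations) monalg.

Set Implicit Arguments.
Unset Strict Implicit.
Unset Printing Implicit Defensive.

Import Order.TTheory GRing.Theory Num.Theory.
Import numFieldNormedType.Exports.
Local Open Scope classical_set_scope.
Local Open Scope ring_scope.
Local Open Scope quotient_scope.

Section Polytopes.
Variable R : realType.

Definition dot n (u v : 'rV[R]_n) : R := \sum_i u 0 i * v 0 i.

Definition hpolyhedron n (s : seq ('rV[R]_n * R)) : set 'rV[R]_n :=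
  [set x | forall h, h \in s -> dot h.1 x <= h.2].

(* Polytopes are nonempty; the ambient dimension may exceed the dimension. *)
Definition is_polytope n (P : set 'rV[R]_n) : Prop :=
  [/\ P !=set0, bounded_set P & exists s, P = hpolyhedron s].

Record polytope n := Polytope {
  pset :> set 'rV[R]_n;
  psetP : is_polytope pset }.

HB.instance Definition _ n := gen_eqMixin (polytope n).
HB.instance Definition _ n := gen_choiceMixin (polytope n).

Definition argmax n (c : 'rV[R]_n) (P : set 'rV[R]_n) : set 'rV[R]_n :=
  [set x | P x /\ forall y, P y -> dot c y <= dot c x].

(* The nonempty faces; c = 0 gives P itself. *)
Definition faces n (P : polytope n) : set (polytope n) :=
  [set F | exists c, F = argmax c P :> set _].

(* One less than the maximal number of affinely independent points. *)
Definition pdim n (P : set 'rV[R]_n) : nat :=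
  \max_(d < n.+1 | `[< exists (x : 'rV[R]_n) (A : 'M[R]_(d, n)),
      [/\ P x, forall i, P (x + row i A) & row_free A] >]) d.

(* Isomorphism of the posets of nonempty faces; adjoining the empty face as a
   least element to both posets does not change this relation. *)
Definition comb_equiv m n (P : polytope m) (Q : polytope n) : Prop :=
  exists f : polytope m -> polytope n,
    set_bij (faces P) (faces Q) f /\
    forall F G, faces P F -> faces P G -> (F `<=` G <-> f F `<=` f G).

Lemma polytope_inj n (P Q : polytope n) : P = Q :> set _ -> P = Q.
Proof.
case: P Q => [P hP] [Q hQ] /= PQ; rewrite PQ in hP *.
by rewrite (Prop_irrelevance hP hQ).
Qed.

Lemma bounded_setP n (P : set 'rV[R]_n) :
  bounded_set P <-> exists M : R, forall x, P x -> forall i, `|x 0 i| <= M.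
Proof.
split=> [[M [Mr bM]]|[M bM]].
  exists (M + 1) => x Px i.
  have xM : `|x| <= M + 1 by apply: bM => //; rewrite ltrDl.
  apply: le_trans xM; rewrite [leRHS]/Num.norm /= mx_normrE.
  by apply/bigmax_geP; right; exists (0, i).
exists (Num.max M 0); split=> [|N]; first exact: num_real.
rewrite gt_max => /andP[MN N0] x Px /=.
rewrite [leLHS]/Num.norm /= mx_normrE.
apply/bigmax_leP; split; first exact: ltW.
case=> a i _ /=; rewrite (ord1 a).
by apply: le_trans (bM _ Px i) _; exact: ltW.
Qed.

Lemma dot0 n (x : 'rV[R]_n) : dot 0 x = 0.
Proof. by rewrite /dot big1// => i _; rewrite mxE mul0r. Qed.

Lemma dotN n (c x : 'rV[R]_n) : dot (- c) x = - dot c x.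
Proof. by rewrite /dot -sumrN; apply: eq_bigr => i _; rewrite mxE mulNr. Qed.

Lemma dot_row m n (a c : 'rV[R]_m) (b d : 'rV[R]_n) :
  dot (row_mx a b) (row_mx c d) = dot a c + dot b d.
Proof.
rewrite /dot big_split_ord /=.
by congr (_ + _); apply: eq_bigr => i _; rewrite ?row_mxEl ?row_mxEr.
Qed.

Lemma dot_rowl m n (a : 'rV[R]_m) (b : 'rV[R]_n) (z : 'rV[R]_(m + n)) :
  dot (row_mx a b) z = dot a (lsubmx z) + dot b (rsubmx z).
Proof. by rewrite -dot_row hsubmxK. Qed.

Lemma faces_self n (P : polytope n) : faces P P.
Proof.
exists 0; apply/seteqP; split=> [x Px|x []//].
by split=> // y Py; rewrite !dot0.
Qed.

Lemma argmax_is_polytope n (P : polytope n) c :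
  argmax c P !=set0 -> is_polytope (argmax c P).
Proof.
case: (psetP P) => _ /bounded_setP[M bM] [s Ps] [x0 [Px0 x0max]].
split; first by exists x0.
  by apply/bounded_setP; exists M => x [Px _]; exact: bM.
exists ((- c, - dot c x0) :: s); apply/seteqP; split=> [x [Px xmax]|x hx].
  move=> h; rewrite inE => /predU1P[->|hs] /=.
    by rewrite dotN lerN2; exact: xmax.
  by move: Px; rewrite Ps; exact.
have Px : pset P x by rewrite Ps => h hs; apply: hx; rewrite inE hs orbT.
split=> // y Py; apply: le_trans (x0max _ Py) _.
by rewrite -lerN2 -dotN; apply: (hx (- c, - dot c x0)); rewrite mem_head.
Qed.

Lemma argmax_face n (P : polytope n) c : argmax c P !=set0 ->
  exists2 F : polytope n, faces P F & F = argmax c P :> set _.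
Proof.
by move=> /argmax_is_polytope Fp; exists (Polytope Fp) => //; exists c.
Qed.

Lemma comb_equiv_of_rel m n (P : polytope m) (Q : polytope n)
    (r : polytope m -> polytope n -> Prop) :
    (forall F, faces P F -> exists2 G, faces Q G & r F G) ->
    (forall G, faces Q G -> exists2 F, faces P F & r F G) ->
    (forall F F' G G', faces P F -> faces P F' -> faces Q G -> faces Q G' ->
       r F G -> r F' G' -> (F `<=` F' <-> G `<=` G')) ->
  comb_equiv P Q.
Proof.
move=> rl rr rmono.
have /choice[f fP] : forall F, exists G, faces P F -> faces Q G /\ r F G.
  move=> F; have [/rl[G QG rFG]|nF] := pselect (faces P F); first by exists G.
  by exists Q.
exists f; split; last first.
  move=> F G PF PG; have [? ?] := fP _ PF; have [? ?] := fP _ PG.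
  exact: rmono.
split=> [F /fP[]//|F G|G QG].
  move=> /set_mem PF /set_mem PG fFG.
  have [QF rF] := fP _ PF; have [QG rG] := fP _ PG.
  apply: polytope_inj; apply/seteqP.
  by split; [apply/(rmono _ _ _ _ PF PG QF QG)|apply/(rmono _ _ _ _ PG PF QG QF)];
    rewrite // fFG.
have [F PF rFG] := rr _ QG; exists F => //.
have [QfF rF] := fP _ PF.
apply: polytope_inj; apply/seteqP.
by split; [apply/(rmono _ _ _ _ PF PF QfF QG)|apply/(rmono _ _ _ _ PF PF QG QfF)].
Qed.

Lemma comb_equiv_refl n (P : polytope n) : comb_equiv P P.
Proof.
apply: (@comb_equiv_of_rel _ _ _ _ eq) => [F|F|F F' _ _ _ _ _ _ <- <-//].
  by exists F.
by exists F.
Qed.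

Lemma comb_equiv_sym m n (P : polytope m) (Q : polytope n) :
  comb_equiv P Q -> comb_equiv Q P.
Proof.
case=> f [[f1 _ f3] fmono].
apply: (@comb_equiv_of_rel _ _ _ _ (fun G F => G = f F)).
- by move=> G /f3[F PF <-]; exists F.
- by move=> F PF; exists (f F) => //; exact: f1.
- by move=> G G' F F' _ _ PF PF' -> ->; split=> /(fmono _ _ PF PF').
Qed.

Lemma comb_equiv_trans m n p (P : polytope m) (Q : polytope n) (S : polytope p) :
  comb_equiv P Q -> comb_equiv Q S -> comb_equiv P S.
Proof.
case=> f [[f1 _ f3] fmono] [g [[g1 _ g3] gmono]].
apply: (@comb_equiv_of_rel _ _ _ _ (fun F H => H = g (f F))).
- by move=> F PF; exists (g (f F)) => //; apply/g1/f1.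
- by move=> H /g3[G /f3[F PF <-] <-]; exists F.
- move=> F F' _ _ PF PF' _ _ -> ->.
  by rewrite fmono// gmono//; exact: f1.
Qed.

Definition prod_set m n (P : set 'rV[R]_m) (Q : set 'rV[R]_n) :
    set 'rV[R]_(m + n) :=
  [set z | P (lsubmx z) /\ Q (rsubmx z)].

Lemma prod_is_polytope m n (P : polytope m) (Q : polytope n) :
  is_polytope (prod_set P Q).
Proof.
case: (psetP P) => [[x Px]] /bounded_setP[M bM] [s Ps].
case: (psetP Q) => [[y Qy]] /bounded_setP[N bN] [t Qt].
split.
- by exists (row_mx x y); rewrite /prod_set /= row_mxKl row_mxKr.
- apply/bounded_setP; exists (Num.max M N) => z [Pz Qz] i.
  rewrite -(hsubmxK z) mxE; case: splitP => j _; rewrite le_max.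
    by rewrite bM.
  by rewrite bN ?orbT.
exists ([seq (row_mx h.1 0, h.2) | h <- s] ++ [seq (row_mx 0 h.1, h.2) | h <- t]).
apply/seteqP; split=> [z|z zh].
  rewrite /prod_set /= Ps Qt => -[Pz Qz] h.
  rewrite mem_cat => /orP[] /mapP[k ks ->] /=;
    rewrite dot_rowl dot0 ?addr0 ?add0r.
  - exact: Pz.
  - exact: Qz.
rewrite /prod_set /= Ps Qt; split=> h hs.
- have := zh (row_mx h.1 0, h.2); rewrite dot_rowl dot0 addr0.
  by apply; rewrite mem_cat; apply/orP; left; apply/mapP; exists h.
- have := zh (row_mx 0 h.1, h.2); rewrite dot_rowl dot0 add0r.
  by apply; rewrite mem_cat; apply/orP; right; apply/mapP; exists h.
Qed.

Definition prod_polytope m n (P : polytope m) (Q : polytope n) :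
  polytope (m + n) := Polytope (prod_is_polytope P Q).

Lemma prod_subset m n (P P' : polytope m) (Q Q' : polytope n) :
  (prod_polytope P Q `<=` prod_polytope P' Q') <-> (P `<=` P' /\ Q `<=` Q').
Proof.
split=> [PQ|[PP' QQ'] z [Pz Qz]]; last by split; [exact: PP'|exact: QQ'].
case: (psetP P) => [[x0 Px0]] _ _; case: (psetP Q) => [[y0 Qy0]] _ _.
split=> [x Px|y Qy].
  have := PQ (row_mx x y0); rewrite /= /prod_set /= row_mxKl row_mxKr.
  by case.
have := PQ (row_mx x0 y); rewrite /= /prod_set /= row_mxKl row_mxKr.
by case.
Qed.

Lemma argmax_prod m n (P : polytope m) (Q : polytope n) c d :
  argmax (row_mx c d) (prod_set P Q) = prod_set (argmax c P) (argmax d Q).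
Proof.
apply/seteqP; split=> z; rewrite /argmax /prod_set /=.
  move=> [[Pz Qz] zmax]; split; split=> // y Py.
    have := zmax (row_mx y (rsubmx z)).
    rewrite row_mxKl row_mxKr !dot_rowl row_mxKl row_mxKr lerD2r; exact.
  have := zmax (row_mx (lsubmx z) y).
  rewrite row_mxKl row_mxKr !dot_rowl row_mxKl row_mxKr lerD2l; exact.
move=> [[Pz zP] [Qz zQ]]; split=> // y [Py Qy].
by rewrite !dot_rowl lerD ?zP ?zQ.
Qed.

Lemma faces_prod m n (P : polytope m) (Q : polytope n) F :
  faces (prod_polytope P Q) F <->
  exists F1 F2, [/\ faces P F1, faces Q F2 & F = prod_polytope F1 F2].
Proof.
split=> [[c]|[F1 [F2 [[c Fc] [d Fd] ->]]]]; last first.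
  by exists (row_mx c d); rewrite argmax_prod -Fc -Fd.
rewrite -(hsubmxK c) argmax_prod => FE.
have [[z]] := psetP F; rewrite FE => -[z1 z2] _ _.
have [|F1 PF1 F1E] := @argmax_face _ P (lsubmx c); first by eexists; exact: z1.
have [|F2 QF2 F2E] := @argmax_face _ Q (rsubmx c); first by eexists; exact: z2.
by exists F1, F2; split=> //; apply: polytope_inj; rewrite FE /= F1E F2E.
Qed.

Lemma comb_equiv_prod m m' n n' (P : polytope m) (P' : polytope m')
    (Q : polytope n) (Q' : polytope n') :
  comb_equiv P P' -> comb_equiv Q Q' ->
  comb_equiv (prod_polytope P Q) (prod_polytope P' Q').
Proof.
case=> f [[f1 _ f3] fmono] [g [[g1 _ g3] gmono]].
apply: (@comb_equiv_of_rel _ _ _ _ (fun F G => exists F1 F2,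
  [/\ faces P F1, faces Q F2, F = prod_polytope F1 F2 &
      G = prod_polytope (f F1) (g F2)])).
- move=> F /faces_prod[F1 [F2 [PF1 QF2 ->]]].
  exists (prod_polytope (f F1) (g F2)); last by exists F1, F2.
  by apply/faces_prod; exists (f F1), (g F2); split=> //; [exact: f1|exact: g1].
- move=> G /faces_prod[_ [_ [/f3[F1 PF1 <-] /g3[F2 QF2 <-] ->]]].
  exists (prod_polytope F1 F2); last by exists F1, F2.
  by apply/faces_prod; exists F1, F2.
- move=> F F' G G' _ _ _ _ [F1 [F2 [PF1 QF2 -> ->]]].
  move=> [F1' [F2' [PF1' QF2' -> ->]]].
  by rewrite !prod_subset fmono// gmono.
Qed.

Lemma comb_equiv_isometry m n (P : polytope m) (Q : polytope n)
    (f : 'rV[R]_m -> 'rV[R]_n) (g : 'rV[R]_n -> 'rV[R]_m) :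
    cancel f g -> cancel g f -> (forall x y, dot (f x) (f y) = dot x y) ->
    (forall x, pset P x <-> pset Q (f x)) ->
  comb_equiv P Q.
Proof.
move=> fK gK fdot PQ.
have amax c x : argmax c P x <-> argmax (f c) Q (f x).
  split=> [[Px xmax]|[Qx xmax]].
    split=> [|y]; first exact/PQ.
    by rewrite -(gK y) => /PQ Py; rewrite !fdot; exact: xmax.
  split=> [|y Py]; first exact/PQ.
  by rewrite -!(fdot c); apply: xmax; apply/PQ.
apply: (@comb_equiv_of_rel _ _ _ _
  (fun F G => forall x, pset F x <-> pset G (f x))).
- move=> F [c FE]; have [[x]] := psetP F; rewrite FE => /amax Gx _ _.
  have [|G QG GE] := @argmax_face _ Q (f c); first by exists (f x).
  by exists G => // y; rewrite GE.
- move=> G [c GE]; have [[x Gx] _ _] := psetP G.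
  have [|F PF FE] := @argmax_face _ P (g c).
    by exists (g x); apply/amax; rewrite !gK -GE.
  by exists F => // y; rewrite FE GE -{2}(gK c).
- move=> F F' G G' _ _ _ _ FG FG'; split=> [FF' y|GG' x].
    by rewrite -(gK y) => /FG/FF'/FG'.
  by move=> /FG/GG'/FG'.
Qed.

Lemma prodC_equiv m n (P : polytope m) (Q : polytope n) :
  comb_equiv (prod_polytope P Q) (prod_polytope Q P).
Proof.
apply: (@comb_equiv_isometry _ _ _ _
  (fun z : 'rV_(m + n) => row_mx (rsubmx z) (lsubmx z))
  (fun z : 'rV_(n + m) => row_mx (rsubmx z) (lsubmx z))).
- by move=> z; rewrite row_mxKl row_mxKr hsubmxK.
- by move=> z; rewrite row_mxKl row_mxKr hsubmxK.
- by move=> x y; rewrite dot_row addrC -dot_row !hsubmxK.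
- by move=> x; rewrite /= /prod_set /= row_mxKl row_mxKr; split=> -[].
Qed.

Lemma prodA_equiv m n p (P : polytope m) (Q : polytope n) (S : polytope p) :
  comb_equiv (prod_polytope P (prod_polytope Q S))
             (prod_polytope (prod_polytope P Q) S).
Proof.
apply: (@comb_equiv_isometry _ _ _ _
  (fun z : 'rV_(m + (n + p)) =>
     row_mx (row_mx (lsubmx z) (lsubmx (rsubmx z))) (rsubmx (rsubmx z)))
  (fun z : 'rV_(m + n + p) =>
     row_mx (lsubmx (lsubmx z)) (row_mx (rsubmx (lsubmx z)) (rsubmx z)))).
- by move=> z; rewrite !(row_mxKl, row_mxKr, hsubmxK).
- by move=> z; rewrite !(row_mxKl, row_mxKr, hsubmxK).
- by move=> x y; rewrite !dot_row -addrA -!dot_row !hsubmxK.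
- move=> x; rewrite /= /prod_set /= !(row_mxKl, row_mxKr) /=.
  by split=> [[? []]|[[]]].
Qed.

Lemma pt_is_polytope : is_polytope [set: 'rV[R]_0].
Proof.
split; first by exists 0.
  by apply/bounded_setP; exists 0 => x _ [].
by exists [::]; apply/seteqP; split.
Qed.

Definition pt : polytope 0 := Polytope pt_is_polytope.

Lemma prod1_equiv n (P : polytope n) : comb_equiv (prod_polytope pt P) P.
Proof.
apply: (@comb_equiv_isometry _ _ _ _
  (fun z : 'rV_(0 + n) => rsubmx z) (fun z => row_mx 0 z : 'rV_(0 + n))).
- by move=> z; rewrite -[RHS](hsubmxK z) [lsubmx z]thinmx0.
- by move=> z; rewrite row_mxKr.
- move=> x y; rewrite -[in RHS](hsubmxK x) -[in RHS](hsubmxK y) dot_row.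
  by rewrite [lsubmx x]thinmx0 dot0 add0r.
- by move=> x; split=> [[]//|Px]; split.
Qed.

Lemma pt_uniq (F : polytope 0) : F = pt.
Proof.
apply: polytope_inj; apply/seteqP; split=> // x _.
by have [[y Fy] _ _] := psetP F; rewrite (thinmx0 x) -(thinmx0 y).
Qed.

Lemma comb_equiv_pt n (P : polytope n) :
  comb_equiv P pt <-> forall F, faces P F -> F = P.
Proof.
split=> [[f [[_ finj _] _]] F PF|uP].
  apply: (finj F P (mem_set PF) (mem_set (faces_self P))).
  by rewrite [LHS]pt_uniq [RHS]pt_uniq.
apply: (@comb_equiv_of_rel _ _ _ _ (fun _ _ => True)).
- by move=> F PF; exists pt => //; exact: faces_self.
- by move=> G PG; exists P => //; exact: faces_self.
- by move=> F F' G G' /uP -> /uP -> _ _ _ _; split=> _ x; rewrite ?(pt_uniq G) ?(pt_uniq G').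
Qed.

Lemma prod_eq_pt m n (P : polytope m) (Q : polytope n) :
  comb_equiv (prod_polytope P Q) pt -> comb_equiv P pt /\ comb_equiv Q pt.
Proof.
move=> /comb_equiv_pt uPQ; split; apply/comb_equiv_pt => F PF.
  have /uPQ /(congr1 (@pset _)) /seteqP FE :
      faces (prod_polytope P Q) (prod_polytope F Q).
    by apply/faces_prod; exists F, Q; split=> //; exact: faces_self.
  apply: polytope_inj; apply/seteqP.
  by case: FE => /prod_subset[? _] /prod_subset[].
have /uPQ /(congr1 (@pset _)) /seteqP FE :
    faces (prod_polytope P Q) (prod_polytope P F).
  by apply/faces_prod; exists P, F; split=> //; exact: faces_self.
apply: polytope_inj; apply/seteqP.
by case: FE => /prod_subset[_ ?] /prod_subset[].
Qed.

Definition gpolytope := {n : nat & polytope n}.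

Definition gequiv (P Q : gpolytope) : bool :=
  `[< comb_equiv (tagged P) (tagged Q) >].

Lemma gequiv_refl : reflexive gequiv.
Proof. by move=> P; apply/asboolP; exact: comb_equiv_refl. Qed.

Lemma gequiv_sym : symmetric gequiv.
Proof. by move=> P Q; apply/asboolP/asboolP; exact: comb_equiv_sym. Qed.

Lemma gequiv_trans : transitive gequiv.
Proof.
move=> P Q S /asboolP QP /asboolP PS; apply/asboolP.
exact: comb_equiv_trans QP PS.
Qed.

Canonical gequiv_equiv := EquivRel gequiv gequiv_refl gequiv_sym gequiv_trans.

Definition pclass := {eq_quot gequiv_equiv}.

HB.instance Definition _ := Choice.on pclass.
HB.instance Definition _ := EqQuotient.on pclass.

Definition class_of n (P : polytope n) : pclass := \pi_pclass (Tagged polytope P : gpolytope).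

Lemma class_ofP m n (P : polytope m) (Q : polytope n) :
  class_of P = class_of Q <-> comb_equiv P Q.
Proof. by split=> [/eqmodP/asboolP|PQ] //; apply/eqmodP/asboolP. Qed.

Lemma class_of_repr (a : pclass) : class_of (tagged (repr a)) = a.
Proof. by rewrite /class_of taggedK reprK. Qed.

Definition pclass_one : pclass := class_of pt.

Definition pclass_mul (a b : pclass) : pclass :=
  class_of (prod_polytope (tagged (repr a)) (tagged (repr b))).

Lemma pclass_mulE m n (P : polytope m) (Q : polytope n) :
  pclass_mul (class_of P) (class_of Q) = class_of (prod_polytope P Q).
Proof.
apply/class_ofP.
by apply: comb_equiv_prod; apply/class_ofP; rewrite class_of_repr.
Qed.

Lemma pclass_ind (T : pclass -> Prop) :
  (forall n (P : polytope n), T (class_of P)) -> forall a, T a.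
Proof. by move=> TP a; rewrite -(class_of_repr a). Qed.

Lemma pclass_mulC : commutative pclass_mul.
Proof.
elim/pclass_ind=> m P; elim/pclass_ind=> n Q; rewrite !pclass_mulE.
by apply/class_ofP; exact: prodC_equiv.
Qed.

Lemma pclass_mulA : associative pclass_mul.
Proof.
elim/pclass_ind=> m P; elim/pclass_ind=> n Q; elim/pclass_ind=> p S.
by rewrite !pclass_mulE; apply/class_ofP; exact: prodA_equiv.
Qed.

Lemma pclass_mul1m : left_id pclass_one pclass_mul.
Proof.
elim/pclass_ind=> m P; rewrite pclass_mulE.
by apply/class_ofP; exact: prod1_equiv.
Qed.

Lemma pclass_mulm1 : right_id pclass_one pclass_mul.
Proof. by move=> a; rewrite pclass_mulC pclass_mul1m. Qed.

Lemma pclass_unitm a b :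
  pclass_mul a b = pclass_one -> a = pclass_one /\ b = pclass_one.
Proof.
elim/pclass_ind: a => m P; elim/pclass_ind: b => n Q; rewrite pclass_mulE.
by move=> /class_ofP/prod_eq_pt[? ?]; split; apply/class_ofP.
Qed.

HB.instance Definition _ := Choice_isMonomialDef.Build pclass
  pclass_mulA pclass_mul1m pclass_mulm1 pclass_unitm.
HB.instance Definition _ := MonomialDef_isConomialDef.Build pclass pclass_mulC.

End Polytopes.

Arguments pt {R}.
Arguments class_of {R n} P.

(* The ring of polytopes and its extension of scalars to the rationals: the
   tensor product of Z[M] with Q is the monoid algebra Q[M]. *)
Notation polytope_ring R := (malg (pclass R) int).
Notation polytope_ringQ R := (malg (pclass R) rat).

Definition to_rat (R : realType) : polytope_ring R -> polytope_ringQ R :=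
  mmap intr (fun k => mkmalgU k 1).

Section Interior.
Variable R : realType.

Definition poly_class n (P : polytope R n) : polytope_ring R :=
  mkmalgU (class_of P) 1.

(* [faces Q] is finite, so this is a genuine sum over all nonempty faces. *)
Definition motivic_interior n (Q : polytope R n) : polytope_ring R :=
  \sum_(F \in faces Q) (-1) ^+ (pdim Q - pdim F) * poly_class F.

End Interior.

Section GraphAssociahedra.
Variable R : realType.

Definition induced_connected (V : finType) (e : rel V) (S : {set V}) : bool :=
  (S != finset.set0) &&
  [forall x in S, forall y in S,
     connect [rel u v | [&& u \in S, v \in S & e u v]] x y].

(* The vertex set is [n.+1], as every graph considered has a vertex. *)
Definition graph_assoc_set n (e : rel 'I_n.+1) : set 'rV[R]_n.+1 :=
  [set x | \sum_i x 0 i = 3 ^+ n.+1 /\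
     forall S : {set 'I_n.+1}, S \proper finset.setT ->
       induced_connected e S -> 3 ^+ #|S| <= \sum_(i in S) x 0 i].

Lemma ratio_pow3 k N : (0 < k <= N)%N -> (N * 3 ^ k <= k * 3 ^ N)%N.
Proof.
move=> /andP[k0 /subnK <-]; elim: (N - k)%N => [|d IH] //.
rewrite addSn expnS mulnCA; apply: (@leq_trans (3 * ((d + k) * 3 ^ k))).
  rewrite mulnA leq_mul2r; apply/orP; right.
  rewrite (mulnDl 1 2) mul1n -addn1 leq_add2l.
  by rewrite muln_gt0 addn_gt0 k0 orbT.
by rewrite leq_mul2l IH.
Qed.

Lemma graph_assoc_is_polytope n (e : rel 'I_n.+1) :
  is_polytope (graph_assoc_set e).
Proof.
have dot1 (S : {set 'I_n.+1}) (x : 'rV[R]_n.+1) :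
    dot (\row_i (i \in S)%:R) x = \sum_(i in S) x 0 i.
  rewrite /dot [RHS]big_mkcond; apply: eq_bigr => i _; rewrite mxE.
  by case: ifP; rewrite ?mul1r ?mul0r.
have dotT (x : 'rV[R]_n.+1) : dot (const_mx 1) x = \sum_i x 0 i.
  by apply: eq_bigr => i _; rewrite mxE mul1r.
split.
- exists (const_mx (3 ^+ n.+1 / n.+1%:R)); split=> [|S _ /andP[S0 _]].
    under eq_bigr do rewrite mxE.
    by rewrite sumr_const card_ord -[LHS]mulr_natr divfK// pnatr_eq0.
  under eq_bigr do rewrite mxE.
  rewrite sumr_const -[leRHS]mulr_natr mulrAC ler_pdivlMr ?ltr0n//.
  rewrite -!natrX -!natrM ler_nat mulnC [leqRHS]mulnC ratio_pow3//.
  by rewrite card_gt0 S0 -[leqRHS]card_ord max_card.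
- apply/bounded_setP; exists (3 ^+ n.+1) => x [xT xS] i.
  have x0 j : 0 <= x 0 j.
    have [jT|jT] := eqVneq [set j]%SET finset.setT.
      have : \sum_(k in [set j]%SET) x 0 k = 3 ^+ n.+1.
        by rewrite jT -xT; apply: eq_bigl => k; rewrite finset.in_setT.
      by rewrite finset.big_set1 => ->; rewrite exprn_ge0.
    have := xS [set j]%SET; rewrite finset.big_set1 => xj.
    apply: (le_trans _ (xj _ _)); first by rewrite exprn_ge0.
      by rewrite finset.properEneq jT finset.subsetT.
    apply/andP; split; first by apply/finset.set0Pn; exists j; rewrite finset.set11.
    apply/forallP => u; apply/implyP => /finset.set1P ->.
    by apply/forallP => v; apply/implyP => /finset.set1P ->; exact: connect0.
  by rewrite ger0_norm// -xT (bigD1 i)//= lerDl sumr_ge0.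
exists ([:: (const_mx 1, 3 ^+ n.+1); (- const_mx 1, - 3 ^+ n.+1)] ++
  [seq (- (\row_i (i \in U)%:R), - 3 ^+ #|U|) | U : {set 'I_n.+1} <-
     enum [pred U : {set 'I_n.+1} |
       (U \proper finset.setT) && induced_connected e U]]).
apply/seteqP; split=> [x [xT xS] h|x xh].
  rewrite mem_cat !inE => /orP[/orP[]/eqP->/=|/mapP[S]].
  - by rewrite dotT xT.
  - by rewrite dotN dotT xT.
  - rewrite mem_enum inE => /andP[SP Sc] -> /=.
    by rewrite dotN dot1 lerN2; exact: xS.
split=> [|S SP Sc].
  apply/eqP; rewrite eq_le -!dotT; apply/andP; split.
    by apply: (xh (const_mx 1, _)); rewrite mem_head.
  rewrite -lerN2 -dotN.
  by apply: (xh (- const_mx 1, - 3 ^+ n.+1)); rewrite !inE eqxx orbT.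
rewrite -dot1 -lerN2 -dotN.
apply: (xh (- (\row_i (i \in S)%:R), - 3 ^+ #|S|)).
rewrite mem_cat; apply/orP; right; apply/mapP; exists S => //.
by rewrite mem_enum inE SP.
Qed.

Definition graph_associahedron n (e : rel 'I_n.+1) : polytope R n.+1 :=
  Polytope (graph_assoc_is_polytope e).

Definition path_graph n : rel 'I_n :=
  fun i j => (i.+1 == j :> nat) || (j.+1 == i :> nat).

(* The condition [i != j] excludes a loop for n = 1. *)
Definition cycle_graph n : rel 'I_n :=
  fun i j => (i != j) && ((i.+1 %% n == j)%N || (j.+1 %% n == i)%N).

(* Indices are shifted by one: the graphs have n.+1 vertices. *)
Definition associahedron n := graph_associahedron (@path_graph n.+1).
Definition cyclohedron n := graph_associahedron (@cycle_graph n.+1).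

End GraphAssociahedra.

(* A power series is its sequence of coefficients. *)
Section FormalSeries.
Variable A : nzRingType.

Definition fps_one : nat -> A := fun n => (n == 0)%:R.

Definition fps_X : nat -> A := fun n => (n == 1)%:R.

Definition fps_mul (f g : nat -> A) : nat -> A :=
  fun n => \sum_(i < n.+1) f i * g (n - i)%N.

Definition fps_exp (f : nat -> A) (k : nat) : nat -> A :=
  iter k (fps_mul f) fps_one.

(* f(g(x)) for a series g without constant term: the coefficient of x^n in g^k
   vanishes for k > n, so the sum over k stops at n. *)
Definition fps_comp (f g : nat -> A) : nat -> A :=
  fun n => \sum_(k < n.+1) f k * fps_exp g k n.

End FormalSeries.

Section Series.
Variable R : realType.

Definition alpha_series (n : nat) : polytope_ringQ R :=
  match n with
  | 0 => 0
  | 1 => 1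
  | m.+2 => to_rat (poly_class (associahedron R m))
  end.

Definition beta_series (n : nat) : polytope_ringQ R :=
  match n with
  | 0 => 0
  | 1 => 1
  | m.+2 => - to_rat (motivic_interior (associahedron R m))
  end.

Definition W_series (n : nat) : polytope_ringQ R :=
  if n is m.+1 then n%:R^-1 *: to_rat (poly_class (cyclohedron R m)) else 0.

Definition Wint_series (n : nat) : polytope_ringQ R :=
  if n is m.+1 then n%:R^-1 *: to_rat (motivic_interior (cyclohedron R m))
  else 0.

End Series.

(* Main.v *)
(* The faces of a graph-associahedron correspond to the sets of pairwise
   compatible tubes, so its face poset is that of a flag complex, and so is the
   one of each face, with the flag complex replaced by a link.  Hence a class is
   determined by a compatibility relation, it is multiplicative on joins, and
   so is the signed sum over faces.

   A tube of the path with m - 1 vertices is a chord {a < b}, b - a >= 2, of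
   the interval [0, m] other than {0 < m}; compatible means noncrossing.  For
   the cycle with p vertices one takes chords of the line of length at most p,
   modulo translation by p.  Each set T of noncrossing chords has a set P of
   points not covered by T.  The chords joining consecutive points of P (the
   walls) belong to T, the other chords of T lie in the gaps of P, and the
   chords joining nonconsecutive points of P realize a smaller associahedron or
   cyclohedron.  So a motivic interior is the sum over P of the class of that
   smaller polytope times the product over the gaps of the coefficients of
   beta, the sign being absorbed by the walls.  For the path this says
   alpha(beta(x)) = x.  For the cycle one counts the sets P by the position of
   their last gap, which turns one factor beta into x beta', and
   n [x^n] beta^k = k [x^n] beta^(k-1) x beta'. *)
Require Import Defs.
From mathcomp Require Import all_boot all_order all_algebra.
From mathcomp Require Import boolp classical_sets functions.
From mathcomp Require Import fsbigop reals.
From mathcomp Require Import zify ring lra.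
From mathcomp.multinomials Require Import -(notations) monalg.
(* Last, so that their names take precedence over those of [classical_sets]. *)
From mathcomp Require Import fintype finset.
Set Implicit Arguments.
Unset Strict Implicit.
Unset Printing Implicit Defensive.
Import Order.TTheory GRing.Theory Num.Theory.
Local Open Scope ring_scope.

(** * Formal power series *)

(** The bounds 3^|S| are strictly superadditive, which makes tubes that are tight at a common point
    compatible. Conversely every set of pairwise compatible tubes is exactly the set of tubes tight
    at a suitable point. With a substitute for relative interior points this matches faces with
    cliques, and the linear independence of the indicator vectors of the tubes makes the codimension
    equal to the number of tubes. After that no polytope is cut or glued: since a class sees only
    the face poset, a face becomes a link and a product becomes a join. The obstacle is that the
    class of a flag complex is meaningful only if some polytope realizes it, so the realizability of
    all links is carried along through isomorphisms and joins. The cycle is unrolled onto the line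
    so that the order arguments for the path apply again; the price is to follow translates by the
    period and to cut the circle at an uncovered point. *)

Section FormalSeriesTheory.
Variable A : comNzRingType.
Implicit Types f g h : nat -> A.

(** A coefficient of a product involves finitely many coefficients of the factors, so identities of
    series are proved on polynomial truncations, where ring laws, derivation and composition are
    available. *)
Lemma coefM_fps (p q : {poly A}) f g n :
    (forall i, (i <= n)%N -> p`_i = f i) -> (forall i, (i <= n)%N -> q`_i = g i) ->
  (p * q)`_n = fps_mul f g n.
Proof.
move=> pf qg; rewrite coefM; apply: eq_bigr => i _.
by rewrite pf ?qg ?leq_subr// -ltnS.
Qed.

Lemma coefXM_fps (p q : {poly A}) f g k n :
    (forall i, (i <= n)%N -> p`_i = f i) -> (forall i, (i <= n)%N -> q`_i = g i) ->
  (p ^+ k * q)`_n = iter k (fps_mul f) g n.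
Proof.
elim: k n => [|k IH] n pf qg /=; first by rewrite expr0 mul1r qg.
rewrite exprS -mulrA; apply: coefM_fps => // i ni.
by apply: IH => j ji; [apply: pf|apply: qg]; exact: leq_trans ni.
Qed.

Lemma fps_exp_iter f k : fps_exp f k.+1 = iter k (fps_mul f) f.
Proof.
rewrite /fps_exp iterSr; congr iter; apply: funext => n.
pose p := \poly_(i < n.+1) f i.
rewrite -(@coefM_fps p 1) => [|i|i _]; rewrite ?coef1//.
  by rewrite mulr1 coef_poly ltnSn.
by rewrite coef_poly ltnS => ->.
Qed.

Lemma coef_exp_fps (p : {poly A}) f k n :
  (forall i, (i <= n)%N -> p`_i = f i) -> (p ^+ k)`_n = fps_exp f k n.
Proof.
move=> pf; rewrite -[p ^+ k]mulr1; apply: coefXM_fps => // i _.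
by rewrite coef1.
Qed.

(** The derivation x d/dx multiplies the coefficient of x^n by n and sends f^(k+1) to (k+1) f^k x
    f'. *)
Lemma fps_exp_deriv f k n :
  n%:R * fps_exp f k.+1 n =
  k.+1%:R * iter k (fps_mul f) (fun i => i%:R * f i) n.
Proof.
pose p := \poly_(i < n.+1) f i.
have pE i : (i <= n)%N -> p`_i = f i by rewrite coef_poly ltnS => ->.
have Xd (q : {poly A}) i : ('X * q^`())`_i = i%:R * q`_i.
  by case: i => [|i]; rewrite coefXM ?mul0r//= coef_deriv mulr_natl.
rewrite -(coef_exp_fps _ pE) -Xd deriv_exp /=.
rewrite -(@coefXM_fps p ('X * p^`())) => // [|i ni]; last by rewrite Xd pE.
by rewrite mulrnAr coefMn mulr_natl mulrCA mulrC !mulrA (mulrC 'X).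
Qed.

Lemma dvdX_coef (p : {poly A}) m :
  (forall i, (i < m)%N -> p`_i = 0) -> p = 'X^m * drop_poly m p.
Proof.
move=> p0; rewrite -{1}(poly_take_drop m p) mulrC.
by rewrite (_ : take_poly m p = 0) ?add0r//; apply/polyP => i;
  rewrite coef_take_poly coef0; case: ifP => // /p0.
Qed.

Lemma coef_exp_lt (p : {poly A}) k n : p`_0 = 0 -> (n < k)%N -> (p ^+ k)`_n = 0.
Proof.
move=> p0 nk; rewrite (@dvdX_coef p 1); last by case.
by rewrite exprMn -exprM mul1n coefXnM nk.
Qed.

Lemma coef_exp_diag (p : {poly A}) n : p`_0 = 0 -> (p ^+ n)`_n = p`_1 ^+ n.
Proof.
move=> p0; have := @dvdX_coef p 1; set q := drop_poly _ _ => pE.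
have -> : p`_1 = q`_0 by rewrite [in LHS]pE ?coefXnM//; case.
rewrite pE; last by case.
rewrite exprMn -exprM mul1n coefXnM ltnn subnn.
elim: n => [|n IH]; first by rewrite !expr0 coef1.
by rewrite !exprS coef0M IH.
Qed.

Lemma coef_comp_fps (p q : {poly A}) f g n : g 0%N = 0 ->
    (forall i, (i <= n)%N -> p`_i = f i) -> (forall i, (i <= n)%N -> q`_i = g i) ->
  (p \Po q)`_n = fps_comp f g n.
Proof.
move=> g0 pf qg; rewrite comp_polyE coef_sum /fps_comp.
have q0 : q`_0 = 0 by rewrite qg.
pose F i := p`_i * (q ^+ i)`_n.
under eq_bigr do rewrite coefZ.
pose m := maxn (size p) n.+1.
(* Both sums are extended to the larger length: beyond [size p] the new terms vanish because of [p],
   and beyond [n] because [q] has no constant term. *)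
have widen k : (k <= m)%N -> (forall i, (k <= i)%N -> F i = 0) ->
    \sum_(i < k) F i = \sum_(i < m) F i.
  move=> km F0; rewrite (big_ord_widen_cond m xpredT F km) big_mkcond.
  by apply: eq_bigr => i _ /=; case: ltnP => // /F0.
rewrite (widen (size p)) ?leq_maxl// => [|i pi]; last first.
  by rewrite /F nth_default ?mul0r.
rewrite -(widen n.+1) ?leq_maxr// => [|i ni]; last by rewrite /F coef_exp_lt ?mulr0.
by apply: eq_bigr => i _; rewrite /F pf -1?ltnS// (coef_exp_fps _ qg).
Qed.

Lemma fps_comp0 f g : f 0%N = 0 -> fps_comp f g 0 = 0.
Proof. by move=> f0; rewrite /fps_comp big_ord1 f0 mul0r. Qed.

Lemma fps_compS f g n : f 0%N = 0 ->
  fps_comp f g n.+1 = \sum_(k < n.+1) f k.+1 * fps_exp g k.+1 n.+1.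
Proof. by move=> f0; rewrite /fps_comp big_ord_recl f0 mul0r add0r. Qed.

Lemma fps_comp_split f g n : f 0%N = 0 -> f 1%N = 1 ->
  fps_comp f g n.+2 = g n.+2 + \sum_(k < n.+1) f k.+2 * fps_exp g k.+2 n.+2.
Proof.
by move=> f0 f1; rewrite fps_compS// big_ord_recl f1 mul1r fps_exp_iter.
Qed.

(* If [q] is the difference of the truncations of [g \o f] and [x], then
   [q \o g] vanishes to high order, and as [g = x + ...] so does [q]. *)
Lemma fps_comp_inverse f g : f 0%N = 0 -> g 0%N = 0 -> g 1%N = 1 ->
  fps_comp f g = @fps_X A -> fps_comp g f = @fps_X A.
Proof.
move=> f0 g0 g1 fg; apply: funext => N.
pose p := \poly_(i < N.+2) f i; pose r := \poly_(i < N.+2) g i.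
have pE i : (i < N.+2)%N -> p`_i = f i by rewrite coef_poly => ->.
have rE i : (i < N.+2)%N -> r`_i = g i by rewrite coef_poly => ->.
pose q := (r \Po p) - 'X.
have prE : exists s, p \Po r = 'X + 'X^(N.+1) * s.
  exists (drop_poly N.+1 (p \Po r - 'X)).
  rewrite -dvdX_coef; first by rewrite addrC subrK.
  move=> i iN; rewrite coefB coefX (@coef_comp_fps _ _ f g)//.
  - by rewrite fg subrr.
  - by move=> j ji; apply: pE; lia.
  - by move=> j ji; apply: rE; lia.
have qr : exists s, q \Po r = 'X^(N.+1) * s.
  have [s sE] := prE.
  have H : exists t, r \Po ('X + 'X^(N.+1) * s) = r + 'X^(N.+1) * t.
    elim/poly_ind: (r) => [|u c [t tE]].
      by exists 0; rewrite comp_poly0 mulr0 addr0.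
    exists (t * ('X + 'X^(N.+1) * s) + u * s).
    rewrite comp_polyD comp_polyM comp_polyX comp_polyC tE.
    by ring.
  have [t tE] := H; exists t.
  by rewrite /q comp_polyB comp_polyX -comp_polyA sE tE addrC addKr.
have q0 i : (i < N.+1)%N -> q`_i = 0.
  elim/ltn_ind: i => i IH iN.
  have qE := @dvdX_coef q i (fun j ji => IH j ji (ltn_trans ji iN)).
  have [s sE] := qr.
  have r0 : r`_0 = 0 by rewrite rE.
  have comp0 (u : {poly A}) : (u \Po r)`_0 = u`_0.
    elim/poly_ind: u => [|v c _]; first by rewrite comp_poly0.
    by rewrite comp_poly_MXaddC !coefD !coef0M r0 coefX !mulr0 !coefC.
  have : (q \Po r)`_i = 0 by rewrite sE coefXnM iN.
  rewrite {1}qE comp_polyM comp_Xn_poly.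
  rewrite (@dvdX_coef (r ^+ i) i) => [|j ji]; last by rewrite coef_exp_lt.
  rewrite -mulrA coefXnM ltnn subnn coef0M comp0 !coef_drop_poly add0n.
  by rewrite coef_exp_diag// rE// g1 expr1n mul1r.
have := q0 N (ltnSn N); rewrite coefB coefX => /eqP.
rewrite subr_eq0 => /eqP rpN; rewrite /fps_X -rpN; symmetry; apply: coef_comp_fps => //.
- by move=> i iN; rewrite rE//; lia.
- by move=> i iN; rewrite pE//; lia.
Qed.

(** For [a < b] these are, up to the shift by [a], the proper partial sums of the compositions of
    [b - a] into [k.+1] positive parts. *)
Fixpoint increasing_seqs (b k a : nat) : seq (seq nat) :=
  if k is k'.+1
  then [seq v :: s | v <- iota a.+1 (b - a.+1), s <- increasing_seqs b k' v]
  else [:: [::]].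

(** The last gap has a weight [g] of its own, so that x beta' can stand there while the other gaps
    keep beta. *)
Fixpoint gap_weight f g (b a : nat) (s : seq nat) : A :=
  if s is v :: s' then f (v - a)%N * gap_weight f g b v s' else g (b - a)%N.

Lemma gap_weight_last f b c s :
  gap_weight f (fun i => i%:R * f i) b c s = (b - last c s)%:R * gap_weight f f b c s.
Proof. by elim: s c => [|v s IH] c //=; rewrite IH mulrCA. Qed.

(** Expanding the product f^k g gives all compositions of [b - a]; those with a part 0 contribute
    nothing, as [f] and [g] have no constant term. *)
Lemma sum_gap_weight f g (a b k : nat) : f 0%N = 0 -> g 0%N = 0 -> (a <= b)%N ->
  \sum_(s <- increasing_seqs b k a) gap_weight f g b a s =
  iter k (fps_mul f) g (b - a)%N.
Proof.
move=> f0 g0; elim: k a => [|k IH] a ab /=; first by rewrite big_seq1.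
rewrite big_allpairs_dep /=.
transitivity (\sum_(v <- iota a.+1 (b - a.+1))
    f (v - a)%N * iter k (fps_mul f) g (b - v)%N).
  rewrite big_seq [RHS]big_seq; apply: eq_bigr => v; rewrite mem_iota => vab.
  by rewrite -IH ?mulr_sumr//; lia.
rewrite -[RHS](big_mkord xpredT
  (fun i => f i * iter k (fps_mul f) g (b - a - i)%N)).
rewrite big_nat_recl//= f0 mul0r add0r.
have [<-|ab'] := eqVneq a b.
  by rewrite subnn (_ : a - a.+1 = 0)%N ?big_geq ?big_nil//; lia.
have -> : (b - a = (b - a.+1).+1)%N by lia.
rewrite big_nat_recr//= subnn.
have -> : iter k (fps_mul f) g 0%N = 0.
  case: k {IH} => [|k] //=.
  by rewrite /fps_mul big_ord_recl big_ord0 f0 mul0r addr0.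
rewrite mulr0 addr0 -{1}(addn0 a.+1) iotaDl big_map /index_iota subn0.
apply: eq_bigr => i _; congr (f _ * _); first by lia.
by congr (iter _ _ _ _); lia.
Qed.

End FormalSeriesTheory.

(** * Flag complexes *)

Section FlagComplexes.
Variables (X : finType) (r : rel X).
Implicit Types A B T : {set X}.

Definition clique T := [forall x in T, forall y in T, r x y].

Definition cliques A : {set {set X}} := [set T : {set X} | (T \subset A) && clique T].

(** The link of a face in a flag complex is again flag for the same relation, so it is recorded by
    its vertices. *)
Definition link A T : {set X} := [set x in A :\: T | [forall y in T, r x y]].

Lemma cliqueP T : reflect {in T &, forall x y, r x y} (clique T).
Proof.
apply: (iffP forall_inP) => [rT x y xT yT|rT x xT].
  exact: (forall_inP (rT x xT)).
by apply/forall_inP => y yT; exact: rT.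
Qed.

Lemma cliquesP A T :
  reflect (T \subset A /\ {in T &, forall x y, r x y}) (T \in cliques A).
Proof. by rewrite inE; apply: (iffP andP) => -[TA /cliqueP]. Qed.

Lemma linkP A T x :
  reflect [/\ x \in A, x \notin T & {in T, forall y, r x y}] (x \in link A T).
Proof.
rewrite !inE -andbA [(x \notin T) && _]andbCA.
by apply: (iffP and3P) => -[xA xT /forall_inP].
Qed.

Lemma link_subset A T : link A T \subset A.
Proof. by apply/subsetP => x /linkP[]. Qed.

Lemma link0 A : link A set0 = A.
Proof.
apply/setP => x; apply/linkP/idP => [[]//|xA].
by split=> // [|y]; rewrite inE.
Qed.

Lemma cliques0 A : set0 \in cliques A.
Proof. by apply/cliquesP; split=> [|x y]; [exact: sub0set|rewrite inE]. Qed.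

(** In the decomposition by uncovered points [B] is a set of walls, common to all cliques of a
    fibre. *)
Definition cliques_over A B : {set {set X}} := [set T in cliques A | B \subset T].

Lemma cliques_overP A B T :
  reflect (T \in cliques A /\ B \subset T) (T \in cliques_over A B).
Proof. exact: setIdP. Qed.

End FlagComplexes.

Arguments cliqueP {X r T}.
Arguments cliquesP {X r A T}.
Arguments linkP {X r A T x}.
Arguments cliques_overP {X r A B T}.

Section FlagComplexIso.
Variables (X Y : finType) (r : rel X) (s : rel Y) (f : X -> Y) (A : {set X}).
Hypotheses (finj : {in A &, injective f}).
Hypothesis fr : {in A &, forall x y, s (f x) (f y) = r x y}.
Implicit Types T : {set X}.

Lemma imset_preimsetI T : T \subset A -> A :&: f @^-1: (f @: T) = T.
Proof.
move=> TA; apply/setP => x; rewrite !inE; apply/andP/idP => [[xA /imsetP[y yT]]|xT].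
  by move=> /finj -> //; exact: (subsetP TA).
by split; [exact: (subsetP TA)|exact: imset_f].
Qed.

Lemma preimsetI_imset (T : {set Y}) : T \subset f @: A -> f @: (A :&: f @^-1: T) = T.
Proof.
move=> TA; apply/setP => y; apply/imsetP/idP => [[x]|yT].
  by rewrite !inE => /andP[_ fxT] ->.
have /imsetP[x xA yE] := subsetP TA _ yT.
by exists x; rewrite // !inE xA -yE.
Qed.

Lemma imset_cliques T : T \in cliques r A -> f @: T \in cliques s (f @: A).
Proof.
move=> /cliquesP[/subsetP TA cT]; apply/cliquesP; split.
  by apply: imsetS; apply/subsetP.
by move=> _ _ /imsetP[x xT ->] /imsetP[y yT ->]; rewrite fr ?cT//; exact: TA.
Qed.

Lemma preimset_cliques (T : {set Y}) :
  T \in cliques s (f @: A) -> A :&: f @^-1: T \in cliques r A.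
Proof.
move=> /cliquesP[/subsetP TA cT]; apply/cliquesP; split; first exact: subsetIl.
by move=> x y; rewrite !inE => /andP[xA xT] /andP[yA yT]; rewrite -fr ?cT.
Qed.

Lemma imset_link T : T \subset A -> link s (f @: A) (f @: T) = f @: link r A T.
Proof.
move=> /subsetP TA; apply/setP => y; apply/linkP/imsetP => [[]|[x /linkP[xA xT rx] ->]].
  move=> /imsetP[x xA ->] fxT sx; exists x => //; apply/linkP; split=> // [|z zT].
    by apply: contraNN fxT => xT; exact: imset_f.
  by rewrite -(fr xA (TA _ zT)); apply: sx; exact: imset_f.
split; first exact: imset_f.
  by apply: contraNN xT => /imsetP[z zT /finj ->//]; exact: TA.
by move=> _ /imsetP[z zT ->]; rewrite (fr xA (TA _ zT)) rx.
Qed.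

Lemma imset_cliques_over (B : {set X}) : B \subset A ->
  cliques_over s (f @: A) (f @: B) = (fun T => f @: T) @: cliques_over r A B.
Proof.
move=> BA; apply/setP => T.
apply/cliques_overP/imsetP => [[cT BT]|[T' /cliques_overP[cT BT] ->]]; last first.
  by rewrite imset_cliques// imsetS.
have [TA _] := cliquesP cT.
exists (A :&: f @^-1: T); last by rewrite preimsetI_imset.
apply/cliques_overP; split; first exact: preimset_cliques.
by apply/subsetP => x xB; rewrite !inE (subsetP BA)// (subsetP BT)// imset_f.
Qed.

Lemma imset_inj_on : {in cliques r A &, injective (fun T => f @: T)}.
Proof.
move=> T T' /cliquesP[TA _] /cliquesP[T'A _] TT'.
by rewrite -(imset_preimsetI TA) TT' imset_preimsetI.
Qed.

End FlagComplexIso.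

Section FlagComplexJoin.
Variables (X : finType) (r : rel X) (A A' : {set X}).
Hypothesis dAA' : [disjoint A & A'].
Hypothesis rAA' : forall x y, x \in A -> y \in A' -> r x y && r y x.
Implicit Types T : {set X}.

Lemma joinI T T' : T \subset A -> T' \subset A' ->
  (T :|: T') :&: A = T /\ (T :|: T') :&: A' = T'.
Proof.
move=> TA T'A'.
have TA'0 : T :&: A' = set0.
  by apply/eqP; rewrite setI_eq0; exact: disjointWl dAA'.
have T'A0 : T' :&: A = set0.
  by apply/eqP; rewrite setI_eq0 disjoint_sym; exact: disjointWr dAA'.
by rewrite !setIUl TA'0 T'A0 (setIidPl TA) (setIidPl T'A') setU0 set0U.
Qed.

Lemma join_cliques T T' :
  T \in cliques r A -> T' \in cliques r A' -> T :|: T' \in cliques r (A :|: A').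
Proof.
move=> /cliquesP[sTA cT] /cliquesP[sTA' cT']; apply/cliquesP; split.
  exact: setUSS.
have TA := subsetP sTA; have TA' := subsetP sTA'.
move=> x y; rewrite !inE => /orP[]xT /orP[]yT.
- exact: cT.
- by have /andP[] := rAA' (TA _ xT) (TA' _ yT).
- by have /andP[] := rAA' (TA _ yT) (TA' _ xT).
- exact: cT'.
Qed.

Lemma join_link T T' : T \subset A -> T' \subset A' ->
  link r (A :|: A') (T :|: T') = link r A T :|: link r A' T'.
Proof.
move=> /subsetP TA /subsetP TA'.
apply/setP => x; rewrite in_setU; apply/linkP/orP => [[]|].
  rewrite !in_setU negb_or => /orP[]xA /andP[xT xT'] rx; [left|right];
    by apply/linkP; split=> // y yT; apply: rx; rewrite inE yT ?orbT.
have dA z : z \in A -> z \in A' -> False.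
  by move=> zA zA'; have /disjointFr := dAA' => /(_ _ zA); rewrite zA'.
move=> []/linkP[xA xT rx]; rewrite !in_setU ?xA ?orbT negb_or xT ?andbT /=; split=> //.
- by apply/negP => /TA'; exact: dA.
- move=> y; rewrite in_setU => /orP[/rx//|/TA' yA'].
  by have /andP[] := rAA' xA yA'.
- by apply/negP => /TA yA; exact: dA yA xA.
- move=> y; rewrite in_setU => /orP[/TA yA|/rx//].
  by have /andP[] := rAA' yA xA.
Qed.

Lemma join_cliques_over (B B' : {set X}) : B \subset A -> B' \subset A' ->
  cliques_over r (A :|: A') (B :|: B') =
  (fun u => u.1 :|: u.2) @: setX (cliques_over r A B) (cliques_over r A' B').
Proof.
move=> BA BA'; apply/setP => T.
apply/cliques_overP/imsetP => [[cT]|[[T1 T2]]]; last first.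
  move=> /setXP[/cliques_overP[cT1 BT1] /cliques_overP[cT2 BT2]] -> /=.
  by rewrite join_cliques// setUSS.
rewrite subUset => /andP[BT B'T]; have [TAA' cTr] := cliquesP cT.
have cTI C : T :&: C \in cliques r C.
  apply/cliquesP; split=> [|x y /setIP[xT _] /setIP[yT _]]; first exact: subsetIr.
  exact: cTr.
exists (T :&: A, T :&: A'); last by rewrite /= -setIUr (setIidPl TAA').
by apply/setXP; split; apply/cliques_overP; rewrite subsetI ?BT ?B'T.
Qed.

End FlagComplexJoin.

Lemma signM (K : comNzRingType) a b (x y z : K) :
  z = x * y -> (-1) ^+ (a + b) * z = (-1) ^+ a * x * ((-1) ^+ b * y).
Proof. by move=> ->; rewrite exprD mulrACA. Qed.

(** * Polytopes realizing a flag complex, their classes and signed sums *)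

Section Realization.
Variable R : realType.

Lemma monomialM (k k' : pclass R) :
  mkmalgU (pclass_mul k k') 1 = mkmalgU k 1 * mkmalgU k' 1 :> polytope_ringQ R.
Proof. by rewrite [RHS]fgmulUU mulr1. Qed.

(* The face poset of [P] is that of the flag complex of [r] on [A], reversed. *)
Definition realizes (X : finType) (r : rel X) (A : {set X}) n (P : polytope R n)
    (F : {set X} -> polytope R n) : Prop :=
  [/\ forall T, T \in cliques r A -> faces P (F T),
      forall G, faces P G -> exists2 T, T \in cliques r A & G = F T
    & {in cliques r A &, forall T T',
         (F T `<=` F T')%classic <-> T' \subset T}].

Definition realizable (X : finType) (r : rel X) (A : {set X}) : Prop :=
  exists n (P : polytope R n) F, realizes r A P F.

(** Faces that come from the same clique are matched; in both polytopes the order is the reversed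
    inclusion of cliques. *)
Lemma realizes_equiv (X : finType) (r : rel X) (A : {set X}) m n
    (P : polytope R m) (Q : polytope R n) F G :
  realizes r A P F -> realizes r A Q G -> comb_equiv P Q.
Proof.
move=> [F1 F2 F3] [G1 G2 G3].
apply: (@comb_equiv_of_rel _ _ _ _ _ (fun U V =>
  exists2 T, T \in cliques r A & U = F T /\ V = G T)).
- by move=> U /F2[T cT ->]; exists (G T); [exact: G1|exists T].
- by move=> V /G2[T cT ->]; exists (F T); [exact: F1|exists T].
- by move=> U U' V V' _ _ _ _ [T cT [-> ->]] [T' cT' [-> ->]]; rewrite F3// G3.
Qed.

(* The class of a polytope realizing the flag complex; [1] if there is none. *)
Definition flag_class (X : finType) (r : rel X) (A : {set X}) : pclass R :=
  xget (pclass_one R) (fun c => exists n (P : polytope R n) F,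
    c = class_of P /\ realizes r A P F).

Lemma flag_classE (X : finType) (r : rel X) (A : {set X}) n
    (P : polytope R n) F : realizes r A P F -> flag_class r A = class_of P.
Proof.
move=> rP; have : exists c, exists n (P : polytope R n) F,
    c = class_of P /\ realizes r A P F.
  by exists (class_of P), n, P, F.
move=> /(xgetPex (pclass_one R))[m [Q [G [QE rQ]]]].
by rewrite /flag_class QE; apply/class_ofP; exact: realizes_equiv rQ rP.
Qed.

Section Iso.
Variables (X Y : finType) (r : rel X) (s : rel Y) (f : X -> Y) (A : {set X}).
Hypotheses (finj : {in A &, injective f}).
Hypothesis fr : {in A &, forall x y, s (f x) (f y) = r x y}.

Lemma realizes_imset n (P : polytope R n) F : realizes r A P F ->
  realizes s (f @: A) P (fun T => F (A :&: f @^-1: T)).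
Proof.
move=> [F1 F2 F3]; have pc := preimset_cliques fr; split.
- by move=> T /pc; exact: F1.
- move=> G /F2[T cT ->]; exists (f @: T); first exact: (imset_cliques fr).
  by have [TA _] := cliquesP cT; rewrite (imset_preimsetI finj TA).
- move=> T T' cT cT'; rewrite F3 ?pc//.
  have [TA _] := cliquesP cT; have [TA' _] := cliquesP cT'.
  split=> [TT'|TT']; last by rewrite setIS// preimsetS.
  by rewrite -(preimsetI_imset TA) -(preimsetI_imset TA') imsetS.
Qed.

Lemma realizable_imset : realizable r A -> realizable s (f @: A).
Proof. by move=> [n [P [F /realizes_imset]]]; exists n, P; eexists; eassumption. Qed.

Lemma flag_class_imset : realizable r A -> flag_class s (f @: A) = flag_class r A.
Proof.
by move=> [n [P [F rP]]]; rewrite (flag_classE (realizes_imset rP)) (flag_classE rP).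
Qed.

End Iso.

Section Join.
Variables (X : finType) (r : rel X) (A A' : {set X}).
Hypothesis dAA' : [disjoint A & A'].
Hypothesis rAA' : forall x y, x \in A -> y \in A' -> r x y && r y x.

(** Faces of a product are products of faces, just as cliques of a join are unions of one clique
    from each side. *)
Lemma realizes_join m n (P : polytope R m) (Q : polytope R n) F G :
  realizes r A P F -> realizes r A' Q G ->
  realizes r (A :|: A') (prod_polytope P Q)
    (fun T => prod_polytope (F (T :&: A)) (G (T :&: A'))).
Proof.
move=> [F1 F2 F3] [G1 G2 G3].
have cI B T : T \in cliques r (A :|: A') -> T :&: B \in cliques r B.
  move=> /cliquesP[_ cT]; apply/cliquesP; split=> [|x y /setIP[xT _] /setIP[yT _]].
    exact: subsetIr.
  exact: cT.
split.
- move=> T cT; apply/faces_prod; exists (F (T :&: A)), (G (T :&: A')).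
  by split=> //; [apply: F1|apply: G1]; exact: cI.
- move=> H /faces_prod[_ [_ [/F2[T cT ->] /G2[T' cT' ->] ->]]].
  exists (T :|: T'); first exact: (join_cliques rAA').
  have [TA _] := cliquesP cT; have [TA' _] := cliquesP cT'.
  by have [-> ->] := joinI dAA' TA TA'.
- move=> T T' cT cT'; rewrite prod_subset F3 ?cI// G3 ?cI//.
  have [TA _] := cliquesP cT; have [TA' _] := cliquesP cT'.
  split=> [[T1 T2]|TT']; last by rewrite !setSI.
  by rewrite -(setIidPl TA) -(setIidPl TA') !setIUr setUSS.
Qed.

Lemma realizable_join :
  realizable r A -> realizable r A' -> realizable r (A :|: A').
Proof.
by move=> [m [P [F rP]]] [n [Q [G rQ]]]; do 3 eexists; exact: realizes_join rP rQ.
Qed.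

Lemma flag_class_join : realizable r A -> realizable r A' ->
  flag_class r (A :|: A') = pclass_mul (flag_class r A) (flag_class r A').
Proof.
move=> [m [P [F rP]]] [n [Q [G rQ]]].
by rewrite (flag_classE (realizes_join rP rQ)) (flag_classE rP) (flag_classE rQ)
           pclass_mulE.
Qed.

End Join.

Lemma realizes_set0 (X : finType) (r : rel X) : realizes r set0 pt (fun=> pt).
Proof.
split=> [T _|G _|T T' /cliquesP[T0 _] /cliquesP[T0' _]]; first exact: faces_self.
  by exists set0; [exact: cliques0|exact: pt_uniq].
by move: T0 T0'; rewrite !subset0 => /eqP-> /eqP->.
Qed.

(** For a graph-associahedron the face of [T] has codimension [#|T|], and its own face poset is that
    of the link of [T]. *)
Definition flag_term (X : finType) (r : rel X) (A T : {set X}) : polytope_ringQ R :=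
  (-1) ^+ #|T| * mkmalgU (flag_class r (link r A T)) 1.

(* With [B = set0] this is the motivic interior of a polytope realizing [A]. *)
Definition flag_sum (X : finType) (r : rel X) (A B : {set X}) : polytope_ringQ R :=
  \sum_(T in cliques_over r A B) flag_term r A T.

(** Because [flag_class] has a default value, its invariance and multiplicativity are proved for
    realizable complexes; this is that condition for every term of a [flag_sum]. *)
Definition links_realizable (X : finType) (r : rel X) (A B : {set X}) : Prop :=
  forall T, T \in cliques_over r A B -> realizable r (link r A T).

Section SumIso.
Variables (X Y : finType) (r : rel X) (s : rel Y) (f : X -> Y) (A B : {set X}).
Hypotheses (finj : {in A &, injective f}).
Hypothesis fr : {in A &, forall x y, s (f x) (f y) = r x y}.
Hypothesis BA : B \subset A.

Let link_inj T : {in link r A T &, injective f}.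
Proof. by move=> x y /linkP[xA _ _] /linkP[yA _ _]; exact: finj. Qed.

Let link_fr T : {in link r A T &, forall x y, s (f x) (f y) = r x y}.
Proof. by move=> x y /linkP[xA _ _] /linkP[yA _ _]; exact: fr. Qed.

Lemma links_realizable_imset :
  links_realizable r A B -> links_realizable s (f @: A) (f @: B).
Proof.
move=> ok T; rewrite (imset_cliques_over fr)// => /imsetP[T' T'c ->].
have [/cliquesP[T'A _] _] := cliques_overP T'c.
rewrite (imset_link finj fr)//; apply: realizable_imset; last exact: ok.
  exact: link_inj.
exact: link_fr.
Qed.

Lemma flag_sum_imset :
  links_realizable r A B -> flag_sum s (f @: A) (f @: B) = flag_sum r A B.
Proof.
move=> ok; rewrite /flag_sum (imset_cliques_over fr)// big_imset /=; last first.
  move=> T T' /cliques_overP[cT _] /cliques_overP[cT' _].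
  exact: (imset_inj_on finj cT cT').
apply: eq_bigr => T cT; have [/cliquesP[TA _] _] := cliques_overP cT.
have cfT : #|f @: T| = #|T|.
  by apply: card_in_imset => x y xT yT; apply: finj; exact: (subsetP TA).
have cls := flag_class_imset (@link_inj T) (@link_fr T) (ok _ cT).
by rewrite /flag_term cfT (imset_link finj fr TA) cls.
Qed.

End SumIso.

Section SumJoin.
Variables (X : finType) (r : rel X) (A A' B B' : {set X}).
Hypothesis dAA' : [disjoint A & A'].
Hypothesis rAA' : forall x y, x \in A -> y \in A' -> r x y && r y x.
Hypotheses (BA : B \subset A) (BA' : B' \subset A').

Let link_disj T T' : [disjoint link r A T & link r A' T'].
Proof. by apply: disjointW dAA'; exact: link_subset. Qed.

Let link_join T T' x y :
  x \in link r A T -> y \in link r A' T' -> r x y && r y x.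
Proof. by move=> /linkP[xA _ _] /linkP[yA _ _]; exact: rAA'. Qed.

Lemma links_realizable_join : links_realizable r A B -> links_realizable r A' B' ->
  links_realizable r (A :|: A') (B :|: B').
Proof.
move=> ok ok' T; rewrite (join_cliques_over rAA')// => /imsetP[[T1 T2]].
move=> /setXP[cT1 cT2] -> /=.
have [/cliquesP[TA _] _] := cliques_overP cT1.
have [/cliquesP[TA' _] _] := cliques_overP cT2.
rewrite (join_link dAA' rAA')//; apply: realizable_join; last exact: ok'.
- exact: link_disj.
- exact: link_join.
- exact: ok.
Qed.

Lemma flag_sum_join : links_realizable r A B -> links_realizable r A' B' ->
  flag_sum r (A :|: A') (B :|: B') = flag_sum r A B * flag_sum r A' B'.
Proof.
move=> ok ok'; rewrite [LHS]/flag_sum (join_cliques_over rAA' BA BA').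
rewrite [LHS]big_imset /=; last first.
  move=> [T1 T2] [U1 U2] /setXP[cT1 cT2] /setXP[cU1 cU2] /= TU.
  have [/cliquesP[TA1 _] _] := cliques_overP cT1.
  have [/cliquesP[TA2 _] _] := cliques_overP cT2.
  have [/cliquesP[UA1 _] _] := cliques_overP cU1.
  have [/cliquesP[UA2 _] _] := cliques_overP cU2.
  have [E1 E2] := joinI dAA' TA1 TA2; have [E3 E4] := joinI dAA' UA1 UA2.
  by congr pair; [rewrite -E1 TU|rewrite -E2 TU].
rewrite /flag_sum mulr_suml; under [RHS]eq_bigr do rewrite mulr_sumr.
rewrite [RHS]pair_big_dep /=; apply: eq_big => [[T1 T2]|[T1 T2]]; first by rewrite in_setX.
move=> /setXP[cT1 cT2] /=.
have [/cliquesP[TA _] _] := cliques_overP cT1.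
have [/cliquesP[TA' _] _] := cliques_overP cT2.
have cU : #|T1 :|: T2| = (#|T1| + #|T2|)%N.
  by rewrite cardsU disjoint_setI0 ?cards0 ?subn0//; exact: disjointW dAA'.
have cls := flag_class_join (@link_disj T1 T2) (@link_join T1 T2)
  (ok _ cT1) (ok' _ cT2).
rewrite /flag_term (join_link dAA' rAA' TA TA') cls cU.
exact: signM (monomialM _ _).
Qed.

End SumJoin.

Lemma links_realizable0 (X : finType) (r : rel X) : links_realizable r set0 set0.
Proof.
move=> T _; suff -> : link r set0 T = set0 by exists 0%N, pt; eexists; exact: realizes_set0.
by apply/eqP; rewrite -subset0 link_subset.
Qed.

Lemma flag_sum0 (X : finType) (r : rel X) : flag_sum r set0 set0 = 1.
Proof.
rewrite /flag_sum (_ : cliques_over _ _ _ = [set set0]).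
  by rewrite big_set1 /flag_term cards0 expr0 mul1r link0 (flag_classE (realizes_set0 r)).
apply/setP => T; rewrite [RHS]inE; apply/cliques_overP/eqP => [[/cliquesP[]]|->].
  by rewrite subset0 => /eqP.
by split; [exact: cliques0|exact: sub0set].
Qed.

(** The only clique is [[set x]], with empty link. Applied to the wall of a gap, this produces the
    minus sign in the coefficients of beta. *)
Lemma flag_sum1 (X : finType) (r : rel X) (x : X) :
  r x x -> flag_sum r [set x] [set x] = -1 /\ links_realizable r [set x] [set x].
Proof.
move=> rxx; have cE : cliques_over r [set x] [set x] = [set [set x]].
  apply/setP => T; rewrite [RHS]inE; apply/cliques_overP/eqP => [[/cliquesP[Tx _] xT]|->].
    by apply/eqP; rewrite eqEsubset Tx.
  by split=> //; apply/cliquesP; split=> // y z /set1P-> /set1P->.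
have lE : link r [set x] [set x] = set0.
  by apply/setP => y; rewrite !inE; case: eqP.
split; last first.
  move=> T; rewrite cE => /set1P ->.
  by rewrite lE; exists 0%N, pt; eexists; exact: realizes_set0.
rewrite /flag_sum cE big_set1 /flag_term lE cards1 expr1 (flag_classE (realizes_set0 r)).
by rewrite mulN1r.
Qed.

End Realization.

(** * Tubes of a graph *)

Section InducedConnected.
Variables (V : finType) (e : rel V).
Hypothesis e_sym : symmetric e.
Implicit Types S M : {set V}.

Let inner S := [rel u v | [&& u \in S, v \in S & e u v]].

Let inner_sym S : connect_sym (inner S).
Proof. by apply: sym_connect_sym => u v /=; rewrite e_sym andbCA. Qed.

Lemma induced_connectedP S : reflect
  (S != set0 /\ {in S &, forall x y, connect (inner S) x y}) (induced_connected e S).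
Proof.
apply: (iffP andP) => -[S0 cS]; split=> //.
  by move=> x y xS yS; exact: (forall_inP (forall_inP cS _ xS)).
by apply/forall_inP => x xS; apply/forall_inP => y; exact: cS.
Qed.

Lemma induced_connected1 x : induced_connected e [set x].
Proof.
apply/induced_connectedP; split; first by apply/set0Pn; exists x; rewrite inE.
by move=> y z /set1P-> /set1P->; exact: connect0.
Qed.

Lemma induced_connected_edge S M : induced_connected e S -> M \subset S ->
  M != set0 -> M != S -> exists u v, [/\ u \in M, v \in S :\: M & e u v].
Proof.
move=> /induced_connectedP[_ cS] MS /set0Pn[x xM] MnS.
have /subsetPn[y yS yM] : ~~ (S \subset M).
  by apply: contraNN MnS => SM; rewrite eqEsubset MS.
apply: contrapT => noedge.
have cl : fingraph.closed (inner S) (mem M).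
  move=> u v /= /and3P[uS vS euv]; apply/idP/idP => wM; apply: contrapT => /negP wNM.
    by apply: noedge; exists u, v; rewrite inE wNM.
  by apply: noedge; exists v, u; rewrite inE wNM e_sym.
have := fingraph.closed_connect cl (cS _ _ (subsetP MS _ xM) yS).
by rewrite /= xM (negbTE yM).
Qed.

Lemma induced_connected_closed S M : induced_connected e S -> M \subset S ->
  M != set0 -> (forall u v, u \in M -> v \in S -> e u v -> v \in M) -> M = S.
Proof.
move=> cS MS M0 clM; apply/eqP; apply: contraT => MnS.
have [u [v [uM]]] := induced_connected_edge cS MS M0 MnS.
by rewrite inE => /andP[/negP vM vS] euv; case: vM; exact: clM euv.
Qed.

Lemma induced_connectedU S M u v : induced_connected e S -> induced_connected e M ->
  u \in S -> v \in M -> (u == v) || e u v -> induced_connected e (S :|: M).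
Proof.
move=> /induced_connectedP[_ cS] /induced_connectedP[_ cM] uS vM uv.
have sub (W : {set V}) : W \subset S :|: M ->
    subrel (connect (inner W)) (connect (inner (S :|: M))).
  move=> /subsetP WU; apply: connect_sub => x y /= /and3P[xW yW exy].
  by apply: connect1; rewrite /= !WU.
have SU : S \subset S :|: M by exact: subsetUl.
have MU : M \subset S :|: M by exact: subsetUr.
have cuv : connect (inner (S :|: M)) u v.
  case/orP: uv => [/eqP->|euv]; first exact: connect0.
  by apply: connect1; rewrite /= (subsetP SU)// (subsetP MU).
have cu x : x \in S :|: M -> connect (inner (S :|: M)) u x.
  rewrite inE => /orP[xS|xM]; first by apply: sub SU _ _ _; exact: cS.
  by apply: connect_trans cuv _; apply: sub MU _ _ _; exact: cM.
apply/induced_connectedP; split.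
  by apply/set0Pn; exists u; exact: (subsetP SU).
by move=> x y xU yU; apply: (connect_trans (y := u)); [rewrite inner_sym; exact: cu|exact: cu].
Qed.

Definition tubes : {set {set V}} :=
  [set S : {set V} | (S \proper [set: V]) && induced_connected e S].

(** Connected sets that meet have a connected union, so for tubes the last case means disjoint and
    not adjacent. *)
Definition tube_compat : rel {set V} :=
  fun S S' => [|| S \subset S', S' \subset S | ~~ induced_connected e (S :|: S')].

Lemma tubesP S : reflect (S != [set: V] /\ induced_connected e S) (S \in tubes).
Proof.
rewrite inE properE subsetT /= (_ : _ \subset S = (S == [set: V])); first exact: andP.
by rewrite eqEsubset subsetT.
Qed.

Lemma tube_compat_sym : symmetric tube_compat.
Proof. by move=> S S'; rewrite /tube_compat orbCA (setUC S). Qed.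

End InducedConnected.

Arguments induced_connectedP {V e S}.
Arguments tubesP {V e S}.

Section Nested.
Variables (V : finType) (e : rel V).
Hypothesis e_sym : symmetric e.
Hypothesis econn : induced_connected e [set: V].
Variable T : {set {set V}}.
Hypothesis Tclique : T \in cliques (tube_compat e) (tubes e).
Implicit Types S Y : {set V}.

(** With the whole vertex set added the laminar family has a root, and the equation for the total
    sum becomes one more tight set. *)
Definition nested : {set {set V}} := [set: V] |: T.

Lemma nestedT : [set: V] \in nested. Proof. by rewrite !inE eqxx. Qed.

Lemma nested_connected S : S \in nested -> induced_connected e S.
Proof.
move=> /setU1P[->//|ST]; have [TA _] := cliquesP Tclique.
by have /tubesP[] := subsetP TA _ ST.
Qed.

Lemma nested_neq0 S : S \in nested -> S != set0.
Proof. by move=> /nested_connected/induced_connectedP[]. Qed.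

Lemma nested_compat : {in nested &, forall S S', tube_compat e S S'}.
Proof.
move=> S S' /setU1P[->|ST]; first by rewrite /tube_compat subsetT orbT.
move=> /setU1P[->|ST']; first by rewrite /tube_compat subsetT.
by have [_] := cliquesP Tclique; exact.
Qed.

Lemma nested_laminar : {in nested &, forall S S',
  [\/ S \subset S', S' \subset S | [disjoint S & S']]}.
Proof.
move=> S S' NS NS'; have /or3P[SS'|S'S|nc] := nested_compat NS NS'.
- by constructor 1.
- by constructor 2.
constructor 3; apply: contraNT nc => /pred0Pn[x /andP[/= xS xS']].
exact: (induced_connectedU e_sym (nested_connected NS) (nested_connected NS')
         xS xS' (predU1l _ erefl)).
Qed.

(* A maximal member of [N] meeting the connected set [Y] is not adjacent to the
   rest of [Y]. *)
Lemma nested_cover (N : {set {set V}}) Y : N \subset nested ->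
  induced_connected e Y -> Y \subset cover N -> exists2 S, S \in N & Y \subset S.
Proof.
move=> Nn cY /subsetP YN.
have [/set0Pn[y yY] _] := induced_connectedP cY.
have /bigcupP[S0 NS0 yS0] := YN _ yY.
pose Q := fun S => (S \in N) && [exists z in Y, z \in S].
have QS0 : Q S0 by rewrite /Q NS0; apply/exists_inP; exists y.
have [S /andP[NS /exists_inP[z zY zS]] Smax] := arg_maxnP (fun S => #|S|) QS0.
exists S => //; apply/setIidPl.
apply: (induced_connected_closed e_sym cY); first exact: subsetIl.
  by apply/set0Pn; exists z; rewrite inE zY.
move=> u v /setIP[uY uS] vY euv; rewrite inE vY /=.
have /bigcupP[S' NS' vS'] := YN _ vY.
have nS := subsetP Nn _ NS; have nS' := subsetP Nn _ NS'.
have /or3P[SS'|/subsetP->//|] := nested_compat nS nS'.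
  have : (#|S'| <= #|S|)%N by apply: Smax; rewrite /Q NS'; apply/exists_inP; exists v.
  by move=> S'S; have /eqP -> : S == S' by rewrite eqEcard SS'.
by rewrite (induced_connectedU e_sym (nested_connected nS) (nested_connected nS')
         uS vS')// euv orbT.
Qed.

Definition below S : {set {set V}} := [set S' in nested | S' \proper S].

(** The vertices whose smallest member is [S]. Over all members these sets partition the vertices,
    and they make the linear systems attached to the family triangular. *)
Definition own S : {set V} := S :\: cover (below S).

Lemma below_nested S : below S \subset nested.
Proof. by apply/subsetP => S'; rewrite inE => /andP[]. Qed.

(** Otherwise the members below [S] would cover [Y], and by [nested_cover] the connected set [Y]
    would lie in one of them. *)
Lemma meets_own S Y : S \in nested -> induced_connected e Y -> Y \subset S ->
  {in below S, forall S', ~~ (Y \subset S')} -> exists2 v, v \in Y & v \in own S.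
Proof.
move=> NS cY YS nY; apply: contrapT => noown.
suff /(nested_cover (below_nested S) cY)[S' /nY/negP] : Y \subset cover (below S) by [].
apply/subsetP => v vY; apply: contrapT => /negP vS; apply: noown; exists v => //.
by rewrite inE vS (subsetP YS).
Qed.

Lemma own_neq0 S : S \in nested -> own S != set0.
Proof.
move=> NS; have [|v _ vS] := meets_own NS (nested_connected NS) (subxx S).
  by move=> S'; rewrite inE properE => /and3P[].
by apply/set0Pn; exists v.
Qed.

Lemma own_sub S Y v : S \in nested -> Y \in nested -> v \in own S -> v \in Y ->
  S \subset Y.
Proof.
move=> NS NY; rewrite inE => /andP[/negP vS' vS] vY.
have [//|YS|/disjointFr/(_ vS)] := nested_laminar NS NY; last by rewrite vY.
have [->//|YnS] := eqVneq Y S.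
by case: vS'; apply/bigcupP; exists Y; rewrite // inE NY properEneq YnS.
Qed.

Lemma own_inj S S' v :
  S \in nested -> S' \in nested -> v \in own S -> v \in own S' -> S = S'.
Proof.
move=> NS NS' vS vS'.
have sub (U : {set V}) : v \in own U -> v \in U by rewrite inE => /andP[].
by apply/eqP; rewrite eqEsubset !(own_sub _ _ _ (sub _ _)).
Qed.

Lemma card_own S : S \in nested -> (#|own S| + #|cover (below S)|)%N = #|S|.
Proof.
move=> NS; have sub : cover (below S) \subset S.
  by apply/bigcupsP => S'; rewrite inE properE => /and3P[].
rewrite addnC -(cardsID (cover (below S)) S); congr (_ + _)%N.
by congr #|pred_of_set _|; apply/esym/setIidPr.
Qed.

End Nested.

(** * A triangular system and inequalities between powers of 3 *)

Section TriangularSystem.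
Variables (V : finType) (K : zmodType).

(** A set of maximal size occurs in no equation but its own, so the system is first solved without
    it. *)
Lemma subset_sum_solution (T : {set {set V}}) (z : {set V} -> K) :
  exists c : {set V} -> K,
    forall S, S \in T -> \sum_(S' in T | S' \subset S) c S' = z S.
Proof.
have [m] := ubnP #|T|; elim: m T => // m IH T Tm.
have [->|[S0 TS0]] := set_0Vmem T; first by exists z => S; rewrite inE.
have [S TS Smax] := @arg_maxnP _ S0 (mem T) (fun S : {set V} => #|S|) TS0.
have {}TS : S \in T by [].
have [|c cP] := IH (T :\ S).
  by rewrite (cardsD1 S) TS in Tm.
have nS (S' : {set V}) : S' \in T -> S' != S -> ~~ (S \subset S').
  move=> TS' S'S; apply: contra_neqN S'S => SS'; apply/esym/eqP.
  by rewrite eqEcard SS'; exact: Smax.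
exists (fun S' => if S' == S then z S - \sum_(S' in T :\ S | S' \subset S) c S' else c S').
have sumE (S' : {set V}) : \sum_(U in T :\ S | U \subset S')
    (if U == S then z S - \sum_(W in T :\ S | W \subset S) c W else c U) =
    \sum_(U in T :\ S | U \subset S') c U.
  by apply: eq_bigr => U; rewrite !inE => /andP[/andP[/negbTE->]].
have split (S' : {set V}) : \sum_(U in T | U \subset S')
    (if U == S then z S - \sum_(W in T :\ S | W \subset S) c W else c U) =
    (if S \subset S' then z S - \sum_(W in T :\ S | W \subset S) c W else 0) +
    \sum_(U in T :\ S | U \subset S') c U.
  rewrite -(sumE S'); case: ifPn => SS'.
    rewrite (bigD1 S) ?TS//= eqxx; congr (_ + _).
    by apply: eq_bigl => U; rewrite !inE andbC andbA.
  rewrite add0r; apply: eq_bigl => U; rewrite !inE.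
  by have [->|] := eqVneq U S; rewrite ?(negbTE SS') ?andbF.
move=> S' TS'; rewrite split; have [->|S'S] := eqVneq S' S.
  by rewrite subxx subrK.
by rewrite (negbTE (nS _ TS' S'S)) add0r cP// !inE S'S.
Qed.

End TriangularSystem.

(** Strictness depends on the base: with 2 in place of 3 there is equality at [a = b = 1]. *)
Lemma pow3D a b : (0 < a)%N -> (0 < b)%N -> (3 ^ a + 3 ^ b < 3 ^ (a + b))%N.
Proof.
move=> a0 b0; rewrite expnD.
have a3 : (3 <= 3 ^ a)%N by rewrite -{1}(expn1 3) leq_exp2l.
have b3 : (3 <= 3 ^ b)%N by rewrite -{1}(expn1 3) leq_exp2l.
nia.
Qed.

(** To be read with [s = #|S|], [k = #|own S|], [r = #|Y|] and [j = #|Y :&: own S|], where [S] is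
    the smallest member containing a tube [Y] outside the family: a fraction j/k of 3^s - 3^(s-k)
    exceeds 3^r. *)
Lemma pow3_ineq j k s r : (0 < j <= k)%N -> (k <= s)%N -> (r < s)%N ->
  (r + k <= s + j)%N -> (k * 3 ^ r + j * 3 ^ (s - k) < j * 3 ^ s)%N.
Proof.
move=> /andP[j0 jk] ks rs rk; have [->|j'k] := eqVneq j k.
  have p1 : (3 ^ r <= 3 ^ s.-1)%N by rewrite leq_exp2l//; lia.
  have p2 : (3 ^ (s - k) <= 3 ^ s.-1)%N by rewrite leq_exp2l//; lia.
  have -> : (3 ^ s = 3 * 3 ^ s.-1)%N by rewrite -expnS prednK//; lia.
  have : (0 < 3 ^ s.-1)%N by rewrite expn_gt0.
  nia.
have p1 : (3 ^ r <= 3 ^ (s - k) * 3 ^ j)%N by rewrite -expnD leq_exp2l//; lia.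
have -> : (3 ^ s = 3 ^ (s - k) * (3 ^ (k - j) * 3 ^ j))%N.
  by rewrite -!expnD; congr (3 ^ _)%N; lia.
have p2 : (2 * (k - j) < 3 ^ (k - j))%N.
  by elim: (k - j)%N => // i IH; rewrite expnS; lia.
have p3 : (3 <= 3 ^ j)%N by rewrite -{1}(expn1 3) leq_exp2l.
have p4 : (0 < 3 ^ (s - k))%N by rewrite expn_gt0.
set u := (3 ^ (s - k))%N in p1 p4 *; set v := (3 ^ j)%N in p1 p3 *.
set w := (3 ^ (k - j))%N in p2 *.
(* This is the claim with 3^r replaced by its bound [u * v] and the factor [u] removed; it follows
   from w > 2 (k - j) and v >= 3. *)
have : (k * v + j < j * (w * v))%N.
  have : (j * ((2 * (k - j)).+1 * v) <= j * (w * v))%N.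
    by rewrite leq_mul2l leq_mul2r p2 !orbT.
  have -> : k = (j + (k - j))%N by lia.
  rewrite addKn; move: (k - j)%N (j'k) => i.
  nia.
have : (k * 3 ^ r <= u * (k * v))%N by rewrite mulnCA leq_mul2l p1 orbT.
have : (u * (k * v + j) < u * (j * (w * v)) <-> k * v + j < j * (w * v))%N.
  by rewrite ltn_pmul2l.
nia.
Qed.

(** * Faces of graph-associahedra *)

Section InteriorPoint.
Variables (R : realType) (n : nat) (e : rel 'I_n.+1).
Hypothesis e_sym : symmetric e.
Hypothesis e_conn : induced_connected e [set: 'I_n.+1].
Let V := 'I_n.+1.
Implicit Types (S Y : {set V}) (x : 'rV[R]_n.+1) (T : {set {set V}}).

Definition coord_sum x S : R := \sum_(i in S) x 0 i.

Lemma coord_sumU x S Y : [disjoint S & Y] ->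
  coord_sum x (S :|: Y) = coord_sum x S + coord_sum x Y.
Proof. move=> SY; rewrite /coord_sum -bigU//.
by apply: eq_bigl => i; rewrite !inE. Qed.

Lemma graph_assoc_ge0 x i : graph_assoc_set e x -> 0 <= x 0 i.
Proof.
move=> [xT xS]; have [iT|iT] := eqVneq [set i] [set: V].
  have : \sum_(k in [set i]) x 0 k = 3 ^+ n.+1.
    by rewrite iT -xT; apply: eq_bigl => k; rewrite in_setT.
  by rewrite big_set1 => ->; rewrite exprn_ge0.
have := xS [set i]; rewrite big_set1 => xi.
have iP : [set i] \proper [set: V] by rewrite properEneq iT subsetT.
by apply: le_trans (xi iP (induced_connected1 e i)); rewrite exprn_ge0.
Qed.

Lemma graph_assoc_ge x S : graph_assoc_set e x -> induced_connected e S ->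
  3 ^+ #|S| <= coord_sum x S.
Proof.
move=> [xT xS] cS; have [->|ST] := eqVneq S [set: V].
  rewrite cardsT card_ord -xT le_eqVlt; apply/orP; left; apply/eqP.
  by apply: eq_bigl => i; rewrite in_setT.
by apply: xS => //; rewrite properEneq ST subsetT.
Qed.

(** If the sets were incompatible, their union would be connected while, coordinates being
    nonnegative, its sum would be at most 3^|S| + 3^|S'|, less than the bound imposed on the
    union. *)
Lemma tight_compat x S S' : graph_assoc_set e x ->
    induced_connected e S -> induced_connected e S' ->
    coord_sum x S = 3 ^+ #|S| -> coord_sum x S' = 3 ^+ #|S'| ->
  tube_compat e S S'.
Proof.
move=> xP cS cS' tS tS'; apply/or3P; apply: contrapT => ncompat.
have nSS' : ~~ (S \subset S') by apply/negP => ?; apply: ncompat; constructor 1.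
have nS'S : ~~ (S' \subset S) by apply/negP => ?; apply: ncompat; constructor 2.
have cU : induced_connected e (S :|: S').
  by apply: contrapT => /negP ?; apply: ncompat; constructor 3.
have := graph_assoc_ge xP cU; apply/negP; rewrite -ltNge.
have : coord_sum x (S :|: S') <= 3 ^+ #|S| + 3 ^+ #|S'|.
  rewrite -tS -tS' -(setID (S :|: S') S) setUK setDUl setDv set0U.
  rewrite coord_sumU; last by rewrite -setI_eq0 setIC setIDAC -setIDA setDv setI0.
  rewrite lerD2l /coord_sum [leRHS](big_setID S) /= lerDr.
  by apply: sumr_ge0 => i _; exact: graph_assoc_ge0.
move=> /le_lt_trans; apply.
have s0 : (0 < #|S|)%N by rewrite card_gt0; have /induced_connectedP[] := cS.
have s'0 : (0 < #|S'|)%N by rewrite card_gt0; have /induced_connectedP[] := cS'.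
rewrite -!natrX -natrD ltr_nat.
have [dSS'|/pred0Pn[i /andP[/= iS iS']]] := boolP [disjoint S & S'].
  by rewrite cardsU disjoint_setI0// cards0 subn0 pow3D.
have lt1 : (#|S| < #|S :|: S'|)%N.
  apply: proper_card; rewrite properE subsetUl.
  by apply: contraNN nS'S; exact: subset_trans (subsetUr _ _).
have lt2 : (#|S'| < #|S :|: S'|)%N.
  apply: proper_card; rewrite properE subsetUr.
  by apply: contraNN nSS'; exact: subset_trans (subsetUl _ _).
have l1 : (3 ^ #|S| <= 3 ^ #|S :|: S'|.-1)%N by rewrite leq_exp2l//; lia.
have l2 : (3 ^ #|S'| <= 3 ^ #|S :|: S'|.-1)%N by rewrite leq_exp2l//; lia.
have -> : (3 ^ #|S :|: S'| = 3 * 3 ^ #|S :|: S'|.-1)%N.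
  by rewrite -expnS prednK//; lia.
have := expn_gt0 3 #|S :|: S'|.-1.
move: (3 ^ _)%N (3 ^ _)%N (3 ^ _)%N l1 l2 => u v w; lia.
Qed.

Section Point.
Variable T : {set {set V}}.
Hypothesis cT : T \in cliques (tube_compat e) (tubes e).
Let N := nested T.
Let O := own T.

(** Tightness on the members determines masses [c], and [c S] is spread evenly over [own S].
    Everything below [S] carries at most 3^(|S| - |own S|), so [c S] is large, and the share
    received by a further tube through [own S], for [S] its smallest member, already exceeds the
    bound of that tube. *)
Lemma interior_point : exists2 x : 'rV[R]_n.+1, graph_assoc_set e x &
  forall S, S \in tubes e -> (coord_sum x S == 3 ^+ #|S|) = (S \in T).
Proof.
have [c cP] := subset_sum_solution N (fun S => 3 ^+ #|S| : R).
pose x : 'rV[R]_n.+1 := \row_i \sum_(S in N | i \in O S) c S / #|O S|%:R.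
have O0 S : S \in N -> (0 < #|O S|)%N by move=> NS; rewrite card_gt0 (own_neq0 e_sym e_conn cT).
have xE Y : coord_sum x Y = \sum_(S in N) c S / #|O S|%:R * #|Y :&: O S|%:R.
  rewrite /coord_sum; under eq_bigr do rewrite mxE.
  rewrite (exchange_big_dep (mem N)) /= => [|i S _ /andP[]//].
  apply: eq_bigr => S NS; rewrite sumr_const mulr_natr; congr (_ *+ _).
  by apply: eq_card => i; rewrite [RHS]in_setI unfold_in /= NS.
have xN Y : Y \in N -> coord_sum x Y = 3 ^+ #|Y|.
  move=> NY; rewrite xE -cP// big_mkcondr; apply: eq_bigr => S NS.
  case: ifPn => SY.
    rewrite (setIidPr _) ?divfK// ?pnatr_eq0 -?lt0n ?O0//.
    by apply: subset_trans SY; exact: subsetDl.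
  rewrite (_ : _ :&: _ = set0) ?cards0 ?mulr0//.
  apply/setP => i; rewrite in_set0; apply/negP => /setIP[iY iS].
  by case/negP: SY; exact: (own_sub e_sym e_conn cT) iS iY.
have xO S : S \in N -> coord_sum x (O S) = c S.
  move=> NS; rewrite xE (bigD1 S)//= setIid divfK ?pnatr_eq0 -?lt0n ?O0//.
  rewrite big1 ?addr0// => S' /andP[NS' S'S].
  rewrite (_ : _ :&: _ = set0) ?cards0 ?mulr0//.
  apply/setP => i; rewrite in_set0; apply/negP => /setIP[iS iS'].
  by case/eqP: S'S; exact: (own_inj e_sym e_conn cT) iS' iS.
(* A member of maximal size contains or is disjoint from each other one; splitting it off leaves a
   disjoint cover, and powers of 3 are superadditive. *)
have xcover (M : {set {set V}}) : M \subset N -> coord_sum x (cover M) <= 3 ^+ #|cover M|.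
  have [m] := ubnP #|M|; elim: m M => // m IH M Mm /subsetP MN.
  have [->|[S0 MS0]] := set_0Vmem M.
    by rewrite /cover big_set0 /coord_sum big_set0 cards0.
  have [S MS Smax] := @arg_maxnP _ S0 (mem M) (fun S : {set V} => #|S|) MS0.
  pose M' := [set S' in M | [disjoint S & S']].
  have {}MS : S \in M by [].
  have NS := MN _ MS.
  have S_0 : (0 < #|S|)%N by rewrite card_gt0 (nested_neq0 e_conn cT).
  have coverM : cover M = S :|: cover M'.
    apply/eqP; rewrite eqEsubset; apply/andP; split.
      apply/bigcupsP => S' MS'; have NS' := MN _ MS'.
      have [SS'|S'S|dSS'] := nested_laminar e_sym e_conn cT NS NS'.
      - have /eqP -> : S == S' by rewrite eqEcard SS'; exact: Smax.
        exact: subsetUl.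
      - by apply: subset_trans S'S _; exact: subsetUl.
      - apply: subset_trans (subsetUr _ _); apply: (bigcup_sup S') => //.
        by rewrite inE MS'.
    rewrite subUset (bigcup_sup S)//=; apply/bigcupsP => S'.
    by rewrite inE => /andP[MS' _]; exact: (bigcup_sup S').
  have dM' : [disjoint S & cover M'].
    by apply/bigcup_disjointP => S'; rewrite inE => /andP[].
  rewrite coverM coord_sumU// cardsU disjoint_setI0// cards0 subn0 xN//.
  have le : coord_sum x (cover M') <= 3 ^+ #|cover M'|.
    apply: IH; last by apply/subsetP => S'; rewrite inE => /andP[/MN].
    apply: leq_trans (_ : #|M'| < #|M|)%N _; last by [].
    apply: proper_card; rewrite properE; apply/andP; split.
      by apply/subsetP => S'; rewrite inE => /andP[].
    apply/subsetPn; exists S => //; rewrite inE MS /=.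
    by rewrite -setI_eq0 setIid -card_gt0.
  have [c0|c0] := eqVneq #|cover M'| 0%N.
    move/eqP: c0; rewrite cards_eq0 => /eqP ->.
    by rewrite /coord_sum big_set0 cards0 addn0 addr0.
  apply: (@le_trans _ _ (3 ^+ #|S| + 3 ^+ #|cover M'|)); first by rewrite lerD2l.
  by rewrite -!natrX -natrD ler_nat ltnW// pow3D// lt0n.
have cge S : S \in N -> 3 ^+ #|S| - 3 ^+ (#|S| - #|O S|)%N <= c S.
  move=> NS; have := card_own NS; rewrite -/N -/O => cO.
  have sub : cover (below T S) \subset S.
    by apply/bigcupsP => S'; rewrite inE properE => /and3P[].
  rewrite lerBlDr -(xN _ NS) -(xO _ NS) -{1}(setID S (cover (below T S))).
  rewrite setIC (setIidPl sub) coord_sumU; last first.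
    rewrite -setI_eq0; apply/eqP/setP => i; rewrite !inE.
    by case: (i \in cover _); rewrite ?andbF.
  rewrite addrC lerD2l -cO addKn; apply: xcover; exact: below_nested.
have cge0 S : S \in N -> 0 <= c S.
  move=> NS; apply: le_trans (cge _ NS); rewrite subr_ge0.
  by rewrite ler_eXn2l ?leq_subr// ltr1n.
have cO0 S Y : S \in N -> 0 <= c S / #|O S|%:R * #|Y :&: O S|%:R.
  by move=> NS; rewrite mulr_ge0// divr_ge0// cge0.
have xgt Y : Y \in tubes e -> Y \notin T -> 3 ^+ #|Y| < coord_sum x Y.
  move=> /tubesP[YnT cY] YT.
  (* The smallest member containing [Y]: no member below it contains [Y], so [Y] meets [own S]. *)
  have [S /andP[NS YS] Smin] := @arg_minnP _ [set: V]
    (fun S => (S \in N) && (Y \subset S)) (fun S : {set V} => #|S|)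
    (introT andP (conj (nestedT T) (subsetT Y))).
  have YnS : Y != S by apply: contraNneq YT => YE; move: NS; rewrite -YE => /setU1P[]// /eqP; rewrite (negbTE YnT).
  have ltYS : (#|Y| < #|S|)%N by apply: proper_card; rewrite properEneq YnS.
  have [|v vY vS] := meets_own e_sym e_conn cT NS cY YS.
    move=> S'; rewrite inE => /andP[NS' S'S]; apply/negP => YS'.
    have := Smin S'; rewrite NS' YS' => /(_ isT).
    by rewrite leqNgt proper_card.
  have le1 : c S / #|O S|%:R * #|Y :&: O S|%:R <= coord_sum x Y.
    rewrite xE (bigD1 S)//= lerDl sumr_ge0// => S' /andP[NS' _].
    exact: cO0.
  apply: lt_le_trans le1.
  have k0 : (0 < #|O S|)%N by exact: O0.
  have j0 : (0 < #|Y :&: O S|)%N by rewrite card_gt0; apply/set0Pn; exists v; rewrite inE vY.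
  rewrite mulrAC ltr_pdivlMr ?ltr0n// mulrC [ltRHS]mulrC.
  apply: (@lt_le_trans _ _ (#|Y :&: O S|%:R * (3 ^+ #|S| - 3 ^+ (#|S| - #|O S|)%N))).
    rewrite mulrBr ltrBrDr -!natrX -!natrM -natrD ltr_nat; apply: pow3_ineq => //.
    - by rewrite j0 subset_leq_card// subsetIr.
    - by rewrite -(card_own NS) leq_addr.
    - have := cardsID (O S) Y; have := card_own NS; rewrite -/O.
      have : (#|Y :\: O S| <= #|cover (below T S)|)%N.
        apply: subset_leq_card; apply/subsetP => i; rewrite !inE.
        move=> /andP[+ iY]; rewrite (subsetP YS)// andbT negbK; exact.
      clear; lia.
  by rewrite ler_wpM2l// cge.
exists x; last first.
  move=> S /[dup] Stube /tubesP[SnT cS]; have [ST|ST] := boolP (S \in T).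
    by apply/eqP/xN/setU1P; right.
  by apply/negbTE; rewrite gt_eqF// xgt.
split.
  have := xN _ (nestedT T); rewrite cardsT card_ord => <-.
  by apply: eq_bigl => i; rewrite in_setT.
move=> S SP cS; have Stube : S \in tubes e by rewrite inE SP.
have [ST|ST] := boolP (S \in T); last exact/ltW/xgt.
by rewrite -xN//; apply/setU1P; right.
Qed.

End Point.
End InteriorPoint.

(** Used to leave a point by a small step in a given direction without violating the finitely many
    constraints that are slack there. *)
Lemma exists_small_scale (R : realType) (I : finType) (P : pred I) (a b : I -> R) :
  (forall i, P i -> 0 < a i) ->
  exists2 t : R, 0 < t & forall i, P i -> t * b i <= a i.
Proof.
move=> a0; pose s := 1 + \sum_(i | P i) `|b i| / a i.
have s0 : 0 < s.
  by rewrite ltr_pwDl// sumr_ge0// => i Pi; rewrite divr_ge0// ltW// a0.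
exists s^-1; first by rewrite invr_gt0.
move=> i Pi; rewrite mulrC ler_pdivrMr// -ler_pdivrMl ?a0// mulrC.
apply: (@le_trans _ _ (`|b i| / a i)).
  by rewrite ler_pM2r ?invr_gt0 ?a0// ler_norm.
rewrite /s (bigD1 i)//= addrCA lerDl addr_ge0// sumr_ge0// => j /andP[Pj _].
by rewrite divr_ge0// ltW// a0.
Qed.

Section GraphFaces.
Variables (R : realType) (n : nat) (e : rel 'I_n.+1).
Hypothesis e_sym : symmetric e.
Hypothesis e_conn : induced_connected e [set: 'I_n.+1].
Let V := 'I_n.+1.
Implicit Types (S Y : {set V}) (x y : 'rV[R]_n.+1) (T U : {set {set V}}).

Let P : polytope R n.+1 := graph_associahedron R e.
Let X := cliques (tube_compat e) (tubes e).

Lemma coord_sumDZ x y a S : coord_sum (x + a *: y) S = coord_sum x S + a * coord_sum y S.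
Proof.
by rewrite /coord_sum mulr_sumr -big_split; apply: eq_bigr => i _; rewrite !mxE.
Qed.

Lemma dotDZ m (c x y : 'rV[R]_m) a : dot c (x + a *: y) = dot c x + a * dot c y.
Proof.
rewrite /dot mulr_sumr -big_split; apply: eq_bigr => i _; rewrite !mxE /=.
by ring.
Qed.

Definition tube_face_set T : set 'rV[R]_n.+1 := fun x =>
  graph_assoc_set e x /\ forall S, S \in T -> coord_sum x S = 3 ^+ #|S|.

Lemma tube_face_setS T U : T \subset U -> (tube_face_set U `<=` tube_face_set T)%classic.
Proof. by move=> /subsetP TU x [Px xU]; split=> // S /TU; exact: xU. Qed.

Lemma tube_face_point T : T \in X -> exists2 x, tube_face_set T x &
  forall S, S \in tubes e -> (coord_sum x S == 3 ^+ #|S|) = (S \in T).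
Proof.
move=> cT; have [x Px xT] := interior_point R e_sym e_conn cT; exists x => //.
split=> // S ST; apply/eqP; rewrite xT//.
by have [/subsetP TA _] := cliquesP cT; exact: TA.
Qed.

(** The functional is minus the sum of [coord_sum] over the tubes of [U]. Each of these is bounded
    below on the polytope, and [tube_face_point] provides a point attaining all the bounds at
    once. *)
Lemma tube_face_argmax T U : U \in X -> T \subset U ->
  exists c, tube_face_set U = argmax c (tube_face_set T).
Proof.
move=> cU TU; have [/subsetP UA _] := cliquesP cU.
pose c : 'rV[R]_n.+1 := - \row_i \sum_(S in U) (i \in S)%:R.
have cE x : dot c x = - \sum_(S in U) coord_sum x S.
  rewrite /c dotN; congr (- _); rewrite /dot /coord_sum.
  under eq_bigr do rewrite mxE mulr_suml.
  rewrite exchange_big /=; apply: eq_bigr => S _; rewrite [RHS]big_mkcond.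
  by apply: eq_bigr => i _; case: ifP; rewrite ?mul1r ?mul0r.
have ge x S : graph_assoc_set e x -> S \in U -> 3 ^+ #|S| <= coord_sum x S.
  by move=> Px /UA/tubesP[_ cS]; exact: (graph_assoc_ge Px cS).
exists c; apply/seteqP; split=> x.
  move=> Ux; split=> [|y [Py _]]; first exact: tube_face_setS Ux.
  rewrite !cE lerN2; apply: ler_sum => S US.
  by have [_ ->//] := Ux; exact: ge.
move=> [[Px xT] xmax]; split=> // S US.
have [z Uz _] := tube_face_point cU.
have := xmax z (tube_face_setS TU Uz); rewrite !cE lerN2 => le.
(* The total slack at [x] is at most that at [z], which is 0, and every single slack is
   nonnegative. *)
have : \sum_(S in U) (coord_sum x S - 3 ^+ #|S|) = 0.
  apply/eqP; rewrite eq_le; apply/andP; split; last first.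
    by apply: sumr_ge0 => S' US'; rewrite subr_ge0 ge.
  rewrite sumrB subr_le0; apply: (le_trans le).
  by apply: ler_sum => S' US'; have [_ ->] := Uz.
move=> s0; apply/eqP; rewrite -subr_eq0; apply/eqP.
by apply: (psumr_eq0P _ s0 US) => S' US'; rewrite subr_ge0 ge.
Qed.

Lemma tube_face_set0 : tube_face_set set0 = pset P.
Proof. by apply/seteqP; split=> x [] // Px; split=> // S; rewrite inE. Qed.

Lemma tube_face_is_polytope T : T \in X -> is_polytope (tube_face_set T).
Proof.
move=> cT; have [c cE] := tube_face_argmax cT (sub0set T).
have [z Tz _] := tube_face_point cT.
rewrite cE tube_face_set0; apply: argmax_is_polytope.
by exists z; rewrite -tube_face_set0 -cE.
Qed.

Definition tube_face T : polytope R n.+1 :=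
  if pselect (is_polytope (tube_face_set T)) is left TP then Polytope TP else P.

Lemma tube_faceE T : T \in X -> pset (tube_face T) = tube_face_set T.
Proof.
by move=> /tube_face_is_polytope TP; rewrite /tube_face; case: pselect.
Qed.

Lemma tube_face0 : tube_face set0 = P.
Proof.
by apply: polytope_inj; rewrite tube_faceE ?tube_face_set0//; exact: cliques0.
Qed.

Lemma tube_face_faces T U : T \in X -> U \in X -> T \subset U ->
  faces (tube_face T) (tube_face U).
Proof.
move=> cT cU TU; have [c cE] := tube_face_argmax cU TU.
by exists c; rewrite !tube_faceE.
Qed.

Lemma tube_face_convex T x y t : tube_face_set T x -> tube_face_set T y -> 0 < t < 1 ->
  tube_face_set T (x + t *: (y - x)).
Proof.
move=> [Px xT] [Py yT] /andP[t0 t1].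
have sE S : coord_sum (x + t *: (y - x)) S =
    (1 - t) * coord_sum x S + t * coord_sum y S.
  by rewrite -[y - x]/(y + - x) -[- x]scale1r scalerN -scaleNr !coord_sumDZ; ring.
have ge0 : 0 <= 1 - t by rewrite subr_ge0 ltW.
have eqs S a : coord_sum x S = a -> coord_sum y S = a ->
    coord_sum (x + t *: (y - x)) S = a.
  by rewrite sE => -> ->; ring.
split; last by move=> S ST; apply: eqs; [exact: xT|exact: yT].
have [xs xle] := Px; have [ys yle] := Py; split.
  have cT (z : 'rV[R]_n.+1) : \sum_i z 0 i = coord_sum z [set: V].
    by apply: eq_bigl => i; rewrite in_setT.
  by rewrite cT; apply: eqs; rewrite -cT.
move=> S SP cS; rewrite -/(coord_sum _ S) sE.
have -> : 3 ^+ #|S| = (1 - t) * 3 ^+ #|S| + t * 3 ^+ #|S| :> R by ring.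
by apply: lerD; rewrite ler_wpM2l ?(ltW t0)//; [exact: xle|exact: yle].
Qed.

(** The tubes sought are those tight at a point of [G] where as few as possible are tight, a
    substitute for a relative interior point. *)
Lemma faces_tube_face T G : T \in X -> faces (tube_face T) G ->
  exists2 U, U \in X & T \subset U /\ G = tube_face U.
Proof.
move=> cT [c]; rewrite tube_faceE// => GE.
have GT x : pset G x -> tube_face_set T x by rewrite GE => -[].
pose tight x : {set {set V}} := [set S in tubes e | coord_sum x S == 3 ^+ #|S|].
have tightX x : tube_face_set T x -> tight x \in X.
  move=> [Px _]; apply/cliquesP; split; first by apply/subsetP => S; rewrite inE => /andP[].
  move=> S S'; rewrite !inE => /andP[/andP[_ cS] /eqP tS] /andP[/andP[_ cS'] /eqP tS'].
  exact: (tight_compat e_conn Px cS cS' tS tS').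
have tightT x : tube_face_set T x -> T \subset tight x.
  move=> [_ xT]; apply/subsetP => S ST; have [/subsetP TA _] := cliquesP cT.
  by rewrite inE TA// xT/=.
have [x0 Gx0 x0min] : exists2 x, pset G x &
    forall y, pset G y -> tight x \subset tight y.
  have exn : exists m, `[< exists2 x, pset G x & #|tight x| = m >].
    by have [[x Gx] _ _] := psetP G; exists #|tight x|; apply/asboolP; exists x.
  case: (ex_minnP exn) => m /asboolP[x Gx xm] mmin; exists x => // y Gy.
  have h01 : 0 < (2^-1 : R) < 1 by rewrite invr_gt0 ltr0n invf_lt1 ?ltr1n ?ltr0n.
  (* At the midpoint a tube is tight only if it is tight at both ends, so minimality at [x] yields
     [tight x \subset tight y]. *)
  pose z := x + 2^-1 *: (y - x).
  have Tz : tube_face_set T z by apply: tube_face_convex => //; exact: GT.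
  have Gz : pset G z.
    move: Gx Gy; rewrite GE => -[Tx xmax] [Ty ymax]; split=> // w Tw.
    have -> : dot c z = dot c x.
      have cxy : dot c x = dot c y by apply/eqP; rewrite eq_le xmax// ymax.
      rewrite /z -[y - x]/(y + - x) -[- x]scale1r scalerN -scaleNr !dotDZ -cxy.
      by ring.
    exact: xmax.
  have zxy : tight z \subset tight x :&: tight y.
    apply/subsetP => S; rewrite !inE => /andP[/[dup] /andP[_ cS] -> /= /eqP].
    have [[Px _] [Py _]] := (GT _ Gx, GT _ Gy).
    have := graph_assoc_ge Px cS; have := graph_assoc_ge Py cS.
    rewrite /z -[y - x]/(y + - x) -[- x]scale1r scalerN -scaleNr !coord_sumDZ.
    by move=> y1 x1 tz; apply/andP; split; apply/eqP; lra.
  have zx : tight z = tight x.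
    apply/eqP; rewrite eqEcard (subset_trans zxy (subsetIl _ _)) xm mmin//.
    by apply/asboolP; exists z.
  by rewrite -zx; apply: subset_trans zxy _; exact: subsetIr.
exists (tight x0); first exact/tightX/GT.
split; first exact/tightT/GT.
apply: polytope_inj; rewrite tube_faceE; last exact/tightX/GT.
apply/seteqP; split=> z.
  move=> Gz; have [Pz _] := GT _ Gz; split=> // S Sx0.
  by have := subsetP (x0min _ Gz) _ Sx0; rewrite inE => /andP[_ /eqP].
move=> [Pz zt]; have [Px0 x0T] := GT _ Gx0.
have x0gt S : S \in tubes e :\: tight x0 -> 0 < coord_sum x0 S - 3 ^+ #|S|.
  rewrite !inE => /andP[+ /[dup] St /andP[_ cS]]; rewrite St /= => nt.
  by rewrite subr_gt0 lt_def nt (graph_assoc_ge Px0 cS).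
have [t t0 tle] := exists_small_scale (fun S => coord_sum z S - coord_sum x0 S) x0gt.
(* The segment from [z] to [x0] is prolonged a little beyond [x0] inside the face; since [x0]
   maximizes [c], the value of [c] at [z] cannot be smaller. *)
pose w := x0 + t *: (x0 - z).
have sw S : coord_sum w S = coord_sum x0 S + t * (coord_sum x0 S - coord_sum z S).
  by rewrite /w -[x0 - z]/(x0 + - z) -[- z]scale1r scalerN -scaleNr !coord_sumDZ; ring.
have eqs S a : coord_sum x0 S = a -> coord_sum z S = a -> coord_sum w S = a.
  by rewrite sw => -> ->; ring.
have Tw : tube_face_set T w.
  split; last first.
    move=> S ST; apply: eqs; [exact: x0T|apply: zt].
    exact: (subsetP (tightT _ (GT _ Gx0))).
  split.
    have cT' (u : 'rV[R]_n.+1) : \sum_i u 0 i = coord_sum u [set: V].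
      by apply: eq_bigl => i; rewrite in_setT.
    by have [[x0s _] [zs _]] := (Px0, Pz); rewrite cT'; apply: eqs; rewrite -cT'.
  move=> S SP cS; rewrite -/(coord_sum _ S).
  have St : S \in tubes e by rewrite inE SP.
  have [Sx0|Sx0] := boolP (S \in tight x0).
    rewrite (eqs _ (3 ^+ #|S|))//; last exact: zt.
    by move: Sx0; rewrite inE => /andP[_ /eqP].
  by have := tle S; rewrite in_setD Sx0 St => /(_ isT); rewrite sw; lra.
have : pset G x0 by [].
rewrite GE => -[Tx0 x0max]; split.
  by split=> // S ST; apply: zt; exact: (subsetP (tightT _ Tx0)).
move=> u Tu; apply: le_trans (x0max _ Tu) _.
have := x0max _ Tw; rewrite /w -[x0 - z]/(x0 + - z) -[- z]scale1r scalerN -scaleNr.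
rewrite !dotDZ => le; have : t * (dot c x0 - dot c z) <= 0 by lra.
by rewrite pmulr_rle0// subr_le0.
Qed.

(** The faces of the face of [T] belong to the cliques containing [T], that is to [T :|: U] with [U]
    a clique of the link. *)
Lemma tube_face_realizes T : T \in X ->
  realizes (tube_compat e) (link (tube_compat e) (tubes e) T) (tube_face T)
    (fun U => tube_face (T :|: U)).
Proof.
move=> cT; have [/subsetP TA Tc] := cliquesP cT.
have cTU U : U \in cliques (tube_compat e) (link (tube_compat e) (tubes e) T) ->
    T :|: U \in X.
  move=> /cliquesP[/subsetP UL Uc]; apply/cliquesP; split.
    apply/subsetP => S; rewrite in_setU => /orP[/TA//|/UL/linkP[]//].
  move=> S S'; rewrite !in_setU => /orP[ST|/[dup] SU /UL/linkP[_ _ SL]].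
    case/orP=> [|/UL/linkP[_ _ S'L]]; first exact: Tc.
    by rewrite tube_compat_sym; exact: S'L.
  by case/orP=> [|S'U]; [exact: SL|exact: Uc].
split.
- by move=> U cU; apply: tube_face_faces => //; [exact: cTU|exact: subsetUl].
- move=> G /(faces_tube_face cT)[U cU [TU ->]]; exists (U :\: T).
    have [/subsetP UA Uc] := cliquesP cU; apply/cliquesP; split.
      apply/subsetP => S /setDP[SU ST]; apply/linkP; split=> // [|S' S'T].
        exact: UA.
      by apply: Uc => //; exact: (subsetP TU).
    by move=> S S' /setDP[SU _] /setDP[S'U _]; exact: Uc.
  congr tube_face; apply/setP => S; rewrite in_setU in_setD.
  by case: (boolP (S \in T)) => // /(subsetP TU).
- move=> U U' cU cU'; rewrite !tube_faceE ?cTU//; split=> [sub|U'U]; last first.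
    by apply: tube_face_setS; exact: setUS.
  have [x /sub[_ xU'] xt] := tube_face_point (cTU _ cU).
  apply/subsetP => S SU'; have [/subsetP/(_ _ SU')/linkP[St ST _] _] := cliquesP cU'.
  have := xt _ St; rewrite xU' ?inE ?SU' ?orbT// eqxx => /esym.
  by rewrite (negbTE ST).
Qed.

End GraphFaces.

(** * Dimensions of faces and the motivic interior as a signed sum over cliques *)

Section GraphDimension.
Variables (R : realType) (n : nat) (e : rel 'I_n.+1).
Hypothesis e_sym : symmetric e.
Hypothesis e_conn : induced_connected e [set: 'I_n.+1].
Let V := 'I_n.+1.
Implicit Types (S Y : {set V}) (x y : 'rV[R]_n.+1) (T U : {set {set V}}).
Let X := cliques (tube_compat e) (tubes e).

Lemma card_nested T : T \in X -> #|nested T| = #|T|.+1.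
Proof.
move=> cT; rewrite cardsU1; case: (boolP (_ \in T)) => // TT.
have [/subsetP TA _] := cliquesP cT.
by have /tubesP[] := TA _ TT; rewrite eqxx.
Qed.

(** Its left kernel is the space of directions of the face: the vectors whose coordinate sums over
    all members vanish. *)
Definition incidence (N : {set {set V}}) : 'M[R]_(n.+1, #|N|) :=
  \matrix_(i, j) (i \in (enum_val j : {set V}))%:R.

Lemma mul_incidence d (A : 'M[R]_(d, n.+1)) N k j :
  (A *m incidence N) k j = coord_sum (row k A) (enum_val j).
Proof.
rewrite mxE /coord_sum [RHS]big_mkcond; apply: eq_bigr => i _; rewrite !mxE.
by case: ifP; rewrite ?mulr1 ?mulr0.
Qed.

(** In a linear relation take a member of maximal size among those with nonzero coefficient; by
    [own_sub] a vertex of its [own] lies in no other of them. *)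
Lemma rank_incidence T : T \in X -> \rank (incidence (nested T)) = #|T|.+1.
Proof.
move=> cT; rewrite -(card_nested cT) -mxrank_tr.
apply/eqP; rewrite -/(row_free _) -kermx_eq0; apply/eqP/row_matrixP => k.
rewrite row0; have := sub_kermxP (row_sub k (kermx (incidence (nested T))^T)).
move: (row k _) => u u0; apply/rowP => j; rewrite mxE; apply: contrapT => /eqP uj.
have [j' uj' jmax] := @arg_maxnP _ j (fun j => u 0 j != 0)
  (fun j => #|enum_val j : {set V}|) uj.
have Nj (i : 'I_#|nested T|) : enum_val i \in nested T by exact: enum_valP.
have /set0Pn[v vj'] := own_neq0 e_sym e_conn cT (Nj j').
have /matrixP/(_ 0 v) := u0; rewrite !mxE (bigD1 j')//= !mxE.
have vS : v \in (enum_val j' : {set V}) by move: vj'; rewrite inE => /andP[].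
rewrite vS mulr1 big1 ?addr0 => [/eqP|i ij']; first by rewrite (negbTE uj').
rewrite !mxE; case: (boolP (v \in _)) => vi; last by rewrite mulr0.
rewrite mulr1; apply: contrapT => /eqP ui; case/eqP: ij'; apply: (@enum_val_inj _ (mem (nested T))).
have := own_sub e_sym e_conn cT (Nj j') (Nj i) vj' vi.
by move=> sub; apply/esym/eqP; rewrite eqEcard sub; exact: jmax.
Qed.

Lemma coord_sumD x y S : coord_sum (x + y) S = coord_sum x S + coord_sum y S.
Proof. by rewrite -[y in LHS]scale1r coord_sumDZ mul1r. Qed.

(** Directions inside the face annihilate the incidence vectors, which gives the upper bound. For
    the lower bound, a small multiple of a basis of the kernel is added to a point where no tube
    outside [T] is tight. *)
Lemma pdim_tube_face_set T : T \in X -> pdim (@tube_face_set R n e T) = (n - #|T|)%N.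
Proof.
move=> cT; have rN := rank_incidence cT.
apply/eqP; rewrite eqn_leq; apply/andP; split.
  apply/bigmax_leqP => d /asboolP[x [A [Tx TA /eqP rA]]].
  suff /mulmx0_rank_max : A *m incidence (nested T) = 0 by rewrite rA rN; lia.
  apply/matrixP => k j; rewrite mul_incidence mxE.
  have eqs S a : coord_sum x S = a -> coord_sum (x + row k A) S = a ->
      coord_sum (row k A) S = 0.
    by rewrite coord_sumD => ->; lra.
  have [Px xT] := Tx; have [PA AT] := TA k.
  have := enum_valP j; rewrite {1}/nested => /setU1P[->|jT]; last first.
    by apply: (eqs _ (3 ^+ #|(enum_val j : {set V})|)); [exact: xT|exact: AT].
  have cs (u : 'rV[R]_n.+1) : \sum_i u 0 i = coord_sum u [set: V].
    by apply: eq_bigl => i; rewrite in_setT.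
  have [[x1 _] [A1 _]] := (Px, PA).
  by apply: (eqs _ (3 ^+ n.+1)); rewrite -cs.
have [x0 Tx0 x0t] := tube_face_point R e_sym e_conn cT.
pose K := kermx (incidence (nested T)).
have rK : \rank K = (n - #|T|)%N by rewrite mxrank_ker rN subSS.
have x0gt (p : 'I_(\rank K) * {set V}) : (p.2 \in tubes e) && (p.2 \notin T) ->
    0 < coord_sum x0 p.2 - 3 ^+ #|p.2|.
  move=> /andP[St ST]; have /tubesP[_ cS] := St; have [Px0 _] := Tx0.
  by rewrite subr_gt0 lt_def (graph_assoc_ge Px0 cS) x0t// ST.
have [t t0 tle] := exists_small_scale
  (fun p => - coord_sum (row p.1 (row_base K)) p.2) x0gt.
have dn : (\rank K < n.+2)%N by rewrite rK; lia.
rewrite -rK; apply: (@leq_bigmax_cond _ _ (fun d : 'I_n.+2 => d : nat) (Ordinal dn)).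
apply/asboolP; exists x0, (t *: row_base K); split=> //; last first.
  have := row_base_free K; rewrite /row_free.
  by rewrite (eqmx_scale _ (lt0r_neq0 t0)).
move=> k; set r := row k (row_base K).
have r0 S : S \in nested T -> coord_sum r S = 0.
  move=> NS; have : row_base K *m incidence (nested T) = 0.
    by apply/sub_kermxP; rewrite eq_row_base.
  move=> /matrixP/(_ k (enum_rank_in NS S)).
  by rewrite mul_incidence mxE enum_rankK_in.
have -> : x0 + row k (t *: row_base K) = x0 + t *: r by rewrite linearZ.
have keep S : S \in nested T -> coord_sum (x0 + t *: r) S = coord_sum x0 S.
  by move=> NS; rewrite coord_sumDZ r0// mulr0 addr0.
have [[x0s x0le] x0T] := Tx0.
split; last by move=> S ST; rewrite keep ?x0T//; exact/setU1r.
split.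
  have cs (u : 'rV[R]_n.+1) : \sum_i u 0 i = coord_sum u [set: V].
    by apply: eq_bigl => i; rewrite in_setT.
  by rewrite cs keep ?nestedT// -cs.
move=> S SP cS; rewrite -/(coord_sum _ S).
have [ST|ST] := boolP (S \in T); first by rewrite keep ?x0T//; exact/setU1r.
have := tle (k, S); rewrite /= ST inE SP cS => /(_ isT).
by rewrite coord_sumDZ -/r; lra.
Qed.

Lemma card_clique_le T : T \in X -> (#|T| <= n)%N.
Proof.
by move=> cT; have := rank_leq_row (incidence (nested T)); rewrite rank_incidence.
Qed.

Let P : polytope R n.+1 := graph_associahedron R e.

Lemma graph_links_realizable : links_realizable R (tube_compat e) (tubes e) set0.
Proof.
move=> T /cliques_overP[cT _]; exists n.+1, (tube_face R e T).
by eexists; exact: tube_face_realizes.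
Qed.

Lemma graph_flag_class : flag_class R (tube_compat e) (tubes e) = class_of P.
Proof.
have := tube_face_realizes R e_sym e_conn (cliques0 _ _).
by rewrite link0 tube_face0// => /flag_classE.
Qed.

Lemma to_rat_poly_class m (Q : polytope R m) :
  to_rat (poly_class Q) = mkmalgU (class_of Q) 1.
Proof. by rewrite /to_rat mmapU mul1r. Qed.

Lemma to_rat_sign k (a : polytope_ring R) : to_rat ((-1) ^+ k * a) = (-1) ^+ k * to_rat a.
Proof.
pose f : {additive polytope_ring R -> polytope_ringQ R} := @to_rat R.
elim: k => [|k IH]; first by rewrite !expr0 !mul1r.
rewrite !exprS -!mulrA !mulN1r -IH; exact: (raddfN f).
Qed.

Lemma graph_motivic_interior :
  to_rat (motivic_interior P) = flag_sum R (tube_compat e) (tubes e) set0.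
Proof.
have bij : set_bij [set` enum X]%classic (faces P) (tube_face R e).
  split=> [T /=|T U /set_mem/= + /set_mem/= + TU|G].
  - rewrite mem_enum -[P](tube_face0 R e_sym e_conn) => cT; apply: tube_face_faces => //.
      exact: cliques0.
    exact: sub0set.
  - rewrite !mem_enum => cT cU; have [x Tx xt] := tube_face_point R e_sym e_conn cT.
    have [y Uy yt] := tube_face_point R e_sym e_conn cU.
    have [/subsetP TA _] := cliquesP cT; have [/subsetP UA _] := cliquesP cU.
    have /(congr1 (@pset _ _)) := TU; rewrite !tube_faceE// => TUE.
    apply/eqP; rewrite eqEsubset; apply/andP; split; apply/subsetP => S SW.
      by move: Uy; rewrite -TUE => -[_ /(_ _ SW)] /eqP; rewrite yt//; exact: TA.
    by move: Tx; rewrite TUE => -[_ /(_ _ SW)] /eqP; rewrite xt//; exact: UA.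
  - rewrite -[P](tube_face0 R e_sym e_conn) => /faces_tube_face[]//; first exact: cliques0.
    by move=> U cU [_ ->]; exists U; rewrite //= mem_enum.
rewrite /motivic_interior (reindex_fsbig _ _ _ _ bij) -fsbig_seq ?enum_uniq// big_enum /=.
pose f : {additive polytope_ring R -> polytope_ringQ R} := @to_rat R.
rewrite -[LHS]/(f _) raddf_sum /flag_sum; apply: eq_big => [T|T cT].
  by apply/idP/cliques_overP => [cT|[]//]; split=> //; exact: sub0set.
have le := card_clique_le cT.
have cls : flag_class R (tube_compat e) (link (tube_compat e) (tubes e) T) =
    class_of (tube_face R e T).
  exact/flag_classE/tube_face_realizes.
have dP : pdim P = n.
  by have := pdim_tube_face_set (cliques0 _ _); rewrite tube_face_set0 cards0 subn0.
have sgn : (pdim P - pdim (tube_face R e T))%N = #|T|.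
  by rewrite dP (tube_faceE R e_sym e_conn cT) pdim_tube_face_set// subKn.
apply: etrans (to_rat_sign _ _) _.
by rewrite to_rat_poly_class sgn /flag_term cls.
Qed.

End GraphDimension.

(** * Associahedra and chords *)

Definition crossing (x y : nat * nat) : bool :=
  [&& x.1 < y.1, y.1 < x.2 & x.2 < y.2]%N.

Definition noncrossing (x y : nat * nat) : bool := ~~ crossing x y && ~~ crossing y x.

Lemma path_graph_sym n : symmetric (@path_graph n).
Proof. by move=> i j; rewrite /path_graph orbC. Qed.

Section PathTubes.
Variable n : nat.
Let e := @path_graph n.+1.
Implicit Types (S : {set 'I_n.+1}) (x y : nat * nat).

(** The vertex [i] sits at the point [a + i.+1] of the line, and a chord cuts out the points
    strictly inside it; the offset [a] places the path in any window. *)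
Definition path_interval (a : nat) x : {set 'I_n.+1} :=
  [set i : 'I_n.+1 | (x.1 < a + i.+1 < x.2)%N].

Lemma path_interval_connected a x : (a <= x.1)%N -> (x.1.+2 <= x.2)%N ->
  (x.2 <= a + n.+2)%N -> induced_connected e (path_interval a x).
Proof.
case: x => c d /= ac cd dn; have -> : d = (c.+2 + (d - c.+2))%N by lia.
have : (c.+2 + (d - c.+2) <= a + n.+2)%N by lia.
elim: (d - c.+2)%N => [|k IH] kn.
  have cn : (c - a < n.+1)%N by lia.
  rewrite (_ : path_interval _ _ = [set Ordinal cn]); first exact: induced_connected1.
  by apply/setP => i; rewrite !inE -val_eqE /=; lia.
have ln : (c + k + 1 - a < n.+1)%N by lia.
have kn' : (c + k - a < n.+1)%N by lia.
rewrite (_ : path_interval _ _ =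
  path_interval a (c, c.+2 + k)%N :|: [set Ordinal ln]); last first.
  by apply/setP => i; rewrite !inE -val_eqE /=; lia.
apply: (induced_connectedU (@path_graph_sym _) (IH _) (induced_connected1 _ _)
  (u := Ordinal kn') (v := Ordinal ln)); rewrite ?inE /path_graph -?val_eqE /=; lia.
Qed.

Lemma path_connected : induced_connected e [set: 'I_n.+1].
Proof.
rewrite (_ : [set: _] = path_interval 0 (0, n.+2)%N); first exact: path_interval_connected.
by apply/setP => i; rewrite !inE /=; have := ltn_ord i; lia.
Qed.

Lemma path_connected_interval a S : induced_connected e S -> exists x,
  [/\ (a <= x.1)%N, (x.1.+2 <= x.2)%N, (x.2 <= a + n.+2)%N & S = path_interval a x].
Proof.
move=> cS; have [/set0Pn[s sS] _] := induced_connectedP cS.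
have [p pS pmin] := @arg_minnP _ s (mem S) (fun i : 'I_n.+1 => i : nat) sS.
have [q qS qmax] := @arg_maxnP _ s (mem S) (fun i : 'I_n.+1 => i : nat) sS.
have {}pS : p \in S by []. have {}qS : q \in S by [].
have pn := ltn_ord p; have qn := ltn_ord q; have pq : (p <= q)%N by exact: pmin.
exists (a + p, a + q.+2)%N; split=> /=; try lia.
apply/setP => k; rewrite inE /=; apply/idP/idP => [kS|pkq].
  by have := pmin k kS; have := qmax k kS => /=; lia.
apply: contrapT => /negP kS.
suff /setP/(_ q) : [set i in S | (i < k)%N] = S.
  rewrite inE qS /= => qk.
  by move: kS; rewrite (_ : k = q) ?qS//; apply/val_inj => /=; lia.
apply: (induced_connected_closed (@path_graph_sym _) cS).
- by apply/subsetP => i; rewrite inE => /andP[].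
- apply/set0Pn; exists p; rewrite inE pS /=.
  have : (p != k :> nat)%N by apply: contraNneq kS => /val_inj <-.
  lia.
- move=> u v; rewrite !inE => /andP[uS uk] vS; rewrite vS /path_graph /=.
  have : (v != k :> nat)%N by apply: contraNneq kS => /val_inj <-.
  lia.
Qed.

(** Disjoint intervals are non-adjacent when at least one point remains between them, and a common
    end of the two chords is such a point. *)
Lemma path_tube_compat a x y :
    (a <= x.1)%N -> (x.1.+2 <= x.2)%N -> (x.2 <= a + n.+2)%N ->
    (a <= y.1)%N -> (y.1.+2 <= y.2)%N -> (y.2 <= a + n.+2)%N ->
  tube_compat e (path_interval a x) (path_interval a y) = noncrossing x y.
Proof.
wlog : x y / (x.1 < y.1)%N || (x.1 == y.1) && (y.2 <= x.2)%N.
  move=> H ax xx xn ay yy yn.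
  have [/H->//|xy] := boolP ((x.1 < y.1) || (x.1 == y.1) && (y.2 <= x.2))%N.
  rewrite tube_compat_sym H//; first by rewrite /noncrossing andbC.
  by move: xy; lia.
move=> xy ax xx xn ay yy yn.
have mem z (k : nat) (kn : (k - a.+1 < n.+1)%N) :
    (a < k)%N -> (Ordinal kn \in path_interval a z) = (z.1 < k < z.2)%N.
  by move=> ak; rewrite inE /=; congr (_ && _); lia.
have cx := path_interval_connected ax xx xn.
have cy := path_interval_connected ay yy yn.
apply/or3P/idP => [H|].
  apply: contrapT; rewrite /noncrossing => nc.
  have cr : crossing x y by move: nc; rewrite /crossing; lia.
  move: cr => /and3P[c1 c2 c3].
  (* For crossing chords the point [y.1] is only in the first interval and [x.2] only in the second,
     while the neighbours [x.2.-1] and [x.2] connect the union. *)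
  have n1 : (y.1 - a.+1 < n.+1)%N by lia.
  have n2 : (x.2 - a.+1 < n.+1)%N by lia.
  have n3 : (x.2.-1 - a.+1 < n.+1)%N by lia.
  case: H => [/subsetP/(_ (Ordinal n1))|/subsetP/(_ (Ordinal n2))|/negP].
  - by rewrite !mem; lia.
  - by rewrite !mem; lia.
  apply; apply: (induced_connectedU (@path_graph_sym _) cx cy
    (u := Ordinal n3) (v := Ordinal n2)); rewrite ?mem /path_graph -?val_eqE /=; lia.
rewrite /noncrossing /crossing => nc.
have [yx|yx] := leqP y.2 x.2.
  by constructor 2; apply/subsetP => i; rewrite !inE; lia.
have xy2 : (x.2 <= y.1)%N by lia.
constructor 3; apply/negP => cU.
have n1 : (y.1 - a < n.+1)%N by lia.
have n2 : (x.1 - a < n.+1)%N by lia.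
suff /setP/(_ (Ordinal n1)) : path_interval a x = path_interval a x :|: path_interval a y.
  by rewrite !inE /=; lia.
apply: (induced_connected_closed (@path_graph_sym _) cU).
- exact: subsetUl.
- by apply/set0Pn; exists (Ordinal n2); rewrite inE /=; lia.
- by move=> u v; rewrite !inE /path_graph /=; lia.
Qed.

End PathTubes.

Section IsoBack.
Variables (R : realType) (X Y : finType) (r : rel X) (s : rel Y).
Variables (f : X -> Y) (A B : {set X}).
Hypotheses (finj : {in A &, injective f}).
Hypothesis fr : {in A &, forall x y, s (f x) (f y) = r x y}.
Hypothesis BA : B \subset A.
Variable x0 : X.

(** Polytopes are known for the tubes, on the image side, while the counting is done with chords;
    [g] inverts [f] on its image to carry results back. *)
Let g (y : Y) : X := odflt x0 [pick x in A | f x == y].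

Let gK : {in A, cancel f g}.
Proof.
move=> x xA; rewrite /g; case: pickP => [z /andP[zA /eqP]|/(_ x)] /=; first exact: finj.
by rewrite xA eqxx.
Qed.

Let gimset (C : {set X}) : C \subset A -> g @: (f @: C) = C.
Proof.
move=> /subsetP CA; rewrite -imset_comp -[RHS]imset_id.
by apply: eq_in_imset => x /CA /= /gK.
Qed.

Let ginj : {in f @: A &, injective g}.
Proof. by move=> _ _ /imsetP[x xA ->] /imsetP[y yA ->]; rewrite !gK// => ->. Qed.

Let gr : {in f @: A &, forall x y, r (g x) (g y) = s x y}.
Proof. by move=> _ _ /imsetP[x xA ->] /imsetP[y yA ->]; rewrite !gK// fr. Qed.

Lemma links_realizable_preimset :
  links_realizable R s (f @: A) (f @: B) -> links_realizable R r A B.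
Proof.
by move=> /(links_realizable_imset ginj gr (imsetS _ BA)); rewrite !gimset.
Qed.

Lemma flag_sum_preimset : links_realizable R s (f @: A) (f @: B) ->
  flag_sum R r A B = flag_sum R s (f @: A) (f @: B).
Proof.
by move=> /(flag_sum_imset ginj gr (imsetS _ BA)); rewrite !gimset.
Qed.

Lemma flag_class_preimset : realizable R s (f @: A) ->
  realizable R r A /\ flag_class R r A = flag_class R s (f @: A).
Proof.
move=> ok; have := realizable_imset ginj gr ok.
by have := flag_class_imset ginj gr ok; rewrite gimset.
Qed.

End IsoBack.

Lemma links_realizable_class (R : realType) (X : finType) (r : rel X) (A : {set X}) :
  links_realizable R r A set0 -> realizable R r A.
Proof.
by move=> /(_ set0); rewrite link0; apply; apply/cliques_overP; rewrite cliques0 sub0set.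
Qed.

Section Chords.
Variables (R : realType) (N : nat).
(** One finite type contains the chords of all windows and of the smaller polytopes, so that links
    and joins are formed inside it; [N] is an upper bound for the points in use. *)
Definition chord : finType := ('I_N.+1 * 'I_N.+1)%type.
Implicit Types (u v : chord) (T : {set chord}).

Definition ends u : nat * nat := (u.1 : nat, u.2 : nat).

Definition mk_chord (c d : nat) : chord := (inord c, inord d).

Lemma mk_chordK c d : (c <= N)%N -> (d <= N)%N -> ends (mk_chord c d) = (c, d).
Proof. by move=> cN dN; rewrite /ends /= !inordK. Qed.

Lemma ends_inj : injective ends.
Proof. by move=> [u1 u2] [v1 v2] [/val_inj-> /val_inj->]. Qed.

Lemma ends_le u : ((ends u).1 <= N)%N && ((ends u).2 <= N)%N.
Proof. by apply/andP; split; rewrite -ltnS ltn_ord. Qed.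

Definition chord_compat : rel chord := fun u v => noncrossing (ends u) (ends v).

Definition chords (a b : nat) : {set chord} :=
  [set u | [&& a <= (ends u).1, (ends u).1.+2 <= (ends u).2 & (ends u).2 <= b]%N].

(** The chord from [a] to [b] is left out because it corresponds to the whole path, which is not a
    proper tube. *)
Definition inner_chords (a b : nat) : {set chord} :=
  [set u in chords a b | ends u != (a, b)].

Lemma inner_chordsP a b u : reflect
  [/\ (a <= (ends u).1)%N, ((ends u).1.+2 <= (ends u).2)%N, ((ends u).2 <= b)%N
    & ends u != (a, b)] (u \in inner_chords a b).
Proof.
rewrite 2!inE; apply: (iffP andP) => [[/and3P[? ? ?] ?]|[-> -> -> ->]] //.
Qed.

Section Window.
Variables (a n : nat).
Let b := (a + n.+2)%N.
Hypothesis bN : (b <= N)%N.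
Let f (u : chord) := path_interval n a (ends u).

Let mem_interval z (k : nat) (kn : (k - a.+1 < n.+1)%N) :
  (a < k)%N -> (Ordinal kn \in path_interval n a z) = (z.1 < k < z.2)%N.
Proof. by move=> ak; rewrite inE /=; congr (_ && _); lia. Qed.

Lemma path_interval_inj : {in inner_chords a b &, injective f}.
Proof.
move=> u v /inner_chordsP[u1 u2 u3 _] /inner_chordsP[v1 v2 v3 _] /setP fuv.
apply: ends_inj; rewrite /b in u3 v3; rewrite /f in fuv.
case: (ends u) (ends v) u1 u2 u3 v1 v2 v3 fuv => [c d] [c' d'] /= u1 u2 u3 v1 v2 v3 fuv.
have n1 : (c.+1 - a.+1 < n.+1)%N by lia.
have n2 : (c'.+1 - a.+1 < n.+1)%N by lia.
have n3 : (d.-1 - a.+1 < n.+1)%N by lia.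
have n4 : (d'.-1 - a.+1 < n.+1)%N by lia.
have := fuv (Ordinal n1); have := fuv (Ordinal n2).
have := fuv (Ordinal n3); have := fuv (Ordinal n4).
by rewrite !mem_interval /=; [move=> *; congr pair; lia|lia..].
Qed.

Lemma path_interval_compat : {in inner_chords a b &, forall u v,
  tube_compat (@path_graph n.+1) (f u) (f v) = chord_compat u v}.
Proof.
move=> u v /inner_chordsP[u1 u2 u3 _] /inner_chordsP[v1 v2 v3 _].
exact: path_tube_compat.
Qed.

Lemma path_interval_tubes : f @: inner_chords a b = tubes (@path_graph n.+1).
Proof.
apply/setP => S; apply/imsetP/tubesP => [[u /inner_chordsP[u1 u2 u3 u4] ->]|[ST cS]].
  split; last exact: path_interval_connected.
  apply: contraNneq u4 => /setP uT.
  have n1 : (a.+1 - a.+1 < n.+1)%N by lia.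
  have n2 : (b.-1 - a.+1 < n.+1)%N by rewrite /b; lia.
  have := uT (Ordinal n1); have := uT (Ordinal n2).
  rewrite /f !mem_interval ?inE => [H1 H2||]; [|rewrite /b; lia|lia].
  rewrite /b in u3 H1 *; apply/eqP.
  by case: (ends u) u1 u2 u3 H1 H2 => [c d] /= *; congr pair; lia.
have [[c d] /= [x1 x2 x3 SE]] := path_connected_interval a cS.
exists (mk_chord c d); last by rewrite /f mk_chordK//; move: bN x3; rewrite /b; lia.
apply/inner_chordsP; rewrite mk_chordK; [|move: bN x3; rewrite /b; lia..].
split=> //; apply: contraNneq ST => -[cE dE]; rewrite SE cE dE.
by apply/eqP/setP => i; rewrite !inE /= /b; have := ltn_ord i; lia.
Qed.

Let sym := @path_graph_sym n.+1.
Let conn := path_connected n.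

Lemma inner_chords_realizable : links_realizable R chord_compat (inner_chords a b) set0.
Proof.
apply: (links_realizable_preimset path_interval_inj path_interval_compat (sub0set _)
  (mk_chord 0 0)).
rewrite path_interval_tubes imset0; exact: graph_links_realizable.
Qed.

Lemma inner_chords_class :
  flag_class R chord_compat (inner_chords a b) = class_of (associahedron R n).
Proof.
rewrite /associahedron -(graph_flag_class R sym conn) -path_interval_tubes.
have [|_ ->//] := flag_class_preimset (R := R) path_interval_inj path_interval_compat
  (mk_chord 0 0).
rewrite path_interval_tubes; apply: links_realizable_class.
exact: graph_links_realizable.
Qed.

Lemma inner_chords_sum : flag_sum R chord_compat (inner_chords a b) set0 =
  to_rat (motivic_interior (associahedron R n)).
Proof.
rewrite /associahedron (graph_motivic_interior R sym conn) -path_interval_tubes.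
rewrite (flag_sum_preimset path_interval_inj path_interval_compat (sub0set _)
  (mk_chord 0 0)) imset0//.
by rewrite path_interval_tubes; exact: graph_links_realizable.
Qed.

End Window.

End Chords.

(** * Decomposing flag complexes along their walls *)

Section Fibration.
Variables (R : realType) (X : finType) (r : rel X) (A : {set X}).

(** Whatever is outside [E] and compatible with the forced set [B] lies in [H], and [H] is
    compatible with all of [E]; so [T] cuts down only the part inside [E]. *)
Lemma link_split (E B H T : {set X}) : E \subset A -> H \subset A -> [disjoint H & E] ->
    (forall x y, x \in H -> y \in E -> r x y && r y x) ->
    (forall x, x \in A -> x \notin E -> {in B, forall y, r x y} -> x \in H) ->
    T \in cliques_over r E B ->
  T \in cliques r A /\ link r A T = H :|: link r E T.
Proof.
move=> /subsetP EA /subsetP HA dHE rHE BH /cliques_overP[/cliquesP[/subsetP TE Tc] /subsetP BT].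
split; first by apply/cliquesP; split=> //; apply/subsetP => x /TE/EA.
apply/setP => x; rewrite in_setU; apply/linkP/orP => [[xA xT rx]|[xH|/linkP[xE xT rx]]].
- have [xE|xE] := boolP (x \in E); first by right; apply/linkP.
  by left; apply: BH => // y yB; apply: rx; exact: BT.
- split=> [|| y yT]; first exact: HA.
    by apply/negP => /TE; rewrite (disjointFr dHE xH).
  by have /andP[] := rHE x y xH (TE _ yT).
- by split=> //; exact: EA.
Qed.

(** In both applications [j] encodes a set of uncovered points, [E j] the chords in its gaps, [B j]
    the walls and [H j] the chords between nonconsecutive points. As [H j] is the same for all
    cliques over [j], its class factors out. *)
Lemma flag_sum_fibration (J : eqType) (js : seq J) (E B H : J -> {set X}) :
    uniq js ->
    (forall j, j \in js -> [/\ E j \subset A, H j \subset A & [disjoint H j & E j]]) ->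
    (forall j x y, j \in js -> x \in H j -> y \in E j -> r x y && r y x) ->
    (forall j x, j \in js -> x \in A -> x \notin E j ->
       {in B j, forall y, r x y} -> x \in H j) ->
    (forall j, j \in js ->
       realizable R r (H j) /\ links_realizable R r (E j) (B j)) ->
    (forall T, T \in cliques r A -> exists2 j, j \in js &
       forall i, i \in js -> (T \in cliques_over r (E i) (B i)) = (i == j)) ->
  flag_sum R r A set0 =
  \sum_(j <- js) mkmalgU (flag_class R r (H j)) 1 * flag_sum R r (E j) (B j).
Proof.
move=> ujs sub cross BH ok ex.
transitivity (\sum_(T in cliques r A)
    \sum_(j <- js | T \in cliques_over r (E j) (B j)) flag_term R r A T).
  rewrite /flag_sum; apply: eq_big => [T|T /cliques_overP[cT _]].
    by apply/cliques_overP/idP => [[]//|cT]; split=> //; exact: sub0set.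
  have [j jjs jP] := ex _ cT.
  rewrite big_seq_cond (eq_bigl (fun i => (i \in js) && (i == j))) => [|i]; last first.
    by case: (boolP (i \in js)) => //= /jP.
  by rewrite -big_seq_cond -big_filter (filter_pred1_uniq ujs jjs) big_seq1.
rewrite (exchange_big_dep predT)//= big_seq [RHS]big_seq; apply: eq_bigr => j jjs.
have [EA HA dHE] := sub _ jjs; have [okH okE] := ok _ jjs.
rewrite mulr_sumr; apply: eq_big => [T|T /andP[_ cT]].
  apply/andP/idP => [[]//|cT]; split=> //.
  by have [] := link_split EA HA dHE (fun x y => cross j x y jjs) (fun x => BH j x jjs) cT.
have [_ linkE] := link_split EA HA dHE (fun x y => cross j x y jjs) (fun x => BH j x jjs) cT.
have dHl : [disjoint H j & link r (E j) T] by apply: disjointWr dHE; exact: link_subset.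
have rHl x y : x \in H j -> y \in link r (E j) T -> r x y && r y x.
  by move=> xH /linkP[yE _ _]; exact: cross yE.
have cls := flag_class_join dHl rHl okH (okE _ cT).
rewrite /flag_term linkE cls.
have signMr (K : comNzRingType) (a b c d : K) : c = b * d -> a * c = b * (a * d).
  by move=> ->; rewrite mulrCA.
exact: signMr (monomialM _ _).
Qed.

End Fibration.

Section PointSets.
Implicit Types (P : pred nat) (x : nat * nat).

Definition free P x : bool := all (predC P) (iota x.1.+1 (x.2 - x.1.+1)).

Lemma freeP P x : reflect (forall p, (x.1 < p < x.2)%N -> ~~ P p) (free P x).
Proof.
apply: (iffP allP) => H p; first by move=> xp; apply: H; rewrite mem_iota; lia.
by rewrite mem_iota => xp; apply: H; lia.
Qed.

Lemma prev_point P lo c : P lo -> (lo < c)%N ->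
  exists p, [/\ P p, (lo <= p < c)%N & forall q, (p < q < c)%N -> ~~ P q].
Proof.
move=> Plo loc.
have ex : exists p, P p && (lo <= p < c)%N by exists lo; rewrite Plo leqnn.
have ub p : P p && (lo <= p < c)%N -> (p <= c)%N by lia.
case: (ex_maxnP ex ub) => p /andP[Pp pc] pmax; exists p; split=> // q pq.
by apply/negP => Pq; have := pmax q; rewrite Pq; lia.
Qed.

Lemma next_point P hi c : P hi -> (c < hi)%N ->
  exists p, [/\ P p, (c < p <= hi)%N & forall q, (c < q < p)%N -> ~~ P q].
Proof.
move=> Phi chi.
have ex : exists p, P p && (c < p <= hi)%N by exists hi; rewrite Phi leqnn chi.
case: (ex_minnP ex) => p /andP[Pp pc] pmin; exists p; split=> // q pq.
by apply/negP => Pq; have := pmin q; rewrite Pq; lia.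
Qed.

(** Some point of [P] lies inside [x]. If an end of [x] were not in [P], the wall between the two
    points of [P] around that end would cross [x]. *)
Lemma noncrossing_walls P x lo hi : P lo -> P hi -> (lo <= x.1)%N -> (x.2 <= hi)%N ->
    (forall p q, P p -> P q -> (lo <= p)%N -> (q <= hi)%N -> (p.+2 <= q)%N ->
       free P (p, q) -> noncrossing x (p, q)) ->
  ~~ free P x -> P x.1 && P x.2.
Proof.
move=> Plo Phi lox xhi walls nfree.
have [p [xp Pp]] : exists p, (x.1 < p < x.2)%N /\ P p.
  apply: contrapT => H; case/negP: nfree; apply/freeP => p xp; apply/negP => Pp.
  by apply: H; exists p.
apply: contrapT => /negP; rewrite negb_and => /orP[nP|nP].
  have ne : lo != x.1 by apply: contraNneq nP => <-.
  have [|p0 [P0 l0 u0]] := prev_point Plo (c := x.1); first by lia.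
  have [|p1 [P1 l1 u1]] := next_point Pp (c := x.1); first by lia.
  have fr : free P (p0, p1).
    apply/freeP => q /= q01; have [->//|ne'] := eqVneq q x.1.
    by have [?|?] := ltnP q x.1; [apply: u0|apply: u1]; lia.
  have := walls p0 p1 P0 P1; rewrite /noncrossing /crossing /= fr.
  by lia.
have ne : hi != x.2 by apply: contraNneq nP => <-.
have [|p0 [P0 l0 u0]] := prev_point Pp (c := x.2); first by lia.
have [|p1 [P1 l1 u1]] := next_point Phi (c := x.2); first by lia.
have fr : free P (p0, p1).
  apply/freeP => q /= q01; have [->//|ne'] := eqVneq q x.2.
  by have [?|?] := ltnP q x.2; [apply: u0|apply: u1]; lia.
have := walls p0 p1 P0 P1; rewrite /noncrossing /crossing /= fr.
by lia.
Qed.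

(* The maximal [x] in [T] starting at [a] must end at [b]: otherwise the chord
   covering its endpoint would start at [a] too and be longer. *)
Lemma covered_interval (T : pred (nat * nat)) a b :
    (forall x y, T x -> T y -> noncrossing x y) -> (a.+1 < b)%N ->
    (forall x, T x -> ~~ (x.1 < a < x.2)%N) ->
    (forall x, T x -> ~~ (x.1 < b < x.2)%N) ->
    (forall p, (a < p < b)%N -> exists2 x, T x & (x.1 < p < x.2)%N) ->
  T (a, b).
Proof.
move=> nc ab ua ub cov.
have ex : exists d, T (a, d) && (a.+1 < d <= b)%N.
  have [|[c d] /= Tx xp] := cov a.+1; first by lia.
  have := ua _ Tx; have := ub _ Tx => /= xb xa; exists d.
  by rewrite (_ : a = c) ?Tx //; lia.
have bd d : T (a, d) && (a.+1 < d <= b)%N -> (d <= b)%N by lia.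
case: (ex_maxnP ex bd) => d /andP[Td ad] dmax.
have [<-//|ne] := eqVneq d b.
have [|[c d'] /= Tx xd] := cov d; first by lia.
have := ua _ Tx; have := ub _ Tx => /= xb xa.
have := nc _ _ Td Tx; rewrite /noncrossing /crossing /= => ncx.
have := dmax d'; rewrite (_ : a = c) ?Tx//; lia.
Qed.

End PointSets.

Section Cells.
Variables (R : realType) (N : nat).
Let C := chord N.
Let r := @chord_compat N.
Implicit Types (u v : C) (P : pred nat).

Lemma noncrossing_sym x y : noncrossing x y = noncrossing y x.
Proof. by rewrite /noncrossing andbC. Qed.

Lemma noncrossing_refl x : noncrossing x x.
Proof. by rewrite /noncrossing /crossing ltnn. Qed.

(** When [a] and [b] are in [P], these are the chords contained in a single gap of [P], the one
    spanning the gap included. *)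
Definition cells P a b : {set C} := [set u in chords N a b | free P (ends u)].

Definition walls P a b : {set C} :=
  [set u in cells P a b | P (ends u).1 && P (ends u).2].

Lemma cellsP P a b u : reflect
  [/\ (a <= (ends u).1)%N, ((ends u).1.+2 <= (ends u).2)%N, ((ends u).2 <= b)%N
    & free P (ends u)] (u \in cells P a b).
Proof.
rewrite 2!inE; apply: (iffP andP) => [[/and3P[? ? ?] ?]|[-> -> -> ->]] //.
Qed.

Lemma wallsP P a b u : reflect
  (u \in cells P a b /\ P (ends u).1 && P (ends u).2) (u \in walls P a b).
Proof. exact: setIdP. Qed.

Lemma walls_cells P a b : walls P a b \subset cells P a b.
Proof. by apply/subsetP => u /wallsP[]. Qed.

(** A gap of length at least 2 is the join of its inner chords, which give a motivic interior, and
    of its forced wall, which gives the sign. *)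
Lemma cells_window a b P : (a < b)%N -> (b <= N)%N -> P a -> P b ->
    (forall p, (a < p < b)%N -> ~~ P p) ->
  links_realizable R r (cells P a b) (walls P a b) /\
  flag_sum R r (cells P a b) (walls P a b) = beta_series R (b - a).
Proof.
move=> ab bN Pa Pb nP; have [bE|ab1] := eqVneq b a.+1.
  (* A gap of length 1 has no chord, in accordance with the coefficient 1 of x in beta. *)
  have -> : cells P a b = set0.
    by apply/setP => u; rewrite [RHS]inE; apply/cellsP => -[]; lia.
  have -> : walls P a b = set0.
    by apply/setP => u; rewrite [RHS]inE; apply/wallsP => -[/cellsP[]]; lia.
  rewrite bE subSnn; split; [exact: links_realizable0|exact: flag_sum0].
have [n bE] : exists n, b = (a + n.+2)%N by exists (b - a.+2)%N; lia.
have mcK : ends (mk_chord N a b) = (a, b) by apply: mk_chordK; lia.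
have cE : cells P a b = inner_chords N a b :|: [set mk_chord N a b].
  apply/setP => u; rewrite in_setU in_set1 -(inj_eq (@ends_inj N)) mcK.
  apply/cellsP/orP => [[u1 u2 u3 _]|[|/eqP uE]].
  - by case: (eqVneq (ends u) (a, b)) => uE; [right|left; rewrite !inE uE u1 u2 u3].
  - rewrite bE => /inner_chordsP[u1 u2 u3 _]; split=> //.
    by apply/freeP => p up; apply: nP; lia.
  - by rewrite uE /=; split=> //; [lia|exact/freeP].
have wE : walls P a b = set0 :|: [set mk_chord N a b].
  apply/setP => u; rewrite set0U in_set1 -(inj_eq (@ends_inj N)) mcK.
  apply/wallsP/eqP => [[/cellsP[u1 u2 u3 _] /andP[P1 P2]]|uE]; last first.
    rewrite uE Pa Pb; split=> //; apply/cellsP; rewrite uE.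
    by split=> //=; [lia|exact/freeP].
  case: (ends u) u1 u2 u3 P1 P2 => c d /= u1 u2 u3 P1 P2.
  congr pair; apply: contrapT => /eqP ne.
    by have := nP c; rewrite P1; lia.
  by have := nP d; rewrite P2; lia.
have dis : [disjoint inner_chords N a b & [set mk_chord N a b]].
  rewrite disjoint_sym disjoints1; rewrite bE in mcK *.
  by apply/inner_chordsP => -[_ _ _]; rewrite mcK eqxx.
have cross u v : u \in inner_chords N a b -> v \in [set mk_chord N a b] -> r u v && r v u.
  rewrite bE => /inner_chordsP[u1 u2 u3 _] /set1P ->.
  rewrite /r /chord_compat -bE mcK; case: (ends u) u1 u2 u3 => c d.
  by rewrite /noncrossing /crossing /=; lia.
have [s1 l1] := flag_sum1 R (noncrossing_refl _ : r (mk_chord N a b) (mk_chord N a b)).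
have ok : links_realizable R r (inner_chords N a b) set0.
  by rewrite bE; apply: inner_chords_realizable; rewrite -bE.
rewrite cE wE; split.
  exact: (links_realizable_join dis cross (sub0set _) (subxx _) ok l1).
rewrite (flag_sum_join dis cross (sub0set _) (subxx _) ok l1) s1 mulrN1.
have -> : (b - a)%N = n.+2 by lia.
by rewrite bE inner_chords_sum// -bE.
Qed.

(** Chords in different gaps share at most an end, so the complex is the join of the complexes of
    the gaps. *)
Lemma cells_sum a b s P : path ltn a (rcons s b) -> (b <= N)%N ->
    (forall p, (a <= p <= b)%N -> P p = (p \in a :: rcons s b)) ->
  links_realizable R r (cells P a b) (walls P a b) /\
  flag_sum R r (cells P a b) (walls P a b) =
    gap_weight (beta_series R) (beta_series R) b a s.
Proof.
elim: s a => [|v s IH] a /= sab bN PE.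
  rewrite andbT in sab.
  have Pa : P a by rewrite PE ?inE ?eqxx//; lia.
  have Pb : P b by rewrite PE ?inE ?eqxx ?orbT//; lia.
  by apply: cells_window => // p abp; rewrite PE ?inE; lia.
case/andP: sab => av svb.
have vall : all (ltn v) (rcons s b) by apply: order_path_min svb; exact: ltn_trans.
have vb : (v < b)%N by move/allP: vall => /(_ b); rewrite mem_rcons mem_head; exact.
have Pa : P a by rewrite PE ?inE ?eqxx//; lia.
have Pv : P v by rewrite PE ?inE ?eqxx ?orbT//; lia.
have PE' p : (v <= p <= b)%N -> P p = (p \in v :: rcons s b).
  move=> vpb; rewrite PE; last by lia.
  by rewrite in_cons (_ : (p == a) = false) //; lia.
have nP p : (a < p < v)%N -> ~~ P p.
  move=> apv; rewrite PE; last by lia.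
  rewrite !inE; apply/negP => /or3P[/eqP pa|/eqP pv|/(allP vall) /= vp].
  - by move: apv; rewrite pa ltnn.
  - by move: apv; rewrite pv ltnn andbF.
  - by move: apv; rewrite [(p < v)%N]ltnNge (ltnW vp) andbF.
have [l1 s1] := @cells_window a v P av (leq_trans (ltnW vb) bN) Pa Pv nP.
have [l2 s2] := IH v svb bN PE'.
have cE : cells P a b = cells P a v :|: cells P v b.
  apply/setP => u; rewrite in_setU; apply/cellsP/orP => [[u1 u2 u3 uf]|].
    have uv : ~~ ((ends u).1 < v < (ends u).2)%N.
      by apply: contraL Pv => ?; exact: (freeP _ _ uf).
    have [?|?] := leqP (ends u).2 v; [left|right]; apply/cellsP; split=> //; move: uv; lia.
  by case=> /cellsP[u1 u2 u3 uf]; split=> //; lia.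
have wE : walls P a b = walls P a v :|: walls P v b.
  apply/setP => u; rewrite in_setU; apply/wallsP/orP.
    by rewrite cE in_setU => -[/orP[]uc uP]; [left|right]; apply/wallsP.
  by rewrite cE in_setU => -[]/wallsP[-> ->]; rewrite ?orbT.
have dis : [disjoint cells P a v & cells P v b].
  apply/pred0P => u /=; apply/negP => /andP[/cellsP[? ? ? _] /cellsP[? ? ? _]]; lia.
have cross x y : x \in cells P a v -> y \in cells P v b -> r x y && r y x.
  move=> /cellsP[? ? ? _] /cellsP[? ? ? _].
  rewrite /r /chord_compat /noncrossing /crossing; lia.
rewrite cE wE; split.
  exact: (links_realizable_join dis cross (walls_cells _ _ _) (walls_cells _ _ _) l1 l2).
by rewrite (flag_sum_join dis cross (walls_cells _ _ _) (walls_cells _ _ _) l1 l2) s1 s2.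
Qed.

End Cells.

Lemma increasing_seqsP b k a s : (a < b)%N ->
  (s \in increasing_seqs b k a) = (size s == k) && path ltn a (rcons s b).
Proof.
elim: k a s => [|k IH] a s ab; first by case: s => [|v s]; rewrite inE//= andbT ab.
apply/allpairsPdep/andP => [[v [s' [vi s'i ->]]]|[]].
  move: vi; rewrite mem_iota => vi; have vb : (v < b)%N by lia.
  have av : (a < v)%N by lia.
  by move: s'i; rewrite IH// => /andP[/eqP /= -> ->]; rewrite av.
case: s => // v s /= /eqP[sk] /andP[av vs].
have vb : (v < b)%N.
  have /allP/(_ b) := order_path_min ltn_trans vs.
  by rewrite mem_rcons mem_head; exact.
exists v, s; split=> //; first by rewrite mem_iota; lia.
by rewrite IH// sk eqxx.
Qed.

Lemma increasing_seqs_uniq b k a : uniq (increasing_seqs b k a).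
Proof.
elim: k a => [//|k IH] a /=; apply: allpairs_uniq_dep => //; first exact: iota_uniq.
by move=> [v s] [v' s'] /= _ _ [-> ->].
Qed.

Lemma noncrossing_mono (pt : nat -> nat) K x y :
    (forall i j, (i < j <= K)%N -> (pt i < pt j)%N) ->
    (x.1 <= K)%N -> (x.2 <= K)%N -> (y.1 <= K)%N -> (y.2 <= K)%N ->
  noncrossing (pt x.1, pt x.2) (pt y.1, pt y.2) = noncrossing x y.
Proof.
move=> pt_mono x1 x2 y1 y2.
have ptE i j : (i <= K)%N -> (j <= K)%N -> (pt i < pt j)%N = (i < j)%N.
  move=> iK jK; have := pt_mono i j; have := pt_mono j i.
  by case: (ltngtP i j) => [ij|ij|->] /=; lia.
by rewrite /noncrossing /crossing /= !ptE.
Qed.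

Section PathFibration.
Variables (R : realType) (N : nat).
Let C := chord N.
Let r := @chord_compat N.
Implicit Types (u v : C) (P : pred nat) (T : {set C}).

Definition long_chords P a b : {set C} :=
  [set u in inner_chords N a b |
    [&& P (ends u).1, P (ends u).2 & ~~ free P (ends u)]].

(** Numbering the [k.+3] points in increasing order preserves crossings and turns these chords into
    the inner chords of [[0, k.+2]]. *)
Lemma long_chords_class k m s : path ltn 0%N (rcons s m) -> size s = k.+1 -> (m <= N)%N ->
  realizable R r (long_chords (mem (0 :: rcons s m)) 0 m) /\
  flag_class R r (long_chords (mem (0 :: rcons s m)) 0 m) = class_of (associahedron R k).
Proof.
move=> sm sk mN; set l := (0 :: rcons s m)%N.
have size_l : size l = k.+3 by rewrite /= size_rcons sk.
pose pt := nth 0%N l.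
have pt_mono i j : (i < j <= k.+2)%N -> (pt i < pt j)%N.
  have mono := @sorted_ltn_nth _ ltn ltn_trans 0%N l sm.
  by move=> ij; apply: mono; rewrite ?inE ?size_l; lia.
have ptE i j : (i <= k.+2)%N -> (j <= k.+2)%N -> (pt i < pt j)%N = (i < j)%N.
  move=> iK jK; have := pt_mono i j; have := pt_mono j i.
  by case: (ltngtP i j) => [ij|ij|->] /=; lia.
have pt0 : pt 0%N = 0%N by [].
have ptk : pt k.+2 = m by rewrite /pt /= -[RHS](last_rcons 0 s m) (last_nth 0) size_rcons sk.
have ptP p : reflect (exists2 i, (i <= k.+2)%N & p = pt i) (p \in l).
  apply: (iffP (nthP 0%N)) => -[i]; rewrite size_l => il pE; exists i => //.
have ptm i : (i <= k.+2)%N -> (pt i <= m)%N.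
  move=> ik; have [->|ne] := eqVneq i k.+2; first by rewrite ptk.
  by rewrite -ptk ltnW// pt_mono; lia.
have ki : (k.+2 <= m)%N.
  have H i : (i <= k.+2)%N -> (i <= pt i)%N.
    elim: i => // i IH ik; have := IH (ltnW ik); have := pt_mono i i.+1; lia.
  by rewrite -[leqRHS]ptk H.
pose f (u : C) : C := mk_chord N (pt (ends u).1) (pt (ends u).2).
pose A := inner_chords N 0 k.+2.
have AP u : u \in A -> [/\ ((ends u).1.+2 <= (ends u).2)%N, ((ends u).2 <= k.+2)%N,
    ends u != (0%N, k.+2) & ends (f u) = (pt (ends u).1, pt (ends u).2)].
  move=> /inner_chordsP[u1 u2 u3 u4]; split=> //.
  rewrite mk_chordK//; apply: leq_trans (ptm _ _) mN; move: u2 u3; lia.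
have finj : {in A &, injective f}.
  move=> u v /AP[u1 u2 _ uE] /AP[v1 v2 _ vE] fuv; apply: ends_inj.
  have := congr1 (@ends N) fuv; rewrite uE vE.
  case: (ends u) (ends v) u1 u2 v1 v2 => [a b] [c d] /= u1 u2 v1 v2 [E1 E2].
  have := ptE a c; have := ptE c a; have := ptE b d; have := ptE d b.
  by rewrite E1 E2 => *; congr pair; lia.
have fr : {in A &, forall u v, r (f u) (f v) = r u v}.
  move=> u v /AP[u1 u2 _ uE] /AP[v1 v2 _ vE]; rewrite /r /chord_compat uE vE.
  by apply: (noncrossing_mono pt_mono); lia.
have imA : f @: A = long_chords (mem l) 0 m.
  apply/setP => u; apply/imsetP/setIdP => [[v vA ->]|[uA /and3P[]]].
    have [v1 v2 v3 vE] := AP _ vA; rewrite vE.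
    move: v1 v2 v3 vE; case: (ends v) => c d /= v1 v2 v3 vE.
    have pcd : (pt c < pt c.+1 < pt d)%N by rewrite !ptE; lia.
    have lc : pt c \in l by apply/ptP; exists c => //; lia.
    have ld : pt d \in l by apply/ptP; exists d.
    have lc1 : pt c.+1 \in l by apply/ptP; exists c.+1 => //; lia.
    split; last first.
      apply/and3P; split; [exact: lc|exact: ld|].
      by apply/negP => /freeP/(_ _ pcd)/negP; apply; exact: lc1.
    apply/inner_chordsP; rewrite vE /=.
    split=> //; [by move: pcd; lia|exact: ptm|].
    apply: contraNneq v3 => -[E1 E2]; apply/eqP.
    have := ptE 0%N c; have := ptE d k.+2; rewrite E1 E2 pt0 ptk => *.
    by congr pair; lia.
  move=> /ptP[i ik E1] /ptP[j jk E2] nf.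
  have [p [up /ptP[h hk pE]]] : exists p, ((ends u).1 < p < (ends u).2)%N /\ p \in l.
    apply: contrapT => H; case/negP: nf; apply/freeP => p up; apply/negP => pl.
    by apply: H; exists p.
  have ihj : (i < h < j)%N by rewrite -(ptE i h)// -(ptE h j)// -pE -E1 -E2.
  have mcK : ends (mk_chord N i j) = (i, j) by apply: mk_chordK; lia.
  exists (mk_chord N i j).
    apply/inner_chordsP; rewrite mcK /=; split=> //; try lia.
    move: uA; rewrite inE => /andP[_]; apply: contraNneq => -[iE jE].
    by apply/eqP; rewrite [ends u]surjective_pairing E1 E2 iE jE pt0 ptk.
  apply: ends_inj; rewrite /f mcK /= -E1 -E2 mk_chordK -?surjective_pairing//.
    by case/andP: (ends_le u).
  by case/andP: (ends_le u).
have kN : (0 + k.+2 <= N)%N by lia.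
have okA : realizable R r A.
  exact: links_realizable_class (inner_chords_realizable R kN).
rewrite -imA; split; first exact: realizable_imset okA.
by rewrite (flag_class_imset finj fr okA) (inner_chords_class R kN).
Qed.

End PathFibration.

Lemma path_ltn_le a b s p :
  path ltn a (rcons s b) -> p \in a :: rcons s b -> (a <= p <= b)%N.
Proof.
elim: s a p => [|v s IH] a p /=.
  by rewrite !inE => /andP[ab _] /orP[]/eqP->; lia.
case/andP=> av /IH{}IH; rewrite inE => /predU1P[->|/IH]; last by lia.
by have := IH v; rewrite mem_head => /(_ isT); lia.
Qed.

Lemma path_ltn_size a s : path ltn a s -> (a + size s <= last a s)%N.
Proof.
elim: s a => [|v s IH] a /=; first by rewrite addn0.
by case/andP=> av /IH; lia.
Qed.

Section Uncovered.
Variable N : nat.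
Implicit Types (u v : chord N) (P : pred nat) (T : {set chord N}).

Definition uncovered T : pred nat :=
  fun p => [forall u in T, ~~ ((ends u).1 < p < (ends u).2)%N].

Lemma uncoveredP T p : reflect
  (forall u, u \in T -> ~~ ((ends u).1 < p < (ends u).2)%N) (uncovered T p).
Proof. exact: forall_inP. Qed.

Lemma long_noncrossing P a b u v : u \in long_chords N P a b -> v \in cells N P a b ->
  chord_compat u v && chord_compat v u.
Proof.
move=> /setIdP[_ /and3P[P1 P2 _]] /cellsP[_ _ _ fv].
have nv p : P p -> ~~ ((ends v).1 < p < (ends v).2)%N.
  by move=> Pp; apply: contraL Pp => ?; exact: (freeP _ _ fv).
have := nv _ P1; have := nv _ P2.
rewrite /chord_compat (noncrossing_sym (ends v)) andbb /noncrossing /crossing.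
by lia.
Qed.

(** A point outside [P] is strictly inside the wall of its gap, and no chord of a gap passes over a
    point of [P]. So [T] determines [P], which makes the fibres disjoint. *)
Lemma uncovered_cells P a b T : (b <= N)%N -> P a -> P b ->
    walls N P a b \subset T -> T \subset cells N P a b ->
  forall p, (a <= p <= b)%N -> uncovered T p = P p.
Proof.
move=> bN Pa Pb /subsetP wT /subsetP TE p apb.
apply/uncoveredP/idP => [unc|Pp u /TE/cellsP[_ _ _ uf]]; last first.
  by apply: contraL Pp => ?; exact: (freeP _ _ uf).
apply: contrapT => /negP nPp.
have ap : (a < p)%N by have : (a != p)%N by [apply: contraNneq nPp => <-]; lia.
have pb : (p < b)%N by have : (b != p)%N by [apply: contraNneq nPp => <-]; lia.
have [p0 [P0 l0 u0]] := prev_point Pa ap.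
have [p1 [P1 l1 u1]] := next_point Pb pb.
have mcK : ends (mk_chord N p0 p1) = (p0, p1) by apply: mk_chordK; lia.
have /unc : mk_chord N p0 p1 \in T.
  apply: wT; apply/wallsP; rewrite mcK P0 P1; split=> //.
  apply/cellsP; rewrite mcK /=; split; try lia.
  apply/freeP => q /= q01; have [->//|ne'] := eqVneq q p.
  by have [?|?] := ltnP q p; [apply: u0|apply: u1]; lia.
by rewrite mcK /=; lia.
Qed.

(** Every clique belongs to the fibre of its own uncovered set: between consecutive uncovered points
    everything is covered, and [covered_interval] yields the wall. *)
Lemma walls_uncovered a b T : (b <= N)%N -> T \subset chords N a b ->
    {in T &, forall u v, chord_compat u v} ->
  walls N (uncovered T) a b \subset T /\ T \subset cells N (uncovered T) a b.
Proof.
move=> bN /subsetP TA cT; split; last first.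
  apply/subsetP => u uT; apply/setIdP; split; first exact: TA.
  by apply/freeP => p up; apply/negP => /uncoveredP/(_ _ uT); rewrite up.
apply/subsetP => w /wallsP[/cellsP[w1 w2 w3 wf] /andP[/uncoveredP U1 /uncoveredP U2]].
pose S : pred (nat * nat) := fun x => [exists u in T, ends u == x].
have SP x : reflect (exists2 u, u \in T & ends u = x) (S x).
  by apply: (iffP exists_inP) => -[u uT /eqP ux]; exists u => //; exact/eqP.
have : S ((ends w).1, (ends w).2).
  apply: covered_interval => //.
  - by move=> x y /SP[u uT <-] /SP[v vT <-]; exact: cT.
  - by move=> x /SP[u uT <-]; exact: U1.
  - by move=> x /SP[u uT <-]; exact: U2.
  - move=> p pw; apply: contrapT => np; have /negP := freeP _ _ wf p pw; apply.
    apply/uncoveredP => u uT; apply/negP => up; apply: np.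
    by exists (ends u) => //; apply/SP; exists u.
by case/SP => u uT; rewrite -surjective_pairing => /(@ends_inj N) <-.
Qed.

End Uncovered.

(** * The motivic interior of the associahedron as a sum over uncovered sets *)

Section PathIdentity.
Variables (R : realType) (n : nat).
Let m := n.+2.
Let r := @chord_compat m.
Let A := inner_chords m 0 m.
Let pts (s : seq nat) : pred nat := mem (0%N :: rcons s m).

(** At least one interior point is required: a set of noncrossing chords covering all of them would
    contain the chord from 0 to [m], which is not inner. *)
Definition path_seqs : seq (seq nat) :=
  [seq s | k <- iota 0 n.+1, s <- increasing_seqs m k.+1 0].

Lemma path_seqsP s :
  reflect (s != [::] /\ path ltn 0%N (rcons s m)) (s \in path_seqs).
Proof.
apply: (iffP allpairsPdep) => [[k [s' [ki]]]|[s0 sm]].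
  by rewrite increasing_seqsP// => /andP[/eqP sk sm] ->; case: s' sk sm.
have sm_le : (size s < m)%N.
  by have := path_ltn_size sm; rewrite size_rcons last_rcons.
exists (size s).-1, s; case: s s0 sm sm_le => [//|v s _ sm sm_le].
by split=> //; [rewrite mem_iota /=; move: sm_le => /=; lia|rewrite increasing_seqsP// eqxx].
Qed.

Lemma path_seqs_uniq : uniq path_seqs.
Proof.
apply: allpairs_uniq_dep; first exact: iota_uniq.
  by move=> k _; exact: increasing_seqs_uniq.
move=> [k s] [k' s'] /allpairsPdep[k1 [s1 [_ + [-> ->]]]] /allpairsPdep[k2 [s2 [_ + [-> ->]]]] /=.
rewrite !increasing_seqsP// => /andP[/eqP e1 _] /andP[/eqP e2 _] E.
by move: e1 e2; rewrite E => -> [->].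
Qed.

Lemma path_motivic_interior :
  to_rat (motivic_interior (associahedron R n)) =
  \sum_(s <- path_seqs) mkmalgU (class_of (associahedron R (size s).-1)) 1 *
    gap_weight (beta_series R) (beta_series R) m 0 s.
Proof.
rewrite -(@inner_chords_sum R m 0 n (leqnn _)).
rewrite -/m -/r -/A.
have sub s : s \in path_seqs -> [/\ pts s 0%N, pts s m & path ltn 0%N (rcons s m)].
  move=> /path_seqsP[_ sm]; split=> //; rewrite /pts /= inE ?eqxx//.
  by rewrite mem_rcons mem_head orbT.
have EA s : s \in path_seqs -> cells m (pts s) 0 m \subset A.
  move=> /path_seqsP[s0 sm]; apply/subsetP => u /cellsP[u1 u2 u3 uf].
  apply/inner_chordsP; split=> //; apply: contraTneq uf => ->.
  case: s s0 sm => // v s _ /= /andP[v0 vs].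
  apply/negP => /freeP/(_ v) /=; rewrite v0 /= /pts /= !inE eqxx orbT.
  have /allP/(_ m) := order_path_min ltn_trans vs.
  by rewrite mem_rcons mem_head => /(_ isT) /= -> /(_ isT).
have HA s : long_chords m (pts s) 0 m \subset A.
  by apply/subsetP => u /setIdP[].
have dHE s : [disjoint long_chords m (pts s) 0 m & cells m (pts s) 0 m].
  apply/pred0P => u /=; apply/negP => /andP[/setIdP[_ /and3P[_ _ nf]] /cellsP[_ _ _ uf]].
  by rewrite uf in nf.
have BH s u : s \in path_seqs -> u \in A -> u \notin cells m (pts s) 0 m ->
    {in walls m (pts s) 0 m, forall v, r u v} -> u \in long_chords m (pts s) 0 m.
  move=> /sub[P0 Pm sm] uA uE uB; have /inner_chordsP[u1 u2 u3 u4] := uA.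
  have nf : ~~ free (pts s) (ends u) by apply: contraNN uE => uf; exact/cellsP.
  apply/setIdP; split=> //; rewrite nf andbT.
  apply: (noncrossing_walls P0 Pm u1 u3) => // p q Pp Pq _ qm pq pqf.
  have mcK : ends (mk_chord m p q) = (p, q).
    by apply: mk_chordK => //; clear -qm pq; lia.
  rewrite -mcK; apply: uB; apply/wallsP; rewrite mcK Pp Pq; split=> //.
  by apply/cellsP; rewrite mcK.
have ok s : s \in path_seqs -> realizable R r (long_chords m (pts s) 0 m) /\
    flag_class R r (long_chords m (pts s) 0 m) = class_of (associahedron R (size s).-1).
  move=> /path_seqsP[s0 sm]; apply: long_chords_class => //.
  by case: (s) s0.
have okE s : s \in path_seqs ->
    links_realizable R r (cells m (pts s) 0 m) (walls m (pts s) 0 m) /\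
    flag_sum R r (cells m (pts s) 0 m) (walls m (pts s) 0 m) =
    gap_weight (beta_series R) (beta_series R) m 0 s.
  by move=> /sub[_ _ sm]; apply: cells_sum.
rewrite (@flag_sum_fibration R _ r A _ path_seqs (fun s => cells m (pts s) 0 m)
  (fun s => walls m (pts s) 0 m) (fun s => long_chords m (pts s) 0 m)).
- apply: eq_big_seq => s sJ.
  by rewrite (okE s sJ).2 (ok s sJ).2.
- exact: path_seqs_uniq.
- by move=> s sJ; split=> //; exact: EA.
- by move=> s x y _; exact: long_noncrossing.
- by move=> s x; exact: BH.
- by move=> s sJ; split; [exact: (ok s sJ).1|exact: (okE s sJ).1].
move=> T cT; have [TA Tc] := cliquesP cT.
have TC : T \subset chords m 0 m.
  by apply: subset_trans TA _; apply/subsetP => u /setIdP[].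
have Tle u : u \in T -> ((ends u).2 <= m)%N by move=> /(subsetP TC); rewrite inE => /and3P[].
have U0 : uncovered T 0 by apply/uncoveredP.
have Um : uncovered T m by apply/uncoveredP => u /Tle; lia.
pose s0 := [seq p <- iota 1 n.+1 | uncovered T p].
have s0P p : (p <= m)%N -> pts s0 p = uncovered T p.
  move=> pm; rewrite /pts /= inE mem_rcons inE mem_filter mem_iota.
  have [->|p0] := eqVneq p 0%N; first by rewrite U0.
  have [->|pm'] := eqVneq p m; first by rewrite Um.
  by rewrite /= andbC (_ : (0 < p < 1 + n.+1)%N)//; rewrite /m in pm pm'; lia.
have s0path : path ltn 0%N (rcons s0 m).
  have := sorted_filter ltn_trans (uncovered T) (iota_ltn_sorted 0 m.+1).
  rewrite -[m.+1]addn1 iotaD filter_cat /= add0n Um U0 cats1.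
  by [].
have [wT TE] := walls_uncovered (leqnn m) TC Tc.
have pts_cells s : (forall p, (p <= m)%N -> pts s p = uncovered T p) ->
    cells m (pts s) 0 m = cells m (uncovered T) 0 m /\
    walls m (pts s) 0 m = walls m (uncovered T) 0 m.
  move=> sP; have fE u : ((ends u).2 <= m)%N -> free (pts s) (ends u) = free (uncovered T) (ends u).
    by move=> um; apply: eq_in_all => p; rewrite mem_iota => pu; rewrite /= sP//; lia.
  have cE : cells m (pts s) 0 m = cells m (uncovered T) 0 m.
    by apply/setP => u; apply/cellsP/cellsP => -[u1 u2 u3]; rewrite fE//.
  split=> //; apply/setP => u; apply/wallsP/wallsP; rewrite cE => -[uc];
    have /cellsP[u1 u2 u3 _] := uc; by rewrite !sP//; clear -u2 u3; lia.
have s0ne : s0 != [::].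
  apply/eqP => s00; have : mk_chord m 0 m \in T.
    have mcK : ends (mk_chord m 0 m) = (0%N, m) by apply: mk_chordK.
    apply: (subsetP wT); apply/wallsP; rewrite mcK U0 Um; split=> //.
    apply/cellsP; rewrite mcK; split=> //=; apply/freeP => p /= pm.
    by rewrite -s0P ?(ltnW (andP pm).2)// /pts s00 /= !inE; lia.
  by move=> /(subsetP TA)/inner_chordsP[_ _ _]; rewrite mk_chordK// eqxx.
exists s0 => [|s sJ]; first exact/path_seqsP.
have [P0 Pm spath] := sub s sJ.
apply/cliques_overP/eqP => [[/cliquesP[TEs _] wTs]|->].
  have sU p : (p <= m)%N -> pts s p = uncovered T p.
    by move=> pm; rewrite (uncovered_cells (leqnn m) P0 Pm wTs TEs).
  suff : 0%N :: rcons s m = 0%N :: rcons s0 m by case=> /rcons_inj[].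
  apply: (@irr_sorted_eq _ ltn ltn_trans ltnn (0%N :: rcons s m) (0%N :: rcons s0 m)
    spath s0path) => p.
  have [pm|pm] := leqP p m; first by have := sU p pm; rewrite -(s0P p pm).
  by apply/idP/idP; [move=> /(path_ltn_le spath)|move=> /(path_ltn_le s0path)]; rewrite [(p <= m)%N]leqNgt pm.
have [-> ->] := pts_cells s0 s0P; split=> //; apply/cliquesP; split=> //.
Qed.
End PathIdentity.

(** * Cyclohedra and cyclic chords *)

Section CycleTubes.
Variable n : nat.
Local Notation p := n.+1.
Let e := @cycle_graph p.
Implicit Types (S : {set 'I_n.+1}) (x y : nat * nat).

Lemma cycle_graphE (i j : 'I_n.+1) : e i j =
  [&& i != j :> nat & [|| i.+1 == j :> nat, j.+1 == i :> nat,
    (i == 0 :> nat) && (j == n :> nat) | (j == 0 :> nat) && (i == n :> nat)]]%N.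
Proof.
have modE (k : 'I_n.+1) : (k.+1 %% p = if k == n :> nat then 0 else k.+1)%N.
  case: eqP => [->|kn]; first by rewrite modnn.
  by rewrite modn_small//; have := ltn_ord k; lia.
rewrite /e /cycle_graph !modE -val_eqE /=; have := ltn_ord i; have := ltn_ord j.
by case: (eqVneq (i : nat) n) => Hi; case: (eqVneq (j : nat) n) => Hj /=;
  rewrite /= ?Hi ?Hj; lia.
Qed.

Lemma cycle_graph_sym : symmetric e.
Proof. by move=> i j; rewrite /e /cycle_graph eq_sym orbC. Qed.

(* A point [k] of the line stands for the vertex [k] mod [p]. *)
Definition cycle_arc x : {set 'I_n.+1} :=
  [set i : 'I_n.+1 | [|| x.1 < i < x.2, x.1 < i + p < x.2 | x.1 < i + p + p < x.2]%N].

Definition shift x : nat * nat := (x.1 + p, x.2 + p)%N.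

Definition is_arc x := [&& x.1 < p + p, x.1.+2 <= x.2 & x.2 <= x.1 + p]%N.

Lemma cycle_arc_shift x : (x.1 < p)%N -> is_arc x -> cycle_arc (shift x) = cycle_arc x.
Proof.
rewrite /is_arc /shift => xp ax; apply/setP => i; rewrite !inE /=.
by have := ltn_ord i; lia.
Qed.

Lemma vertexP k : (k < p + p + p)%N ->
  exists i : 'I_n.+1, [\/ k = i, k = (i + p)%N | k = (i + p + p)%N].
Proof.
move=> kp; have [k1|k1] := ltnP k n.+1; first by exists (Ordinal k1); constructor 1.
have [k2|k2] := ltnP k (n.+1 + n.+1).
  have k3 : (k - n.+1 < n.+1)%N by lia.
  by exists (Ordinal k3); constructor 2 => /=; lia.
have k3 : (k - n.+1 - n.+1 < n.+1)%N by lia.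
by exists (Ordinal k3); constructor 3 => /=; lia.
Qed.

Lemma mem_arc x (i : 'I_n.+1) (k : nat) : [\/ k = i, k = (i + p)%N | k = (i + p + p)%N] ->
  (x.1 < k < x.2)%N -> i \in cycle_arc x.
Proof. by rewrite inE => -[] -> ->; rewrite ?orbT. Qed.

Lemma lift_edge (i j : 'I_n.+1) (k : nat) : (0 < n)%N ->
  [\/ k = i, k = (i + p)%N | k = (i + p + p)%N] ->
  [\/ k.+1 = j, k.+1 = (j + p)%N | k.+1 = (j + p + p)%N] -> e i j.
Proof.
rewrite cycle_graphE; have := ltn_ord i; have := ltn_ord j.
by move=> jp ip n0 [] ik [] jk; lia.
Qed.

Lemma lift_neighbor (i j : 'I_n.+1) (k : nat) : e i j ->
  [\/ k = i, k = (i + p)%N | k = (i + p + p)%N] -> (0 < k < p + p)%N ->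
  exists h : nat, [\/ h = j, h = (j + p)%N | h = (j + p + p)%N] /\ (h = k.+1 \/ k = h.+1).
Proof.
rewrite cycle_graphE => ij ik k0.
have jp := ltn_ord j; have ip := ltn_ord i.
case/andP: ij => _ /or4P[/eqP ij|/eqP ij|/andP[/eqP i0 /eqP jn]|/andP[/eqP j0 /eqP iN]].
- exists k.+1; split; last by left.
  by case: ik => ->; [constructor 1|constructor 2|constructor 3]; lia.
- exists k.-1; split; last by right; lia.
  by case: ik => ->; [constructor 1|constructor 2|constructor 3]; lia.
- exists k.-1; split; last by right; lia.
  by case: ik => kE; [exfalso|constructor 1|constructor 2]; lia.
- exists k.+1; split; last by left.
  by case: ik => kE; [constructor 2|constructor 3|exfalso]; lia.
Qed.

Lemma arc_mem x (i : 'I_n.+1) : i \in cycle_arc x -> exists k : nat,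
  [\/ k = i, k = (i + p)%N | k = (i + p + p)%N] /\ (x.1 < k < x.2)%N.
Proof.
rewrite inE => /or3P[] H; eexists; (split; last exact: H);
  by [constructor 1|constructor 2|constructor 3].
Qed.

Lemma cycle_arc_sub x y : (y.1 <= x.1)%N -> (x.2 <= y.2)%N -> cycle_arc x \subset cycle_arc y.
Proof.
move=> xy1 xy2; apply/subsetP => i /arc_mem[k [ik xk]].
by apply: mem_arc ik _; lia.
Qed.

Lemma cycle_arc_connected x : is_arc x -> induced_connected e (cycle_arc x).
Proof.
case: x => c d /and3P[/= cp cd dp].
have -> : d = (c.+2 + (d - c.+2))%N by lia.
have : (c.+2 + (d - c.+2) <= c + p)%N by lia.
elim: (d - c.+2)%N => [|k IH] kp.
  have [|i ci] := @vertexP c.+1; first by lia.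
  rewrite (_ : cycle_arc _ = [set i]); first exact: induced_connected1.
  apply/setP => j; rewrite !inE -val_eqE /=.
  by have := ltn_ord i; have := ltn_ord j; case: ci => ci; lia.
have [|i ci] := @vertexP (c.+2 + k); first by lia.
have [|j cj] := @vertexP (c.+1 + k); first by lia.
rewrite (_ : cycle_arc _ = cycle_arc (c, c.+2 + k)%N :|: [set i]); last first.
  apply/setP => h; rewrite !inE -val_eqE /=.
  by have := ltn_ord i; have := ltn_ord h; case: ci => ci; lia.
apply: (induced_connectedU cycle_graph_sym (IH _) (induced_connected1 _ _)
  (u := j) (v := i)).
- by lia.
- by apply: mem_arc cj _ => /=; lia.
- by rewrite inE.
- by apply/orP; right; apply: (lift_edge _ cj) => //; lia.
Qed.

Lemma cycle_connected : induced_connected e [set: 'I_n.+1].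
Proof.
have [n0|n0] := posnP n.
  rewrite (_ : [set: _] = [set ord0]); first exact: induced_connected1.
  by apply/setP => i; rewrite !inE -val_eqE /=; have := ltn_ord i; lia.
have c0 : is_arc (0%N, p) by rewrite /is_arc /=; lia.
rewrite (_ : [set: _] = cycle_arc (0%N, p) :|: [set ord0]); last first.
  by apply/setP => i; rewrite !inE -val_eqE /=; have := ltn_ord i; lia.
have n1 : (1 < n.+1)%N by lia.
apply: (induced_connectedU cycle_graph_sym (cycle_arc_connected c0) (induced_connected1 _ _)
  (u := Ordinal n1) (v := ord0)).
- by rewrite inE /=; lia.
- by rewrite inE.
- by rewrite cycle_graphE /=; lia.
Qed.

Lemma cycle_connected_arc S : induced_connected e S -> S != [set: 'I_n.+1] ->
  exists x, [/\ (x.1 < p)%N, is_arc x & S = cycle_arc x].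
Proof.
move=> cS ST; have [/set0Pn[s sS] _] := induced_connectedP cS.
have p0 : (0 < p)%N by [].
pose m (k : nat) : bool := Ordinal (ltn_pmod k p0) \in S.
have mE (i : 'I_n.+1) k : k = i %[mod p] -> m k = (i \in S).
  by move=> ki; congr (_ \in S); apply/val_inj; rewrite /= ki modn_small.
(* [c] is outside [S] and its successor inside. Without such a [c], one vertex outside [S] would
   push the whole cycle outside. The other end [d] will be the next point outside [S]. *)
have [c [cp mc mc1]] : exists c, [/\ (c < p)%N, ~~ m c & m c.+1].
  apply: contrapT => H.
  have step c : ~~ m c -> ~~ m c.+1.
    move=> mc; apply/negP => mc1; apply: H; exists (c %% p)%N.
    rewrite ltn_pmod//; split=> //.
      by rewrite (mE (Ordinal (ltn_pmod c p0)))//= modn_mod.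
    rewrite (mE (Ordinal (ltn_pmod c.+1 p0)))//=.
    by rewrite modn_mod -addn1 modnDml addn1.
  have [i _ iS] : exists2 i, i \in [set: 'I_n.+1] & i \notin S.
    by apply/subsetPn; apply: contraNN ST => TS; rewrite eqEsubset subsetT.
  have all_n k : ~~ m (i + k)%N.
    elim: k => [|k IH]; first by rewrite addn0 (mE i).
    by rewrite addnS; exact: step.
  have := all_n (s + p - i)%N; rewrite subnKC ?(mE s) ?sS//; first by rewrite modnDr.
  by have := ltn_ord i; lia.
have exd : exists d, (c.+1 < d)%N && ~~ m d.
  exists (c + p)%N; apply/andP; split; last first.
    by rewrite (mE (Ordinal cp))/= ?modnDr// -(mE (Ordinal cp) c).
  have : c.+1 != (c + p)%N.
    apply: contraTneq mc1 => ->.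
    by rewrite (mE (Ordinal cp))/= ?modnDr// -(mE (Ordinal cp) c).
  lia.
case: (ex_minnP exd) => d /andP[cd md] dmin.
have dp : (d <= c + p)%N.
  apply: dmin; apply/andP; split; last first.
    by rewrite (mE (Ordinal cp))/= ?modnDr// -(mE (Ordinal cp) c).
  have : c.+1 != (c + p)%N.
    apply: contraTneq mc1 => ->.
    by rewrite (mE (Ordinal cp))/= ?modnDr// -(mE (Ordinal cp) c).
  lia.
have min k : (c < k < d)%N -> m k.
  move=> ck; have [->//|ck1] := eqVneq k c.+1.
  by apply: contraT => mk; have := dmin k; rewrite mk andbT; lia.
have ax : is_arc (c, d) by rewrite /is_arc /=; lia.
exists (c, d); split=> //.
have vE (i : 'I_n.+1) (k : nat) : [\/ k = i, k = (i + p)%N | k = (i + p + p)%N] -> m k = (i \in S).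
  by move=> ik; apply: mE; case: ik => ->; rewrite ?modnDr.
symmetry; apply: (induced_connected_closed cycle_graph_sym cS).
- apply/subsetP => i; rewrite inE => /or3P[] H.
  + by rewrite -(vE i i) ?min//; constructor 1.
  + by rewrite -(vE i (i + p)%N) ?min//; constructor 2.
  + by rewrite -(vE i (i + p + p)%N) ?min//; constructor 3.
- by have /induced_connectedP[] := cycle_arc_connected ax.
- move=> i j ic jS ij; apply: contraT => jc.
  have [k [ik ck]] : exists k : nat, [\/ k = i, k = (i + p)%N | k = (i + p + p)%N] /\ (c < k < d)%N.
    exact: arc_mem ic.
  have [h [jh hk]] : exists h : nat, [\/ h = j, h = (j + p)%N | h = (j + p + p)%N] /\
      (h = k.+1 \/ k = h.+1).
    by apply: lift_neighbor ij ik _; clear -ck dp cp; lia.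
  have hcd : (h == c) || (h == d).
    by apply: contraNT jc => hcd; apply: (mem_arc jh) => /=; clear -hcd ck hk; lia.
  case/orP: hcd => /eqP hE; last by move: md; rewrite -hE (vE _ _ jh) jS.
  by move: mc; rewrite -hE (vE _ _ jh) jS.
Qed.

Lemma crossing_incompat x y : is_arc x -> is_arc y -> crossing x y ->
  ~~ tube_compat e (cycle_arc x) (cycle_arc y).
Proof.
move=> ax ay; have := ax; have := ay; rewrite /is_arc /crossing.
move=> /and3P[y1 y2 y3] /and3P[x1 x2 x3] /and3P[c1 c2 c3].
have [|i ci] := @vertexP y.1; first by lia.
have [|j cj] := @vertexP x.2; first by lia.
have [|h ch] := @vertexP x.2.-1; first by lia.
have hi := ltn_ord i; have hj := ltn_ord j; have hh := ltn_ord h.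
have ix : i \in cycle_arc x by apply: mem_arc ci _; lia.
have iy : i \notin cycle_arc y by rewrite inE; case: ci => ?; lia.
have jx : j \notin cycle_arc x by rewrite inE; case: cj => ?; lia.
have jy : j \in cycle_arc y by apply: mem_arc cj _; lia.
have hx : h \in cycle_arc x by apply: mem_arc ch _; lia.
rewrite /tube_compat !negb_or; apply/and3P; split.
- by apply/subsetPn; exists i.
- by apply/subsetPn; exists j.
rewrite negbK; apply: (induced_connectedU cycle_graph_sym (cycle_arc_connected ax)
  (cycle_arc_connected ay) hx jy).
apply/orP; right; apply: (lift_edge _ ch); rewrite ?prednK//; clear -x1 x2 x3; lia.
Qed.

(** Arcs starting in [0, p) have length at most p, so up to a common translation only these three
    pairs of translates can cross. *)
Definition noncrossing_mod x y : bool :=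
  [&& noncrossing x y, noncrossing x (shift y) & noncrossing (shift x) y].

Lemma cycle_tube_compat x y : (x.1 < p)%N -> (y.1 < p)%N -> is_arc x -> is_arc y ->
  tube_compat e (cycle_arc x) (cycle_arc y) = noncrossing_mod x y.
Proof.
move=> xp yp ax ay; apply/idP/idP => [H|].
  have axs : is_arc (shift x) by move: ax xp; rewrite /is_arc /shift /=; lia.
  have ays : is_arc (shift y) by move: ay yp; rewrite /is_arc /shift /=; lia.
  have inc x' y' : is_arc x' -> is_arc y' ->
      cycle_arc x' = cycle_arc x -> cycle_arc y' = cycle_arc y -> noncrossing x' y'.
    move=> ax' ay' Ex Ey; rewrite /noncrossing; apply/andP; split.
      by apply: contraL H => /(crossing_incompat ax' ay'); rewrite Ex Ey.
    by apply: contraL H => /(crossing_incompat ay' ax'); rewrite Ex Ey tube_compat_sym.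
  by apply/and3P; split; apply: inc => //; exact: cycle_arc_shift.
move=> /and3P[]; rewrite /noncrossing /crossing /shift /= => nc1 nc2 nc3.
have [ax' ay'] := (ax, ay).
move: ax ay; rewrite /is_arc => /and3P[_ x1 x2] /and3P[_ y1 y2].
apply/or3P.
have [H|H1] := boolP ((y.1 <= x.1) && (x.2 <= y.2))%N.
  by case/andP: H => *; constructor 1; exact: cycle_arc_sub.
have [H|H2] := boolP ((y.1 <= x.1 + p) && (x.2 + p <= y.2))%N.
  case/andP: H => *; constructor 1; rewrite -(cycle_arc_shift xp ax').
  exact: cycle_arc_sub.
have [H|H3] := boolP ((x.1 <= y.1) && (y.2 <= x.2))%N.
  by case/andP: H => *; constructor 2; exact: cycle_arc_sub.
have [H|H4] := boolP ((x.1 <= y.1 + p) && (y.2 + p <= x.2))%N.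
  case/andP: H => *; constructor 2; rewrite -(cycle_arc_shift yp ay').
  exact: cycle_arc_sub.
constructor 3; apply/negP => cU.
(* With all containments between translates excluded, noncrossing chords can only lie side by side,
   possibly with a common end. *)
have d1 : (x.2 <= y.1)%N || (y.2 <= x.1)%N by lia.
have d2 : (x.2 <= y.1 + p)%N by lia.
have d3 : (y.2 <= x.1 + p)%N by lia.
have sep i j : i \in cycle_arc x -> j \in cycle_arc y -> (i != j) && ~~ e i j.
  move=> ix jy; apply: contraT; rewrite negb_and !negbK => adj.
  have [k [ik xk]] := arc_mem ix; have [h [jh yh]] := arc_mem jy.
  have [g [jg xg]] : exists g : nat,
      [\/ g = j, g = (j + p)%N | g = (j + p + p)%N] /\ (x.1 <= g <= x.2)%N.
    case/orP: adj => [/eqP <-|ij].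
      by exists k; split=> //; clear -xk; lia.
    have [|g [jg gk]] := lift_neighbor ij ik; first by clear -xk x2 xp; lia.
    by exists g; split=> //; clear -gk xk; lia.
  clear -jh jg xg yh d1 d2 d3 xp yp x2 y2.
  by case: jh jg => hE [] gE; lia.
have ne y' : is_arc y' -> exists i, i \in cycle_arc y'.
  by move=> /cycle_arc_connected/induced_connectedP[/set0Pn].
have [j jy] := ne _ ay'.
suff /setP/(_ j) : cycle_arc x = cycle_arc x :|: cycle_arc y.
  by rewrite in_setU jy orbT => jx; have := sep _ _ jx jy; rewrite eqxx.
apply: (induced_connected_closed cycle_graph_sym cU); first exact: subsetUl.
  by have [i ix] := ne _ ax'; apply/set0Pn; exists i.
move=> u v ux; rewrite in_setU => /orP[//|vy] uv.
by have := sep _ _ ux vy; rewrite uv andbF.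
Qed.

End CycleTubes.

Section CyclicChords.
Variables (R : realType) (N : nat).
Let C := chord N.
Implicit Types (u v : C).

Definition cyclic_compat (n : nat) : rel C := fun u v => noncrossing_mod n (ends u) (ends v).

Definition cyclic_chords (n : nat) : {set C} :=
  [set u : C | ((ends u).1 < n.+1)%N && is_arc n (ends u)].

Lemma cyclic_chordsP n u : reflect
  [/\ ((ends u).1 < n.+1)%N, ((ends u).1.+2 <= (ends u).2)%N &
      ((ends u).2 <= (ends u).1 + n.+1)%N] (u \in cyclic_chords n).
Proof.
rewrite inE; apply: (iffP andP) => [[u1 /and3P[_ u2 u3]]|[u1 u2 u3]] //.
by split=> //; rewrite /is_arc u2 u3 !andbT; clear -u1; lia.
Qed.

Section Fixed.
Variable n : nat.
Local Notation p := n.+1.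
Hypothesis pN : (p + p <= N)%N.
Let f (u : C) := cycle_arc n (ends u).

Let mem_lift x (i : 'I_p) (k : nat) : (x.1 < p)%N -> is_arc n x ->
    [\/ k = i, k = (i + p)%N | k = (i + p + p)%N] -> (x.1 <= k <= x.2)%N ->
  (i \in cycle_arc n x) = (x.1 < k < x.2)%N.
Proof.
rewrite /is_arc => xp /and3P[_ x1 x2] ik xk; apply/idP/idP; last exact: mem_arc.
move=> /arc_mem[h [ih xh]]; clear -xp x1 x2 ik xk ih xh.
by case: ik ih => kE [] hE; lia.
Qed.

(** The left end is where one enters the arc and the right end where one leaves it, so both can be
    read off from the vertices modulo p. *)
Lemma cycle_arc_inj x y : (x.1 < p)%N -> (y.1 < p)%N -> is_arc n x -> is_arc n y ->
  cycle_arc n x = cycle_arc n y -> x = y.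
Proof.
move=> xp yp ax ay E.
have /and3P[_ x1 x2] := ax; have /and3P[_ y1 y2] := ay.
have [|i ci] := @vertexP n x.1.+1; first by clear -xp; lia.
have [|j cj] := @vertexP n x.2.-1; first by clear -xp x2; lia.
have [|i' ci'] := @vertexP n x.1; first by clear -xp; lia.
have [|j' cj'] := @vertexP n x.2; first by clear -xp x2; lia.
have xi : i \in cycle_arc n x by apply: mem_arc ci _; clear -x1; lia.
have xj : j \in cycle_arc n x by apply: mem_arc cj _; clear -x1; lia.
have xi' : i' \notin cycle_arc n x.
  by rewrite (mem_lift xp ax ci') ?ltnn//; clear -x1; lia.
have xj' : j' \notin cycle_arc n x.
  by rewrite (mem_lift xp ax cj') ?ltnn ?andbF//; clear -x1; lia.
rewrite E in xi xj xi' xj'.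
have [h [ih yh]] := arc_mem xi; have [g [jg yg]] := arc_mem xj.
have e1 : x.1 = y.1.
  have ih' : [\/ h.-1 = i', h.-1 = (i' + p)%N | h.-1 = (i' + p + p)%N].
    have ip := ltn_ord i; have ip' := ltn_ord i'.
    clear -ip ip' ci ci' ih xp yp yh y2.
    case: ih ci ci' => hE [] cE [] cE';
    by [constructor 1; lia|constructor 2; lia|constructor 3; lia|exfalso; lia].
  have nin : ~~ (y.1 < h.-1 < y.2)%N.
    by rewrite -(mem_lift yp ay ih')//; clear -yh; lia.
  have hy : h = y.1.+1 by clear -nin yh; lia.
  clear -hy ih ci xp yp; case: ih ci => hE [] cE; lia.
have jg' : [\/ g.+1 = j', g.+1 = (j' + p)%N | g.+1 = (j' + p + p)%N].
  have jp := ltn_ord j; have jp' := ltn_ord j'.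
  clear -jp jp' cj cj' jg xp yp yg y2 x1 x2.
  case: jg cj cj' => hE [] cE [] cE';
  by [constructor 1; lia|constructor 2; lia|constructor 3; lia|exfalso; lia].
have nin : ~~ (y.1 < g.+1 < y.2)%N.
  by rewrite -(mem_lift yp ay jg')//; clear -yg; lia.
have gy : g.+1 = y.2 by clear -nin yg; lia.
have e2 : x.2 = y.2.
  clear -gy jg cj xp yp x1 x2 y1 y2 e1; case: jg cj => hE [] cE; lia.
by rewrite [x]surjective_pairing e1 e2 -surjective_pairing.
Qed.

Lemma cyclic_arc_inj : {in cyclic_chords n &, injective f}.
Proof.
move=> u v; rewrite !inE => /andP[u1 u2] /andP[v1 v2] fuv.
by apply: ends_inj; exact: cycle_arc_inj fuv.
Qed.

Lemma cyclic_arc_compat : {in cyclic_chords n &, forall u v,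
  tube_compat (@cycle_graph p) (f u) (f v) = cyclic_compat n u v}.
Proof.
move=> u v; rewrite !inE => /andP[u1 u2] /andP[v1 v2]; exact: cycle_tube_compat.
Qed.

Lemma cyclic_arc_tubes : f @: cyclic_chords n = tubes (@cycle_graph p).
Proof.
apply/setP => S; apply/imsetP/tubesP => [[u + ->]|[ST cS]].
  rewrite inE => /andP[up ua]; split; last exact: cycle_arc_connected.
  apply/eqP => fT; have : Ordinal up \in f u by rewrite fT inE.
  have /and3P[_ u1 _] := ua.
  rewrite /f (@mem_lift _ _ (ends u).1 up ua) ?ltnn//; first by constructor 1.
  by clear -u1; lia.
have [x [xp ax SE]] := cycle_connected_arc cS ST.
have /and3P[_ x1 x2] := ax.
have mcK : ends (mk_chord N x.1 x.2) = x.
  by rewrite mk_chordK -?surjective_pairing//; clear -xp x2 pN; lia.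
exists (mk_chord N x.1 x.2); last by rewrite /f mcK.
by rewrite inE mcK xp.
Qed.

Let sym := @cycle_graph_sym n.
Let conn := cycle_connected n.

Lemma cyclic_chords_realizable :
  links_realizable R (cyclic_compat n) (cyclic_chords n) set0.
Proof.
apply: (links_realizable_preimset cyclic_arc_inj cyclic_arc_compat (sub0set _)
  (mk_chord N 0 0)).
rewrite cyclic_arc_tubes imset0; exact: graph_links_realizable.
Qed.

Lemma cyclic_chords_class :
  flag_class R (cyclic_compat n) (cyclic_chords n) = class_of (cyclohedron R n).
Proof.
rewrite /cyclohedron -(graph_flag_class R sym conn) -cyclic_arc_tubes.
have [|_ ->//] := flag_class_preimset (R := R) cyclic_arc_inj cyclic_arc_compat
  (mk_chord N 0 0).
rewrite cyclic_arc_tubes; apply: links_realizable_class.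
exact: graph_links_realizable.
Qed.

Lemma cyclic_chords_sum : flag_sum R (cyclic_compat n) (cyclic_chords n) set0 =
  to_rat (motivic_interior (cyclohedron R n)).
Proof.
rewrite /cyclohedron (graph_motivic_interior R sym conn) -cyclic_arc_tubes.
rewrite (flag_sum_preimset cyclic_arc_inj cyclic_arc_compat (sub0set _)
  (mk_chord N 0 0)) imset0//.
by rewrite cyclic_arc_tubes; exact: graph_links_realizable.
Qed.

End Fixed.
End CyclicChords.

(* Otherwise [/=] rewrites [(ends u).1], an atom for [lia], in some hypotheses only. *)
Opaque ends.

(** * Gaps of a periodic set of points *)

Section CyclicCells.
Variables (R : realType) (N n : nat).
Local Notation p := n.+1.
Hypothesis pN : (p + p <= N)%N.
Let C := chord N.
Implicit Types (u v : C) (P : pred nat) (x y : nat * nat).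

Definition cyclic_cells P : {set C} :=
  [set u in cyclic_chords N n | free P (ends u)].

Definition cyclic_walls P : {set C} :=
  [set u in cyclic_cells P | P (ends u).1 && P (ends u).2].

Definition cyclic_long P : {set C} :=
  [set u in cyclic_chords N n | [&& P (ends u).1, P (ends u).2 & ~~ free P (ends u)]].

Definition periodic P := forall q, P (q + p)%N = P q.

Lemma free_shift P x : periodic P -> free P (shift n x) = free P x.
Proof.
move=> perP; apply/freeP/freeP => xf q xq.
  by rewrite -perP; apply: xf; rewrite /shift /=; clear -xq; lia.
rewrite -(subnK (_ : p <= q)%N); last by move: xq; rewrite /shift /=; clear; lia.
by rewrite perP; apply: xf; move: xq; rewrite /shift /=; clear; lia.
Qed.

Definition reduce u : C :=
  if ((ends u).1 < p)%N then u else mk_chord N ((ends u).1 - p) ((ends u).2 - p).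

Lemma reduceE u : ((ends u).1 < (ends u).2)%N ->
  ends (reduce u) = ends u /\ ((ends u).1 < p)%N \/
  ends u = shift n (ends (reduce u)) /\ (p <= (ends u).1)%N.
Proof.
move=> u12; rewrite /reduce; case: ltnP => up; [by left|right; split=> //].
have /andP[u1N u2N] := ends_le u.
have K : ends (mk_chord N ((ends u).1 - p) ((ends u).2 - p)) = ((ends u).1 - p, (ends u).2 - p)%N.
  by apply: mk_chordK; [clear -u1N|clear -u2N]; lia.
by rewrite K /shift /= !subnK -?surjective_pairing// ltnW// (leq_ltn_trans up).
Qed.

Lemma noncrossing_shift x y : noncrossing (shift n x) (shift n y) = noncrossing x y.
Proof. by rewrite /noncrossing /crossing /shift /= !ltn_add2r. Qed.

Lemma noncrossing_apart x y : (x.2 <= y.1)%N -> noncrossing x y.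
Proof. by rewrite /noncrossing /crossing; clear; lia. Qed.

(** Inside a window of length p a chord and a translate of the other lie side by side. Reducing the
    chords changes only which of the three conditions is [noncrossing (ends u) (ends v)]; the other
    two hold. *)
Lemma reduce_compat u v a : (a < p)%N ->
    u \in chords N a (a + p) -> v \in chords N a (a + p) ->
  noncrossing_mod n (ends (reduce u)) (ends (reduce v)) = noncrossing (ends u) (ends v).
Proof.
rewrite !inE => ap /and3P[u1 u2 u3] /and3P[v1 v2 v3].
have u12 : ((ends u).1 < (ends u).2)%N by exact: ltnW.
have v12 : ((ends v).1 < (ends v).2)%N by exact: ltnW.
rewrite /noncrossing_mod.
case: (reduceE u12) => -[uE up]; case: (reduceE v12) => -[vE vp].
- rewrite uE vE (noncrossing_apart (y := shift n (ends v))); last first.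
    by rewrite /shift /=; clear -u3 v1; lia.
  rewrite [noncrossing (shift n _) _]noncrossing_sym.
  rewrite (noncrossing_apart (x := ends v) (y := shift n (ends u))) ?andbT//.
  by rewrite /shift /=; clear -u1 v3; lia.
- rewrite -vE uE; have -> : noncrossing (ends u) (ends (reduce v)).
    rewrite noncrossing_sym noncrossing_apart//.
    by have := congr1 snd vE; rewrite /shift /=; clear -v3 u1; lia.
  have -> : noncrossing (shift n (ends u)) (ends (reduce v)).
    rewrite noncrossing_sym noncrossing_apart//.
    by have := congr1 snd vE; rewrite /shift /=; clear -v3 u1; lia.
  by rewrite andbT.
- rewrite -uE vE; have -> : noncrossing (ends (reduce u)) (ends v).
    rewrite noncrossing_apart//.
    by have := congr1 snd uE; rewrite /shift /=; clear -u3 v1; lia.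
  have -> : noncrossing (ends (reduce u)) (shift n (ends v)).
    rewrite noncrossing_apart//.
    by have := congr1 snd uE; rewrite /shift /=; clear -u3 v1; lia.
  by [].
- rewrite -uE -vE -[in RHS]noncrossing_shift.
  rewrite -(noncrossing_shift (ends (reduce u)) (ends (reduce v))) -uE -vE.
  rewrite noncrossing_shift.
  have -> : noncrossing (ends (reduce u)) (ends v).
    rewrite noncrossing_apart//.
    by have := congr1 snd uE; rewrite /shift /=; clear -u3 v1; lia.
  have -> : noncrossing (ends u) (ends (reduce v)).
    rewrite noncrossing_sym noncrossing_apart//.
    by have := congr1 snd vE; rewrite /shift /=; clear -v3 u1; lia.
  by rewrite !andbT.
Qed.

(** The circle is cut at [a]: no chord of a gap passes over a point of [P], so each has a translate
    in [[a, a + p]]. *)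
Lemma reduce_cells P a : (a < p)%N -> periodic P -> P a ->
  [/\ {in cells N P a (a + p) &, injective reduce},
      reduce @: cells N P a (a + p) = cyclic_cells P &
      reduce @: walls N P a (a + p) = cyclic_walls P].
Proof.
move=> ap perP Pa.
have inj : {in cells N P a (a + p) &, injective reduce}.
  move=> u v /cellsP[u1 u2 u3 _] /cellsP[v1 v2 v3 _] uv; apply: ends_inj.
  have := @reduceE u (ltnW u2); have := @reduceE v (ltnW v2); rewrite uv.
  case=> -[vE vp] [] [uE up].
  - by rewrite -uE.
  - exfalso; have := congr1 snd uE; rewrite vE /shift /=.
    by clear -u3 v1 v2; lia.
  - exfalso; have := congr1 snd vE; rewrite uE /shift /=.
    by clear -v3 u1 u2; lia.
  - by rewrite uE vE.
have cE : reduce @: cells N P a (a + p) = cyclic_cells P.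
  apply/setP => w; apply/imsetP/setIdP => [[u /cellsP[u1 u2 u3 uf] ->]|[]].
    have [[uE up]|[uE up]] := @reduceE u (ltnW u2).
      rewrite uE uf; split=> //; apply/cyclic_chordsP; rewrite uE; split=> //.
      by clear -u1 u3; lia.
    rewrite -free_shift// -uE uf; split=> //.
    apply/cyclic_chordsP; have := congr1 fst uE; have := congr1 snd uE.
    by rewrite /shift /=; clear -up u1 u2 u3 ap; split; lia.
  move=> /cyclic_chordsP[w1 w2 w3] wf.
  have nP q : P q -> ~~ ((ends w).1 < q < (ends w).2)%N.
    by move=> Pq; apply: contraL Pq; exact: (freeP _ _ wf).
  have [vw|wv] := leqP a (ends w).1.
    exists w; last by rewrite /reduce w1.
    apply/cellsP; split=> //.
    by have := nP (a + p)%N; rewrite perP => /(_ Pa); clear -w1 vw; lia.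
  have w2v := nP _ Pa.
  have sK : ends (mk_chord N ((ends w).1 + p) ((ends w).2 + p)) = shift n (ends w).
    by rewrite mk_chordK//; clear -w1 w2 w3 pN w2v wv ap; lia.
  exists (mk_chord N ((ends w).1 + p) ((ends w).2 + p)).
    apply/cellsP; rewrite sK free_shift// wf /shift /=.
    by split=> //; clear -w1 w2 w3 w2v wv ap; lia.
  apply: ends_inj; rewrite /reduce sK /shift /= ltnNge leq_addl /= !addnK.
  by rewrite mk_chordK//; have /andP[] := ends_le w.
split=> //; apply/setP => w; apply/imsetP/setIdP => [[u /wallsP[uc uP] ->]|].
  split; first by rewrite -cE imset_f.
  have /cellsP[_ u2 _ _] := uc.
  have [[-> _]//|[uE up]] := @reduceE u (ltnW u2).
  by move: uP; rewrite uE /shift /= !perP.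
rewrite -cE => -[/imsetP[u uc ->] uP]; exists u => //; apply/wallsP; split=> //.
have /cellsP[_ u2 _ _] := uc.
have [[<- _]//|[uE up]] := @reduceE u (ltnW u2).
by move: uP; rewrite uE /shift /= !perP.
Qed.

Lemma cyclic_cells_sum P a s : (a < p)%N -> periodic P ->
    path ltn a (rcons s (a + p)%N) ->
    (forall q, (a <= q <= a + p)%N -> P q = (q \in a :: rcons s (a + p)%N)) ->
  links_realizable R (@cyclic_compat N n) (cyclic_cells P) (cyclic_walls P) /\
  flag_sum R (@cyclic_compat N n) (cyclic_cells P) (cyclic_walls P) =
    gap_weight (beta_series R) (beta_series R) (a + p) a s.
Proof.
move=> ap perP sp PE.
have Pa : P a by rewrite PE ?mem_head// leqnn leq_addr.
have [|ok <-] := @cells_sum R N a (a + p) s P sp _ PE.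
  by clear -ap pN; lia.
have [inj cE wE] := reduce_cells ap perP Pa.
have compat : {in cells N P a (a + p) &, forall u v,
    cyclic_compat n (reduce u) (reduce v) = chord_compat u v}.
  move=> u v /setIdP[uc _] /setIdP[vc _]; exact: (reduce_compat ap uc vc).
rewrite -cE -wE; split.
  exact: (links_realizable_imset inj compat (walls_cells N P _ _) ok).
exact: (flag_sum_imset inj compat (walls_cells N P _ _) ok).
Qed.

End CyclicCells.

Section PointSet.
Variables (n : nat) (a : nat) (s : seq nat).
Local Notation p := n.+1.
Hypothesis ap : (a + last 0%N s < p)%N.
Hypothesis sp : path ltn 0%N (rcons s p).
Let l := 0%N :: s.
Let K := (size s).+1.

(* The points [a + w + j * p] with [w] in [0 :: s] and [j >= 0]; [point i] below
   is the [i]-th one. *)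
Definition point_set : pred nat := fun q => ((q + (p - a)) %% p)%N \in 0%N :: s.

Let a_lt : (a < p)%N. Proof. exact: leq_ltn_trans (leq_addr _ _) ap. Qed.

Let l_last w : w \in l -> (w <= last 0%N s)%N.
Proof.
move: sp; rewrite rcons_path /l => /andP[+ _].
case/lastP: (s) => [|t z]; first by rewrite mem_seq1 => _ /eqP->.
by rewrite last_rcons => /path_ltn_le H /H/andP[].
Qed.

Let l_lt w : w \in l -> (a + w < p)%N.
Proof. by move=> /l_last wl; apply: leq_ltn_trans ap; rewrite leq_add2l. Qed.

Lemma point_set_periodic : periodic n point_set.
Proof. by move=> q; rewrite /point_set addnAC modnDr. Qed.

Lemma point_set_add w : (w < p)%N -> point_set (a + w)%N = (w \in l).
Proof.
move=> wp; rewrite /point_set (_ : (a + w + (p - a) = w + p)%N); last by have := a_lt; lia.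
by rewrite modnDr modn_small.
Qed.

Lemma point_set_window q : (a <= q <= a + p)%N ->
  point_set q = (q \in a :: rcons (map (addn a) s) (a + p)%N).
Proof.
move=> /andP[aq qp]; rewrite -(subnKC aq); set w := (q - a)%N.
have -> : ((a + w)%N \in a :: rcons (map (addn a) s) (a + p)%N) = (w \in 0%N :: rcons s p).
  have -> : a :: rcons (map (addn a) s) (a + p)%N = map (addn a) (0%N :: rcons s p).
    by rewrite /= map_rcons addn0.
  by rewrite mem_map//; exact: addnI.
have [wp|wp] := ltnP w p.
  rewrite point_set_add// /l !in_cons mem_rcons in_cons.
  by rewrite (_ : (w == p) = false)//; clear -wp; lia.
have -> : w = p by move: wp; rewrite /w; clear -qp aq; lia.
rewrite point_set_periodic -[a in LHS]addn0 point_set_add// /l mem_head.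
by rewrite in_cons mem_rcons mem_head orbT.
Qed.

Lemma point_set_lt q : (q < p)%N -> point_set q = (q \in map (addn a) l).
Proof.
move=> qp; have [aq|qa] := leqP a q.
  rewrite -(subnKC aq) point_set_add; last by move: qp; clear; lia.
  by rewrite mem_map//; exact: addnI.
rewrite /point_set modn_small; last by have := a_lt; move: qa; clear; lia.
apply/idP/mapP => [/l_lt|[w _ qE]]; last by exfalso; move: qE qa; clear; lia.
by move: a_lt qa; clear; lia.
Qed.

Lemma point_set_map_path : path ltn a (rcons (map (addn a) s) (a + p)%N).
Proof.
have -> : path ltn a (rcons (map (addn a) s) (a + p)%N) =
    path (relpre (addn a) ltn) 0%N (rcons s p) by rewrite -path_map map_rcons addn0.
by move: sp; apply: sub_path => x y; rewrite /= ltn_add2l.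
Qed.

Lemma point_set_filter : [seq q <- iota 0 p | point_set q] = map (addn a) l.
Proof.
apply: (@irr_sorted_eq _ ltn ltn_trans ltnn).
- exact: sorted_filter ltn_trans _ _ (iota_ltn_sorted _ _).
- have := point_set_map_path; rewrite rcons_path => /andP[+ _].
  by rewrite /= addn0.
- move=> q; rewrite mem_filter mem_iota add0n leq0n andTb.
  have [qp|pq] := ltnP q p; first by rewrite point_set_lt ?andbT.
  rewrite andbF; apply/esym/negbTE/negP => /mapP[w /l_lt wl qE].
  by move: pq; rewrite qE leqNgt wl.
Qed.

Definition point (i : nat) : nat := (a + nth 0%N l (i %% K) + p * (i %/ K))%N.

Lemma point_lt i : (point i < point i.+1)%N.
Proof.
have K0 : (0 < K)%N by [].
have ss : sorted ltn l by move: sp; rewrite rcons_path => /andP[].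
have r_lt := ltn_pmod i K0; have iE := divn_eq i K.
rewrite /point; set r := (i %% K)%N in r_lt iE *; set d := (i %/ K)%N in iE *.
have -> : i.+1 = (d * K + r.+1)%N by rewrite addnS -iE.
have [rK|Kr] := ltnP r.+1 K.
  rewrite divnMDl// modnMDl (divn_small rK) (modn_small rK) addn0.
  rewrite ltn_add2r ltn_add2l.
  by apply: (@sorted_ltn_nth _ ltn ltn_trans 0%N l ss); rewrite ?inE //= ltnW.
have -> : r.+1 = K by move: r_lt Kr; clear; lia.
rewrite divnMDl// modnMDl modnn divnn K0 /= addn0 addn1 mulnS addnA ltn_add2r.
have : nth 0%N l r \in l by rewrite mem_nth.
by move=> /l_lt; clear; lia.
Qed.

Lemma point_mono i j : (i < j)%N -> (point i < point j)%N.
Proof. move=> ij; rewrite -(subnKC ij); elim: (j - i.+1)%N => [|k IH].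
  by rewrite addn0 point_lt.
by rewrite addnS; exact: ltn_trans (point_lt _). Qed.

Lemma point_le i j : (point i < point j)%N = (i < j)%N.
Proof.
have [ij|ji] := ltnP i j; first exact: point_mono.
apply/negbTE; rewrite -leqNgt; move: ji; rewrite leq_eqVlt => /predU1P[->//|].
by move=> /point_mono/ltnW.
Qed.

Lemma point_addK i : point (i + K)%N = (point i + p)%N.
Proof.
by rewrite /point modnDr divnDr// divnn mulnDr muln1 addnA.
Qed.

Lemma pointP q : reflect (exists i, q = point i) (point_set q).
Proof.
have K0 : (0 < K)%N by [].
apply: (iffP idP) => [|[i ->]]; last first.
  have : nth 0%N l (i %% K)%N \in l by rewrite mem_nth//= ltn_pmod.
  move=> rl; have rp := l_lt rl.
  rewrite /point; elim: (i %/ K)%N => [|d IH]; last first.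
    by rewrite mulnS [(p + _)%N]addnC addnA point_set_periodic.
  by rewrite muln0 addn0 point_set_add//; move: rp; clear; lia.
have [aq|qa] := leqP a q; last first.
  rewrite point_set_lt; last by exact: ltn_trans a_lt.
  by move=> /mapP[w _ qE]; exfalso; move: qa; rewrite qE; clear; lia.
have -> : q = (a + (q - a) %% p + p * ((q - a) %/ p))%N.
  by rewrite -addnA [X in (_ + X)%N]addnC mulnC -divn_eq subnKC.
set w := ((q - a) %% p)%N; set d := ((q - a) %/ p)%N.
have wp : (w < p)%N by rewrite ltn_pmod.
have -> : point_set (a + w + p * d)%N = (w \in l).
  rewrite -point_set_add//; elim: d => [|d IH]; first by rewrite muln0 addn0.
  by rewrite mulnS [(p + _)%N]addnC addnA point_set_periodic.
move=> /(nthP 0%N)[j jl <-]; exists (d * K + j)%N.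
by rewrite /point modnMDl modn_small// divnMDl// divn_small// addn0.
Qed.

Section Long.
Variables (R : realType) (N : nat).
Hypothesis pN : (p + p <= N)%N.

(** [point] is increasing and carries translation by the number [K] of points to translation by [p],
    so it respects [noncrossing_mod] and identifies the chords of the [K]-cycle with the long
    chords. *)
Lemma cyclic_long_class :
  realizable R (@cyclic_compat N n) (cyclic_long N n point_set) /\
  flag_class R (@cyclic_compat N n) (cyclic_long N n point_set) =
    class_of (cyclohedron R (size s)).
Proof.
have Kp : (K <= p)%N by have := path_ltn_size sp; rewrite size_rcons last_rcons.
have KN : (K + K <= N)%N by apply: leq_trans pN; apply: leq_add.
pose f (u : chord N) : chord N := mk_chord N (point (ends u).1) (point (ends u).2).
pose A := cyclic_chords N (size s).
have small i : (i < K)%N -> (point i < p)%N.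
  move=> iK; rewrite /point modn_small// divn_small// muln0 addn0.
  by apply: l_lt; rewrite mem_nth.
have AP u : u \in A -> [/\ ((ends u).1 < K)%N, ((ends u).1.+2 <= (ends u).2)%N,
    ((ends u).2 <= (ends u).1 + K)%N & ends (f u) = (point (ends u).1, point (ends u).2)].
  move=> /cyclic_chordsP[u1 u2 u3]; split=> //; apply: mk_chordK.
    have := small _ u1; move: pN; clear; lia.
  have : (point (ends u).2 <= point ((ends u).1 + K))%N.
    by rewrite leqNgt point_le -leqNgt.
  rewrite point_addK; have := small _ u1; move: pN; clear; lia.
have inj i j : point i = point j -> i = j.
  move=> ij; have := point_le i j; have := point_le j i; rewrite ij ltnn.
  by clear; lia.
have finj : {in A &, injective f}.
  move=> u v /AP[_ _ _ uE] /AP[_ _ _ vE] fuv; apply: ends_inj.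
  have := congr1 (@ends N) fuv; rewrite uE vE => -[/inj E1 /inj E2].
  by rewrite [ends u]surjective_pairing E1 E2 -surjective_pairing.
have mono x y : noncrossing (point x.1, point x.2) (point y.1, point y.2) = noncrossing x y.
  by rewrite /noncrossing /crossing /= !point_le.
have fr : {in A &, forall u v, cyclic_compat n (f u) (f v) = cyclic_compat (size s) u v}.
  move=> u v /AP[_ _ _ uE] /AP[_ _ _ vE].
  rewrite /cyclic_compat /noncrossing_mod uE vE /shift /= -!point_addK.
  by rewrite !mono (mono _ (_, _)) (mono (_, _)) -?surjective_pairing.
have imA : f @: A = cyclic_long N n point_set.
  apply/setP => u; apply/imsetP/setIdP => [[v vA ->]|[/cyclic_chordsP[u1 u2 u3] /and3P[]]].
    have [v1 v2 v3 vE] := AP _ vA; rewrite vE /=.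
    have H i : point_set (point i) by apply/pointP; exists i.
    have m1 : (point (ends v).1 < point (ends v).1.+1)%N by rewrite point_le.
    have m2 : (point (ends v).1.+1 < point (ends v).2)%N by rewrite point_le.
    split; last first.
      rewrite !H /=; apply/negP => /freeP/(_ (point (ends v).1.+1)) /=.
      by rewrite m1 m2 H => /(_ isT).
    apply/cyclic_chordsP; rewrite vE /=; split.
    - exact: small.
    - exact: leq_ltn_trans m1 m2.
    - by rewrite -point_addK leqNgt point_le -leqNgt.
  move=> /pointP[i E1] /pointP[j E2] nf.
  have [q [uq /pointP[h qE]]] :
      exists q, ((ends u).1 < q < (ends u).2)%N /\ point_set q.
    apply: contrapT => H; case/negP: nf; apply/freeP => q uq; apply/negP => ql.
    by apply: H; exists q.
  have ihj : (i < h < j)%N by rewrite -(point_le i h) -(point_le h j) -qE -E1 -E2.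
  have iK : (i < K)%N.
    rewrite ltnNge; apply/negP => Ki; move: u1; rewrite E1 -(subnK Ki) point_addK.
    by clear; lia.
  have jiK : (j <= i + K)%N.
    by rewrite leqNgt -point_le point_addK -E1 -E2 -leqNgt.
  have mcK : ends (mk_chord N i j) = (i, j).
    by apply: mk_chordK; move: iK jiK KN; clear; lia.
  exists (mk_chord N i j).
    apply/cyclic_chordsP; rewrite mcK; split=> //=.
    by move: ihj; clear; lia.
  apply: ends_inj; rewrite /f mcK /= -E1 -E2 mk_chordK -?surjective_pairing//;
    by have /andP[] := ends_le u.
have okA : realizable R (@cyclic_compat N (size s)) A.
  exact: links_realizable_class (cyclic_chords_realizable R KN).
rewrite -imA; split; first exact: realizable_imset okA.
by rewrite (flag_class_imset finj fr okA) (cyclic_chords_class R KN).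
Qed.

End Long.
End PointSet.

(** * Uncovered points on the circle *)

Section CyclicUncovered.
Variables (N n : nat).
Local Notation p := n.+1.
Hypothesis pN : (p + p <= N)%N.
Let C := chord N.
Let A := cyclic_chords N n.
Let r := @cyclic_compat N n.
Implicit Types (u v w : C) (P : pred nat) (x y : nat * nat) (T : {set C}).

Definition shiftn k x : nat * nat := (x.1 + k * p, x.2 + k * p)%N.

Lemma shiftnS k x : shiftn k.+1 x = shift n (shiftn k x).
Proof. by rewrite /shiftn /shift /= mulSn addnCA addnC addnCA [X in (_, X)]addnC. Qed.

Lemma shiftn0 x : shiftn 0 x = x.
Proof. by rewrite /shiftn mul0n !addn0 -surjective_pairing. Qed.

Lemma periodicD P q k : periodic n P -> P (q + k * p)%N = P q.
Proof.
move=> perP; elim: k => [|k IH]; first by rewrite mul0n addn0.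
by rewrite mulSn [(p + _)%N]addnC addnA perP.
Qed.

Lemma free_shiftn P x k : periodic n P -> free P (shiftn k x) = free P x.
Proof.
by move=> perP; elim: k => [|k IH]; rewrite ?shiftn0// shiftnS free_shift.
Qed.

(** After removing a common translation, what is left is one of the three conditions of
    [noncrossing_mod] or a translation by at least two periods, which moves the chords apart. *)
Lemma noncrossing_shiftn u v i j : u \in A -> v \in A -> r u v ->
  noncrossing (shiftn i (ends u)) (shiftn j (ends v)).
Proof.
have down k x y : noncrossing (shiftn k x) (shiftn k y) = noncrossing x y.
  by elim: k => [|k IH]; rewrite ?shiftn0// !shiftnS noncrossing_shift.
have add k d x : shiftn (k + d) x = shiftn k (shiftn d x).
  by rewrite /shiftn /= !mulnDl !addnA ![(_ + k * p + _)%N]addnAC.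
have far d x y : (x.2 < p + p)%N -> noncrossing x (shiftn d.+2 y).
  move=> xp; apply: noncrossing_apart; rewrite /shiftn /=; apply: (leq_trans (ltnW xp)).
  have H : (p + p <= d.+2 * p)%N by rewrite addnn -mul2n leq_mul2r orbT.
  exact: leq_trans H (leq_addl _ _).
move=> /cyclic_chordsP[u1 _ u3] /cyclic_chordsP[v1 _ v3] /and3P[n0 n1 n2].
have u2 : ((ends u).2 < p + p)%N by move: u1 u3; clear; lia.
have v2 : ((ends v).2 < p + p)%N by move: v1 v3; clear; lia.
have [ij|ji] := leqP i j.
  rewrite -(subnKC ij) add down; case: (j - i)%N => [|[|d]]; last exact: far.
    by rewrite shiftn0.
  by rewrite shiftnS shiftn0.
rewrite -(subnKC (ltnW ji)) add down; case: (i - j)%N => [|[|d]].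
- by rewrite shiftn0.
- by rewrite shiftnS shiftn0.
- by rewrite noncrossing_sym; exact: far.
Qed.

Lemma chord_of_interval c d : (c.+2 <= d)%N -> (d <= c + p)%N ->
  exists u k, u \in A /\ (c, d) = shiftn k (ends u).
Proof.
move=> cd dc; exists (mk_chord N (c %% p) (d - c %/ p * p)), (c %/ p)%N.
have cE := divn_eq c p; have cp : (c %% p < p)%N by rewrite ltn_pmod.
set m := (c %% p)%N in cE cp *; set q := (c %/ p * p)%N in cE *.
have mcK : ends (mk_chord N m (d - q)) = (m, d - q)%N.
  by apply: mk_chordK; move: pN cE cp cd dc; clear; lia.
split; last by rewrite /shiftn mcK /= -/q; congr pair; move: cE cd; clear; lia.
by apply/cyclic_chordsP; rewrite mcK /=; move: cE cp cd dc; clear; split; lia.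
Qed.

(** A chord starting in [0, p) ends before 2p, so only two lifts of the residue of [q] can be inside
    it. The bound [p <= q] makes the translation for the second lift a nonnegative multiple of the
    period. *)
Lemma lift_coverP u q : u \in A -> (p <= q)%N -> reflect
  (exists k, ((shiftn k (ends u)).1 < q < (shiftn k (ends u)).2)%N)
  (((ends u).1 < q %% p < (ends u).2)%N || ((ends u).1 < q %% p + p < (ends u).2)%N).
Proof.
move=> /cyclic_chordsP[u1 _ u3] pq.
have qE := divn_eq q p; have qp : (q %% p < p)%N by rewrite ltn_pmod.
have d0 : (0 < q %/ p)%N by rewrite divn_gt0.
set m := (q %% p)%N in qE qp *; set d := (q %/ p)%N in qE d0 *.
apply: (iffP orP) => [[H|H]|[k]].
- by exists d; rewrite /shiftn /= qE; move: H; clear; lia.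
- exists d.-1; have dE : (d * p = p + d.-1 * p)%N by rewrite -mulSn prednK.
  by rewrite /shiftn /= qE dE; move: H; clear; lia.
rewrite /shiftn /= qE.
have [dk|kd] := ltnP d k.
  have : (d.+1 * p <= k * p)%N by rewrite leq_mul2r dk orbT.
  by rewrite mulSn => H1 H2; exfalso; move: H1 H2 qp; clear; lia.
rewrite -(subnKC kd) mulnDl; case: (d - k)%N => [|[|e]] H; [left|right|exfalso].
- by move: H; clear; lia.
- by move: H; clear; lia.
- by move: H u1 u3; rewrite !mulSn; clear; lia.
Qed.

Definition cyclic_uncovered T : pred nat := fun q =>
  [forall u in T, ~~ (((ends u).1 < q %% p < (ends u).2)%N ||
                      ((ends u).1 < q %% p + p < (ends u).2)%N)].

Lemma cyclic_uncovered_periodic T : periodic n (cyclic_uncovered T).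
Proof. by move=> q; rewrite /cyclic_uncovered modnDr. Qed.

Lemma cyclic_uncoveredP T q : T \subset A -> (p <= q)%N -> reflect
  (forall u k, u \in T -> ~~ ((shiftn k (ends u)).1 < q < (shiftn k (ends u)).2)%N)
  (cyclic_uncovered T q).
Proof.
move=> /subsetP TA pq; apply: (iffP forall_inP) => H u.
  by move=> k uT; apply: contra (H u uT) => uk; apply/(lift_coverP (TA _ uT) pq); exists k.
by move=> uT; apply/negP => /(lift_coverP (TA _ uT) pq)[k]; exact/negP/H.
Qed.

Lemma free_wall P c d : periodic n P -> P c -> free P (c, d) -> (d <= c + p)%N.
Proof.
move=> perP Pc /freeP cdf; rewrite leqNgt; apply/negP => cd.
by have := cdf (c + p)%N; rewrite perP Pc /= cd => H; have := H _; clear; lia.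
Qed.

Lemma cyclic_uncovered_cells P T a : periodic n P -> (a < p)%N -> P a ->
  cyclic_walls N n P \subset T -> T \subset cyclic_cells N n P ->
  cyclic_uncovered T = P.
Proof.
move=> perP ap Pa /subsetP wT /subsetP TE; apply: funext => q0.
have TA : T \subset A by apply/subsetP => u /TE/setIdP[].
(* One period is added so that [cyclic_uncoveredP] applies. *)
rewrite -[P q0]perP -[LHS]cyclic_uncovered_periodic.
have : (p <= q0 + p)%N by rewrite leq_addl.
move: (q0 + p)%N => q pq.
apply/(cyclic_uncoveredP TA pq)/idP => [unc|Pq u k /TE/setIdP[_ uf]]; last first.
  by apply: contraL Pq => uk; apply: freeP uk; rewrite free_shiftn.
apply: contrapT => /negP nPq.
(* A point of [P] to the right of [q], which makes the next point of [P] after [q] exist. *)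
have Phi : P (a + q * p)%N by rewrite periodicD.
have aq : (a < q)%N by exact: leq_trans pq.
have qhi : (q < a + q * p)%N.
  have ne : q != (a + q * p)%N by apply: contraNneq nPq => {1}->.
  have : (q * 1 <= q * p)%N by rewrite leq_mul2l orbT.
  by rewrite muln1; move: ne; clear; lia.
have [p0 [P0 l0 u0]] := prev_point Pa aq.
have [p1 [P1 l1 u1]] := next_point Phi qhi.
have fr : free P (p0, p1).
  apply/freeP => z /= z01; have [->//|ne] := eqVneq z q.
  by have [?|?] := ltnP z q; [apply: u0|apply: u1]; move: l0 l1 z01 ne; lia.
have dp := free_wall perP P0 fr.
have [|w [k [wA wE]]] := @chord_of_interval p0 p1 _ dp; first by move: l0 l1; clear; lia.
have wT' : w \in T.
  apply: wT; apply/setIdP; split.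
    by apply/setIdP; rewrite -(free_shiftn _ k perP) -wE.
  have E0 : p0 = ((ends w).1 + k * p)%N := congr1 fst wE.
  have E1 : p1 = ((ends w).2 + k * p)%N := congr1 snd wE.
  rewrite -(periodicD (ends w).1 k perP) -(periodicD (ends w).2 k perP) -E0 -E1.
  by rewrite P0 P1.
have := unc w k wT'; rewrite -wE /=; move: l0 l1; clear; lia.
Qed.

Lemma cyclic_walls_uncovered T : T \subset A -> {in T &, forall u v, r u v} ->
  cyclic_walls N n (cyclic_uncovered T) \subset T /\
  T \subset cyclic_cells N n (cyclic_uncovered T).
Proof.
move=> TA Tc; have perU := cyclic_uncovered_periodic T.
have TA' := subsetP TA; split; last first.
  apply/subsetP => u uT; apply/setIdP; split; first exact: TA'.
  apply/freeP => q uq; apply/negP; rewrite -perU.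
  move=> /(cyclic_uncoveredP TA (leq_addl _ _))/(_ u 1%N uT).
  by rewrite /shiftn mul1n /= !ltn_add2r uq.
apply/subsetP => w /setIdP[/setIdP[/cyclic_chordsP[w1 w2 w3] wf] /andP[U1 U2]].
pose S : pred (nat * nat) := fun x => `[< exists u k, u \in T /\ x = shiftn k (ends u) >].
(* The argument of the line is applied to all translates of [T], at the wall moved by one period so
   that its points are at least [p]. The chord found is then the first translate of an element of
   [T]. *)
have : S ((ends w).1 + p, (ends w).2 + p)%N.
  apply: covered_interval.
  - move=> x y /asboolP[u [i [uT ->]]] /asboolP[v [j [vT ->]]].
    by apply: noncrossing_shiftn; [exact: TA'|exact: TA'|exact: Tc].
  - by move: w2; clear; lia.
  - move=> x /asboolP[u [k [uT ->]]]; move: U1; rewrite -perU.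
    by move=> /(cyclic_uncoveredP TA (leq_addl _ _)); exact.
  - move=> x /asboolP[u [k [uT ->]]]; move: U2; rewrite -perU.
    by move=> /(cyclic_uncoveredP TA (leq_addl _ _)); exact.
  move=> q wq; have pq : (p <= q)%N by move: wq; clear; lia.
  have nU : ~~ cyclic_uncovered T q.
    rewrite -(subnK pq) perU; apply: (freeP _ _ wf); move: wq pq; clear; lia.
  apply: contrapT => H; case/negP: nU; apply/(cyclic_uncoveredP TA pq) => u k uT.
  apply/negP => uq; apply: H; exists (shiftn k (ends u)) => //.
  by apply/asboolP; exists u, k.
case/asboolP => u [k [uT E]]; have /cyclic_chordsP[u1 _ _] := TA' _ uT.
have E1 := congr1 fst E; have E2 := congr1 snd E; rewrite /= in E1 E2.
have k1 : k = 1%N.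
  case: k E1 {E E2} => [|[|k]]; [move: u1; clear; lia|by []|].
  by rewrite !mulSn; move: w1; clear; lia.
rewrite k1 mul1n in E1 E2.
suff -> : w = u by [].
apply: ends_inj; rewrite [ends w]surjective_pairing [ends u]surjective_pairing.
by congr pair; [move: E1|move: E2]; clear; lia.
Qed.

(** The left end of a longest chord is uncovered: a chord passing over it or over its translate
    would, not crossing, contain a copy of the longest chord and be longer. *)
Lemma cyclic_uncovered_exists T : T \subset A -> {in T &, forall u v, r u v} ->
  exists2 q, (q < p)%N & cyclic_uncovered T q.
Proof.
move=> /subsetP TA Tc; have [->|[u0 u0T]] := set_0Vmem T.
  by exists 0%N => //; apply/forall_inP => u; rewrite inE.
have [u uT umax] := @arg_maxnP _ u0 (mem T) (fun u : C => (ends u).2 - (ends u).1)%N u0T.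
have {}uT : u \in T by [].
have /cyclic_chordsP[u1 u2 _] := TA _ uT.
exists (ends u).1 => //; apply/forall_inP => v vT; rewrite modn_small//.
have /and3P[n0 _ n2] := Tc _ _ uT vT.
have := umax v vT; rewrite /geq /=.
move: n0 n2 u2; rewrite /noncrossing /crossing /shift /=; clear; lia.
Qed.

Lemma cyclic_long_noncrossing P u v : periodic n P ->
  u \in cyclic_long N n P -> v \in cyclic_cells N n P -> r u v && r v u.
Proof.
move=> perP /setIdP[_ /and3P[P1 P2 _]] /setIdP[_ vf].
have sym x y : noncrossing_mod n x y = noncrossing_mod n y x.
  by rewrite /noncrossing_mod noncrossing_sym andbCA andbC
    (noncrossing_sym (shift n y)) (noncrossing_sym y (shift n x)) -andbA andbC.
rewrite /r /cyclic_compat (sym (ends v)) andbb.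
have key x y : P x.1 -> P x.2 -> free P y -> noncrossing x y.
  move=> Px1 Px2 yf; have ny q : P q -> ~~ (y.1 < q < y.2)%N.
    by move=> Pq; apply: contraL Pq => ?; exact: (freeP _ _ yf).
  by have := ny _ Px1; have := ny _ Px2; rewrite /noncrossing /crossing; clear; lia.
apply/and3P; split; apply: key; rewrite ?free_shift ?/shift ?perP//.
Qed.

Lemma cyclic_longP P u a : periodic n P -> (a < p)%N -> P a ->
    u \in A -> u \notin cyclic_cells N n P ->
    {in cyclic_walls N n P, forall w, r u w} ->
  u \in cyclic_long N n P.
Proof.
move=> perP ap Pa uA uE uB; have /cyclic_chordsP[u1 u2 u3] := uA.
have nf : ~~ free P (ends u) by apply: contraNN uE => uf; apply/setIdP.
(* Moved by one period, the chord lies between the points [a] and [a + 3 * p] of [P]. *)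
have Phi : P (a + 3 * p)%N by rewrite periodicD.
suff : P (shift n (ends u)).1 && P (shift n (ends u)).2.
  rewrite /shift /= !perP => /andP[P1 P2].
  by apply/setIdP; rewrite P1 P2 nf.
apply: (noncrossing_walls Pa Phi) => //.
- by rewrite /shift /=; move: ap; clear; lia.
- by rewrite /shift /=; move: u1 u3; clear; lia.
- move=> c d Pc Pd _ _ cd cdf; have dp := free_wall perP Pc cdf.
  have [w [k [wA wE]]] := chord_of_interval cd dp.
  rewrite wE -[ends u]shiftn0 -shiftnS; apply: noncrossing_shiftn => //.
  apply: uB; apply/setIdP; split.
    by apply/setIdP; rewrite -(free_shiftn _ k perP) -wE.
  have E0 : c = ((ends w).1 + k * p)%N := congr1 fst wE.
  have E1 : d = ((ends w).2 + k * p)%N := congr1 snd wE.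
  rewrite -(periodicD (ends w).1 k perP) -(periodicD (ends w).2 k perP) -E0 -E1.
  by rewrite Pc Pd.
- by rewrite free_shift.
Qed.

End CyclicUncovered.

(** * Generating series *)

Lemma mulr_scale_nat (K : algType rat) (m x y : K) a b :
  a%:R * x = b.+1%:R * y -> m * y = (a%:R / b.+1%:R : rat) *: (m * x).
Proof.
move=> E; have {}E : x *+ a = y *+ b.+1 by rewrite -[LHS]mulr_natl E mulr_natl.
rewrite [X in X *: _]mulrC -scalerA scaler_nat -mulrnAr E mulrnAr -scaler_nat scalerA.
by rewrite mulVf ?scale1r// pnatr_eq0.
Qed.

Lemma scale_div_mul (K : algType rat) (m x : K) a b :
  (a.+1%:R^-1 : rat) *: ((a.+1%:R / b.+1%:R : rat) *: (m * x)) =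
  ((b.+1%:R^-1 : rat) *: m) * x.
Proof. by rewrite scalerA mulrA mulVf ?pnatr_eq0// mul1r scalerAl. Qed.

Lemma sum_path_gap_weight (K : comNzRingType) (f F : nat -> K) m : f 0%N = 0 ->
  \sum_(s <- path_seqs m) F (size s) * gap_weight f f m.+2 0 s =
  \sum_(k < m.+1) F k.+1 * fps_exp f k.+2 m.+2.
Proof.
move=> f0; rewrite /path_seqs big_allpairs_dep -[iota 0 m.+1]/(index_iota 0 m.+1) big_mkord.
apply: eq_bigr => k _; rewrite fps_exp_iter -[m.+2 in RHS]subn0.
rewrite -(@sum_gap_weight _ f f 0 m.+2 k.+1)// mulr_sumr.
rewrite big_seq [RHS]big_seq; apply: eq_bigr => s.
by rewrite increasing_seqsP// => /andP[/eqP-> _].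
Qed.

(** * The motivic interior of the cyclohedron as a sum over uncovered sets *)

Section CyclicIdentity.
Variables (R : realType) (n : nat).
Local Notation p := n.+1.
Let N := (p + p)%N.
Let r := @cyclic_compat N n.
Let A := cyclic_chords N n.

(* [(a, s)] stands for the subset of [0, p) with least element [a] and other
   elements [a + v], [v] in [s]; its last gap has length [p - last 0 s]. *)
Definition cyclic_seqs : seq (nat * seq nat) :=
  [seq (a, s) | s <- [seq s | k <- iota 0 p, s <- increasing_seqs p k 0],
                a <- iota 0 (p - last 0%N s)].

Let base_seqs := [seq s | k <- iota 0 p, s <- increasing_seqs p k 0].

Lemma base_seqsP s : (s \in base_seqs) = path ltn 0%N (rcons s p).
Proof.
apply/allpairsPdep/idP => [[k [s' [_ + ->]]]|sp].
  by rewrite increasing_seqsP// => /andP[].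
exists (size s), s; rewrite increasing_seqsP// eqxx sp mem_iota; split=> //.
by have := path_ltn_size sp; rewrite size_rcons last_rcons.
Qed.

Lemma base_seqs_uniq : uniq base_seqs.
Proof.
apply: allpairs_uniq_dep; first exact: iota_uniq.
  by move=> k _; exact: increasing_seqs_uniq.
move=> [k s] [k' s'] /allpairsPdep[k1 [s1 [_ + [-> ->]]]] /allpairsPdep[k2 [s2 [_ + [-> ->]]]] /=.
rewrite !increasing_seqsP// => /andP[/eqP e1 _] /andP[/eqP e2 _] E.
by move: e1 e2; rewrite E => -> ->.
Qed.

Lemma cyclic_seqsP a s : reflect
  ((a + last 0%N s < p)%N /\ path ltn 0%N (rcons s p)) ((a, s) \in cyclic_seqs).
Proof.
have lastE t : path ltn 0%N (rcons t p) -> (last 0%N t < p)%N.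
  by rewrite rcons_path => /andP[].
apply: (iffP allpairsPdep) => [[s' [a' [+ + [-> ->]]]]|[al sp]].
  by rewrite base_seqsP => sp; rewrite mem_iota => H; split=> //; have := lastE _ sp; lia.
by exists s, a; split=> //; [rewrite base_seqsP|rewrite mem_iota; lia].
Qed.

Lemma cyclic_seqs_uniq : uniq cyclic_seqs.
Proof.
apply: allpairs_uniq_dep; first exact: base_seqs_uniq.
  by move=> s _; exact: iota_uniq.
by move=> [s a] [s' a'] _ _ /= [-> ->].
Qed.

Lemma cyclic_motivic_interior :
  to_rat (motivic_interior (cyclohedron R n)) =
  \sum_(j <- cyclic_seqs) mkmalgU (class_of (cyclohedron R (size j.2))) 1 *
    gap_weight (beta_series R) (beta_series R) p 0 j.2.
Proof.
have pN : (p + p <= N)%N by [].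
rewrite -(cyclic_chords_sum R pN) -/r -/A.
pose P (j : nat * seq nat) := point_set n j.1 j.2.
have jP j : j \in cyclic_seqs -> [/\ (j.1 + last 0%N j.2 < p)%N, path ltn 0%N (rcons j.2 p),
    (j.1 < p)%N, periodic n (P j) & P j j.1].
  case: j => a s /cyclic_seqsP[al sp]; split=> //=.
  - exact: leq_ltn_trans (leq_addr _ _) al.
  - exact: point_set_periodic.
  - by rewrite /P /= -[X in point_set _ _ _ X]addn0 (point_set_add al sp)//= mem_head.
have shift_weight a s b c : gap_weight (beta_series R) (beta_series R) (a + b) (a + c) (map (addn a) s) =
    gap_weight (beta_series R) (beta_series R) b c s.
  by elim: s c => [|v s IH] c /=; rewrite ?IH subnDl.
have okE j : j \in cyclic_seqs ->
    links_realizable R r (cyclic_cells N n (P j)) (cyclic_walls N n (P j)) /\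
    flag_sum R r (cyclic_cells N n (P j)) (cyclic_walls N n (P j)) =
    gap_weight (beta_series R) (beta_series R) p 0 j.2.
  move=> /jP[al sp ap perP _].
  have [|ok ->] := @cyclic_cells_sum R N n pN (P j) j.1 (map (addn j.1) j.2) ap perP
      (point_set_map_path j.1 sp); first exact: (point_set_window al sp).
  by split=> //; rewrite -[X in gap_weight _ _ _ X]addn0 shift_weight.
rewrite (@flag_sum_fibration R _ r A _ cyclic_seqs (fun j => cyclic_cells N n (P j))
  (fun j => cyclic_walls N n (P j)) (fun j => cyclic_long N n (P j))).
- apply: eq_big_seq => j jJ; have [al sp _ _ _] := jP _ jJ.
  by rewrite (okE j jJ).2 (cyclic_long_class al sp R pN).2.
- exact: cyclic_seqs_uniq.
- move=> j _; split.
  + by apply/subsetP => u /setIdP[].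
  + by apply/subsetP => u /setIdP[].
  + apply/pred0P => u /=; apply/negP => /andP[/setIdP[_ /and3P[_ _ nf]] /setIdP[_ uf]].
    by rewrite uf in nf.
- by move=> j u v /jP[_ _ _ perP _]; exact: cyclic_long_noncrossing.
- by move=> j u /jP[_ _ ap perP Pa] uA uE; exact: (cyclic_longP pN perP ap Pa uA uE).
- move=> j jJ; have [al sp _ _ _] := jP _ jJ.
  by split; [exact: (cyclic_long_class al sp R pN).1|exact: (okE j jJ).1].
move=> T cT; have [TA Tc] := cliquesP cT.
have [wT TE] := cyclic_walls_uncovered TA Tc.
have perU := cyclic_uncovered_periodic n T.
set U := cyclic_uncovered n T in wT TE perU.
have [q qp Uq] := cyclic_uncovered_exists TA Tc.
(* The uncovered points in [0, p) form a nonempty list, whose head is [a] and whose tail minus [a]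
   will be [s]. *)
have [a [t FE]] : exists a t, [seq q <- iota 0 p | U q] = a :: t.
  case F : [seq q <- iota 0 p | U q] => [|a t]; last by exists a, t.
  have : q \in [seq q <- iota 0 p | U q] by rewrite mem_filter [U q]Uq mem_iota.
  by rewrite F.
have at_sorted : path ltn a t.
  by have := sorted_filter ltn_trans U (iota_ltn_sorted 0 p); rewrite FE.
have at_lt z : z \in a :: t -> (z < p)%N by rewrite -FE mem_filter mem_iota => /and3P[].
pose s := map (subn^~ a) t.
have sE : map (addn a) (0%N :: s) = a :: t.
  rewrite /= addn0 /s -map_comp; congr cons; rewrite -[RHS]map_id.
  apply/eq_in_map => z zt /=; apply: subnKC.
  by have /allP/(_ _ zt)/ltnW := order_path_min ltn_trans at_sorted.
have tE : map (addn a) s = t by move: sE; rewrite /= addn0 => -[].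
have last_s : (a + last 0%N s = last a t)%N.
  by have := last_map (addn a) s 0%N; rewrite addn0 tE.
have jJ : (a, s) \in cyclic_seqs.
  apply/cyclic_seqsP; split; first by rewrite last_s at_lt// mem_last.
  have pE z : path ltn 0%N (rcons z p) = path ltn a (rcons (map (addn a) z) (a + p)%N).
    have -> : path ltn a (rcons (map (addn a) z) (a + p)%N) =
      path (relpre (addn a) ltn) 0%N (rcons z p) by rewrite -path_map map_rcons addn0.
    by apply: eq_path => x y; rewrite /= ltn_add2l.
  rewrite pE tE rcons_path at_sorted /=.
  by apply: leq_trans (at_lt _ (mem_last _ _)) (leq_addl _ _).
have [al sp ap perP _] := jP _ jJ.
have PU : P (a, s) = U.
  apply: funext => z; rewrite (divn_eq z p) addnC !periodicD//.
  have zp : (z %% p < p)%N by rewrite ltn_pmod.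
  apply: etrans (point_set_lt al sp zp) _.
  by rewrite sE -FE mem_filter mem_iota add0n leq0n zp !andbT.
exists (a, s) => // -[a' s'] jJ'; apply/cliques_overP/eqP => [[/cliquesP[TE' _] wT']|[-> ->]].
  have [al' sp' ap' perP' Pa'] := jP _ jJ'.
  have UE := cyclic_uncovered_cells pN perP' ap' Pa' wT' TE'.
  (* The increasing list of the uncovered points in [0, p) gives back the pair, its head being
     [a']. *)
  have := point_set_filter al' sp'; rewrite -[point_set _ _ _]/(P (a', s')) -UE -/U FE -sE.
  move=> E; have aE : a = a' by have := congr1 (head 0%N) E; rewrite /= !addn0.
  by move: E; rewrite aE => /(inj_map (@addnI a'))[->].
by rewrite PU; split=> //; apply/cliquesP.
Qed.

Lemma cyclic_motivic_interior_series :
  to_rat (motivic_interior (cyclohedron R n)) =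
  \sum_(k < p) (p%:R / k.+1%:R : rat) *: (mkmalgU (class_of (cyclohedron R k)) 1 *
    fps_exp (beta_series R) k.+1 p).
Proof.
rewrite cyclic_motivic_interior /cyclic_seqs 2!big_allpairs_dep.
rewrite -[iota 0 p]/(index_iota 0 p) big_mkord; apply: eq_bigr => k _ /=.
pose D i : polytope_ringQ R := i%:R * beta_series R i.
(* The number of values of [a] for a given [s] is [p - last 0 s], the factor provided by
   [gap_weight_last]. *)
transitivity (\sum_(s <- increasing_seqs p k 0)
    mkmalgU (class_of (cyclohedron R k)) 1 * gap_weight (beta_series R) D p 0 s).
  rewrite big_seq [RHS]big_seq; apply: eq_bigr => s.
  rewrite increasing_seqsP// => /andP[/eqP sk sp].
  rewrite gap_weight_last big_const_seq count_predT size_iota iter_addr_0 sk.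
  by rewrite mulr_natl mulrnAr.
rewrite -mulr_sumr sum_gap_weight//; last by rewrite /D mul0r.
rewrite subn0; apply: mulr_scale_nat.
exact: fps_exp_deriv.
Qed.

End CyclicIdentity.

Section Main.
Variable R : realType.

Lemma alpha_comp_beta :
  fps_comp (alpha_series R) (beta_series R) = @fps_X (polytope_ringQ R).
Proof.
apply: funext => -[|[|m]].
- exact: fps_comp0.
- by rewrite fps_compS// big_ord1 mul1r fps_exp_iter.
(* The linear term of alpha contributes the coefficient of beta itself, minus a motivic interior,
   and the remaining terms cancel it. *)
rewrite fps_comp_split// [beta_series R m.+2]/= path_motivic_interior.
rewrite (@sum_path_gap_weight _ (beta_series R)
  (fun k => mkmalgU (class_of (associahedron R k.-1)) 1) m erefl).
apply/eqP; rewrite addrC subr_eq0; apply/eqP; apply: eq_bigr => k _.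
by rewrite [alpha_series R _]/= to_rat_poly_class.
Qed.

(** The ratio [n.+1 / k.+1] coming from the derivative turns the weight 1/(n+1) on the left into the
    weight 1/(k+1) of [W_series]; this is why [W_n] is divided by n. *)
Lemma Wint_comp : Wint_series R = fps_comp (W_series R) (beta_series R).
Proof.
apply: funext => -[|n]; first by rewrite fps_comp0.
rewrite fps_compS// [LHS]/= cyclic_motivic_interior_series scaler_sumr.
apply: eq_bigr => k _; rewrite [W_series R _]/= to_rat_poly_class.
exact: scale_div_mul.
Qed.

End Main.

Theorem theorem6p1 (R : realType) :
  Wint_series R = fps_comp (W_series R) (beta_series R) /\
  fps_comp (alpha_series R) (beta_series R) = @fps_X (polytope_ringQ R) /\
  fps_comp (beta_series R) (alpha_series R) = @fps_X (polytope_ringQ R).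
Proof.
split; first exact: Wint_comp.
split; first exact: alpha_comp_beta.
exact: fps_comp_inverse (alpha_comp_beta R).
Qed.
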